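(* The uniform limit $\lim_{n\to+\infty}\tilde v_n(p)$ (on $\Delta(S)$) of the values of the games $G_n(p)$ with endogenous transitions exists and is the unique viscosity solution of the Hamilton–Jacobi equation $$\min\left\{rw(p)+H(p,Dw(p))\ ;\ -\lambda_{\max}(p,D^2w(p))\right\}=0\qquad\text{in }\Delta(S),$$ where $$H(p,\xi)=\min_{x\in\Delta(A)}\max_{y\in\Delta(B)}\left\{-\langle{}^T\!R(x,y)p,\xi\rangle-r\,g(p,x,y)\right\},\qquad p\in\Delta(S),\ \xi\in\mathbf R^{|S|}.$$
   Context: Game. $S$ is a finite set of states, $A,B$ are finite action sets, $g:S\times A\times B\to\mathbf R$ is the payoff function, $r>0$ is a fixed discount rate; $\Delta(S)\subset\mathbf R^{|S|}$ is the set of probability distributions on $S$. The rates $R(s,s';a,b)$ satisfy $R(s,s';a,b)\ge0$ for $s'\ne s$ and $\sum_{s'\in S}R(s,s';a,b)=0$ for all $(s,a,b)\in S\times A\times B$. For fixed $(a,b)$, $R(a,b)$ is the matrix $(R(s,s';a,b))_{s,s'}$ and $P_t(a,b)=\exp(tR(a,b))$ is the transition semigroup of the Markov chain with these rates. For $x\in\Delta(A),y\in\Delta(B)$: $R(x,y)=\sum_{a,b}x(a)y(b)R(a,b)$ and $g(p,x,y)=\sum_{s,a,b}p(s)x(a)y(b)g(s,a,b)$. ${}^T\!M$ is the transpose of $M$. For $n\ge1$ and $p\in\Delta(S)$, $G_n(p)$ is the two-player zero-sum game with stages $k=0,1,2,\dots$ in which $s_0^{(n)}$ is drawn according to $p$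 and, at each stage $k$, the players simultaneously choose $a_k\in A$ (player 1, maximizer) and $b_k\in B$ (player 2, minimizer), the stage payoff is $g(s_k^{(n)},a_k,b_k)$, and then $s_{k+1}^{(n)}$ is drawn according to $P_{1/n}(s_k^{(n)},\cdot\,;a_k,b_k)$. Player 1 observes past and current states $s_0^{(n)},\dots,s_k^{(n)}$ before choosing $a_k$; player 2 does not observe states; both players observe all past actions; payoffs are not observed. Players use behavior strategies. The payoff to player 1 is the expectation of $\sum_{k\ge0}\lambda_n(1-\lambda_n)^kg(s_k^{(n)},a_k,b_k)$, with $\lambda_n:=1-e^{-r/n}$. $\tilde v_n(p)$ is the value of $G_n(p)$. Viscosity solutions. For $p\in\Delta(S)$ let $T_{\Delta(S)}(p):=\{z\in\mathbf R^{|S|}:\exists\varepsilon>0,\ p+\varepsilon z\in\Delta(S),\ p-\varepsilon z\in\Delta(S)\}$. For a symmetric matrix $X\in\mathbf R^{|S|\times|S|}$ let $\lambda_{\max}(p,X):=\sup\{\langle Xz,z\rangle/|z|^2: z\in T_{\Delta(S)}(p)\setminus\{0\}\}$, with $\lambda_{\max}(p,X)=-\infty$ if $T_{\Delta(S)}(p)=\{0\}$. A map $w:\Delta(S)\to\mathbf R$ is a viscosity subsolution of the equation if it is upper semicontinuous and, for any smooth $\phi:\mathbf R^{|S|}\to\mathbf R$ such that $w-\phi$ has a local maximum on $\Delta(S)$ at a point $p\in\Delta(S)$, one has $\min\{rw(p)+H(p,D\phi(p));-\lambda_{\max}(p,D^2\phi(p))\}\le0$. It is a viscosity supersolution if it is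 lower semicontinuous and, for any smooth $\phi$ such that $w-\phi$ has a local minimum on $\Delta(S)$ at $p\in\Delta(S)$, one has $\min\{rw(p)+H(p,D\phi(p));-\lambda_{\max}(p,D^2\phi(p))\}\ge0$. It is a viscosity solution if it is both. *)

(* Defs.v *)
From HB Require Import structures.
From mathcomp Require Import all_boot all_order all_algebra.
From mathcomp Require Import all_classical all_reals all_analysis.

Set Implicit Arguments.
Unset Strict Implicit.
Unset Printing Implicit Defensive.

Import Order.TTheory GRing.Theory Num.Theory.
Import numFieldNormedType.Exports.

Local Open Scope classical_set_scope.
Local Open Scope ring_scope.

Section Simplex.
Context {R : realType}.

Definition simplex (T : finType) : set (T -> R) :=
  [set x | (forall t, 0 <= x t) /\ \sum_t x t = 1].

(* The state set is 'I_N. Vectors of R^N are row vectors, so that [p *m M] is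
   the transpose of the column vector M^T p. *)
Definition state_simplex (N : nat) : set 'rV[R]_N :=
  [set p | simplex (p ord0)].

Definition dot (N : nat) (u v : 'rV[R]_N) : R :=
  \sum_i u ord0 i * v ord0 i.

Definition expmx (N : nat) (M : 'M[R]_N) : 'M[R]_N :=
  limn (series (fun k => (k`!)%:R^-1 *: M ^+ k)).

End Simplex.

Arguments simplex {R} T _.
Arguments state_simplex {R} N _.

(* A discounted zero-sum stochastic game in which player 1 observes the states
   and the actions, and player 2 observes only the actions. [P a b s s'] is the
   probability of moving from s to s', and [l] is the weight of the first
   stage. *)
Section Game.
Context {R : realType} {N : nat} {A B : finType}.
Variables (g : 'I_N -> A -> B -> R) (P : A -> B -> 'M[R]_N) (l : R).

Definition stage : finType := ('I_N * A * B)%type.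

(* The stage k is the length of the list of past stages; that list is in
   chronological order. *)
Definition strategy1 := seq stage -> 'I_N -> A -> R.
Definition strategy2 := seq (A * B) -> B -> R.

Definition behavior1 : set strategy1 :=
  [set sigma | forall past s, simplex A (sigma past s)].
Definition behavior2 : set strategy2 :=
  [set tau | forall past, simplex B (tau past)].

Definition actions (z : stage) : A * B := (z.1.2, z.2).

(* Probability that the play continues with [h] after [past], where [q] is the
   law of the current state given [past]. *)
Fixpoint play_prob (sigma : strategy1) (tau : strategy2) (past : seq stage)
    (q : 'I_N -> R) (h : seq stage) : R :=
  if h is (s, a, b) :: h' then
    q s * sigma past s a * tau (map actions past) b *
    play_prob sigma tau (rcons past (s, a, b)) (P a b s) h'
  else 1.

Definition discounted_sum (K : nat) (h : K.-tuple stage) : R :=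
  \sum_(k < K) l * (1 - l) ^+ k *
    g (tnth h k).1.1 (tnth h k).1.2 (tnth h k).2.

(* The expectation of the infinite discounted sum. Since g is bounded and
   0 < l <= 1, it is the limit over K of the expectations of the K-stage sums,
   which only involve the law of the first K stages. *)
Definition payoff (p : 'rV[R]_N) (sigma : strategy1) (tau : strategy2) : R :=
  limn (fun K => \sum_(h : K.-tuple stage)
    play_prob sigma tau [::] (p ord0) h * discounted_sum h).

Definition is_value (p : 'rV[R]_N) (v : R) : Prop :=
  v%:E = ereal_sup [set ereal_inf [set (payoff p sigma tau)%:E
                                  | tau in behavior2] | sigma in behavior1]
  /\
  v%:E = ereal_inf [set ereal_sup [set (payoff p sigma tau)%:E
                                  | sigma in behavior1] | tau in behavior2].

End Game.

(* [Q a b s s'] is the rate R(s, s'; a, b). *)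
Section Rates.
Context {R : realType} {N : nat} {A B : finType}.
Variables (g : 'I_N -> A -> B -> R) (r : R) (Q : A -> B -> 'M[R]_N).

Definition is_rate : Prop :=
  (forall s s' a b, s' != s -> 0 <= Q a b s s') /\
  (forall s a b, \sum_s' Q a b s s' = 0).

Definition transition (n : nat) (a : A) (b : B) : 'M[R]_N :=
  expmx (n%:R^-1 *: Q a b).

Definition discount (n : nat) : R := 1 - expR (- (r / n%:R)).

Definition is_game_value (n : nat) (p : 'rV[R]_N) (v : R) : Prop :=
  is_value g (transition n) (discount n) p v.

Definition mean_rate (x : A -> R) (y : B -> R) : 'M[R]_N :=
  \sum_a \sum_b (x a * y b) *: Q a b.

Definition mean_payoff (p : 'rV[R]_N) (x : A -> R) (y : B -> R) : R :=
  \sum_s \sum_a \sum_b p ord0 s * x a * y b * g s a b.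

(* For nonempty A and B both extrema are attained: the expression is continuous
   on a product of two compact sets. *)
Definition hamiltonian (p xi : 'rV[R]_N) : R :=
  inf [set sup [set - dot (p *m mean_rate x y) xi - r * mean_payoff p x y
               | y in simplex B] | x in simplex A].

End Rates.

Section Viscosity.
Context {R : realType} {N : nat}.
Implicit Types (p : 'rV[R]_N) (phi w : 'rV[R]_N -> R).

Definition partial (i : 'I_N) phi : 'rV[R]_N -> R :=
  fun p => 'D_(delta_mx ord0 i) phi p.

(* C^oo: total differentiability of every iterated partial derivative implies
   that all of these are continuous. *)
Definition smooth phi : Prop :=
  forall (s : seq 'I_N) p, differentiable (foldr partial phi s) p.

Definition grad phi p : 'rV[R]_N := \row_i partial i phi p.

Definition hess phi p : 'M[R]_N :=
  \matrix_(i, j) partial i (partial j phi) p.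

Definition tangent p : set 'rV[R]_N :=
  [set z | exists e : R, [/\ 0 < e, state_simplex N (p + e *: z) &
                             state_simplex N (p - e *: z)]].

(* [ereal_sup set0] is -oo. *)
Definition lambda_max p (X : 'M[R]_N) : \bar R :=
  ereal_sup [set (dot (z *m X) z / dot z z)%:E | z in tangent p `\ 0].

Definition local_max_on (D : set 'rV[R]_N) (f : 'rV[R]_N -> R) p : Prop :=
  D p /\ \forall q \near within D (nbhs p), f q <= f p.

Definition local_min_on (D : set 'rV[R]_N) (f : 'rV[R]_N -> R) p : Prop :=
  D p /\ \forall q \near within D (nbhs p), f p <= f q.

(* The functions are total, but only their values on the simplex matter: points
   outside D are isolated in [subspace D], which carries on D the relative
   topology. *)
Definition lsc_on (D : set 'rV[R]_N) (f : 'rV[R]_N -> R) : Prop :=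
  lower_semicontinuous (fun p : subspace D => (f p)%:E).

Definition usc_on (D : set 'rV[R]_N) (f : 'rV[R]_N -> R) : Prop :=
  lsc_on D (fun p => - f p).

Variables (r : R) (H : 'rV[R]_N -> 'rV[R]_N -> R).

Definition hj_operator w phi p : \bar R :=
  Order.min (r * w p + H p (grad phi p))%:E
            (- lambda_max p (hess phi p))%E.

Definition viscosity_subsolution w : Prop :=
  usc_on (state_simplex N) w /\
  forall phi p, smooth phi ->
    local_max_on (state_simplex N) (fun q => w q - phi q) p ->
    (hj_operator w phi p <= 0)%E.

Definition viscosity_supersolution w : Prop :=
  lsc_on (state_simplex N) w /\
  forall phi p, smooth phi ->
    local_min_on (state_simplex N) (fun q => w q - phi q) p ->
    (0 <= hj_operator w phi p)%E.

Definition viscosity_solution w : Prop :=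
  viscosity_subsolution w /\ viscosity_supersolution w.

End Viscosity.

(* Main.v *)
(* The value V_n of the discretized game is the support function of the set of
   payoff vectors, indexed by the initial state, that player 2 can secure in
   finitely many stages. On unnormalised beliefs it is homogeneous, concave and
   Lipschitz, and it satisfies a one-stage programming principle in which player
   1 splits the belief.

   By compactness every infinite set of indices n has a uniform cluster point w
   of V_n. Against a test function touching w from below, player 1 plays without
   revealing, which gives r w + H >= 0; concavity gives the second-order part.
   Against a test function touching w from above with negative definite tangent
   Hessian, V_n lies, by concavity, globally below a strictly concave paraboloid
   at a nearby contact point, so an optimal splitting gains only O(1/n^2) from
   revealing, whence r w + H <= 0.

   Comparison: a supersolution v is concave, hence has supergradients xi at
   interior points q, and these can be chosen with r v + H(q, xi) >= 0. At a
   maximum of u(p) - v((1-e)p + e c) + d|p|^2 with c the barycentre, a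
   supergradient of v bounds u from above by a strictly concave quadratic
   touching at p, to which the subsolution inequality applies. Thus all cluster
   points coincide and V_n converges uniformly. *)

From HB Require Import structures.
From mathcomp Require Import all_boot all_order all_algebra.
From mathcomp Require Import all_classical all_reals all_analysis.
From mathcomp Require Import ring lra.
Require Import Defs.

Set Implicit Arguments.
Unset Strict Implicit.
Unset Printing Implicit Defensive.

Import Order.TTheory GRing.Theory Num.Theory.
Import numFieldNormedType.Exports.

Local Open Scope classical_set_scope.
Local Open Scope ring_scope.

Section RowVectors.
Context {R : realType} {N : nat}.
Implicit Types (u v z p q : 'rV[R]_N) (M X : 'M[R]_N).

Lemma dotE u v : dot u v = (u *m v^T) ord0 ord0.
Proof. by rewrite mxE; apply: eq_bigr => i _; rewrite mxE. Qed.

Lemma dotC u v : dot u v = dot v u.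
Proof. by apply: eq_bigr => i _; rewrite mulrC. Qed.

Lemma dotDl u v z : dot (u + v) z = dot u z + dot v z.
Proof. by rewrite !dotE mulmxDl mxE. Qed.

Lemma dotDr u v z : dot z (u + v) = dot z u + dot z v.
Proof. by rewrite dotC dotDl !(dotC z). Qed.

Lemma dotZl a u v : dot (a *: u) v = a * dot u v.
Proof. by rewrite !dotE -scalemxAl mxE. Qed.

Lemma dotZr a u v : dot u (a *: v) = a * dot u v.
Proof. by rewrite dotC dotZl dotC. Qed.

Lemma dotNl u v : dot (- u) v = - dot u v.
Proof. by rewrite -scaleN1r dotZl mulN1r. Qed.

Lemma dotNr u v : dot u (- v) = - dot u v.
Proof. by rewrite dotC dotNl dotC. Qed.

Lemma dotBl u v z : dot (u - v) z = dot u z - dot v z.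
Proof. by rewrite dotDl dotNl. Qed.

Lemma dotBr u v z : dot z (u - v) = dot z u - dot z v.
Proof. by rewrite dotDr dotNr. Qed.

Lemma dot0l u : dot 0 u = 0.
Proof. by rewrite -(scale0r 0) dotZl mul0r. Qed.

Lemma dot0r u : dot u 0 = 0.
Proof. by rewrite dotC dot0l. Qed.

Lemma dot_suml (I : Type) (r : seq I) (P : pred I) (F : I -> 'rV[R]_N) u :
  dot (\sum_(i <- r | P i) F i) u = \sum_(i <- r | P i) dot (F i) u.
Proof.
by elim/big_rec2: _ => [|i y1 y2 _ <-]; rewrite ?dot0l ?dotDl.
Qed.

Lemma dot_trmx M u v : dot (u *m M) v = dot (v *m M^T) u.
Proof.
by rewrite !dotE -[in LHS](trmxK (u *m M *m v^T)) mxE !trmx_mul trmxK mulmxA.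
Qed.

Lemma dot_delta u i : dot u (delta_mx ord0 i) = u ord0 i.
Proof.
rewrite /dot (bigD1 i)//= big1 ?addr0 ?mxE ?eqxx ?mulr1// => j ji.
by rewrite mxE (negPf ji) mulr0.
Qed.

Lemma dot_ge0 u : 0 <= dot u u.
Proof. by apply: sumr_ge0 => i _; exact: sqr_ge0. Qed.

Lemma sqr_entry_le_dot u i : u ord0 i ^+ 2 <= dot u u.
Proof.
rewrite /dot (bigD1 i)//= -expr2 lerDl.
by apply: sumr_ge0 => j _; exact: sqr_ge0.
Qed.

Lemma dot_gt0 u : u != 0 -> 0 < dot u u.
Proof.
move=> u0; rewrite lt_neqAle dot_ge0 andbT eq_sym; apply: contra u0 => /eqP u0.
apply/eqP/rowP => i; rewrite mxE; apply/eqP; rewrite -sqrf_eq0 -[_ == 0]orbF.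
by rewrite orbF eq_le sqr_ge0 andbT -u0 sqr_entry_le_dot.
Qed.

Lemma entry_le_norm m (A : 'M[R]_(m, N)) i j : `|A i j| <= `|A|.
Proof.
rewrite [leRHS]/Num.Def.normr/= mx_normrE.
by apply/bigmax_geP; right => /=; exists (i, j).
Qed.

Lemma norm_le_entries z (e : R) :
  0 <= e -> (forall i, `|z ord0 i| <= e) -> `|z| <= e.
Proof.
move=> e0 ze; rewrite [leLHS]/Num.Def.normr/= mx_normrE.
by apply: bigmax_le => // -[i j] _ /=; rewrite (ord1 i).
Qed.

Lemma norm_sqr_le_dot z : `|z| ^+ 2 <= dot z z.
Proof.
rewrite -(@ler_sqrt R) ?dot_ge0// sqrtr_sqr normr_id.
apply: norm_le_entries => [|i]; first exact: sqrtr_ge0.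
by rewrite -sqrtr_sqr ler_sqrt ?dot_ge0// sqr_entry_le_dot.
Qed.

Lemma sum_ord_le (F : 'I_N -> R) (c : R) :
  (forall i, F i <= c) -> \sum_i F i <= N%:R * c.
Proof.
move=> Fc; apply: (le_trans (ler_sum _ (fun i _ => Fc i))).
by rewrite sumr_const card_ord mulr_natl.
Qed.

Lemma dot_le_norm u v : `|dot u v| <= N%:R * (`|u| * `|v|).
Proof.
apply: (le_trans (ler_norm_sum _ _ _)); apply: sum_ord_le => i.
by rewrite normrM ler_pM// entry_le_norm.
Qed.

Lemma mulmx_le_norm u M : `|u *m M| <= N%:R * (`|u| * `|M|).
Proof.
apply: norm_le_entries => [|j]; first by rewrite !mulr_ge0.
rewrite mxE; apply: (le_trans (ler_norm_sum _ _ _)); apply: sum_ord_le => i.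
by rewrite normrM ler_pM// entry_le_norm.
Qed.

Definition norm1 z : R := \sum_i `|z ord0 i|.

Lemma norm1_ge0 z : 0 <= norm1 z.
Proof. exact: sumr_ge0. Qed.

Lemma norm1D u v : norm1 (u + v) <= norm1 u + norm1 v.
Proof.
by rewrite -big_split/=; apply: ler_sum => i _; rewrite mxE ler_normD.
Qed.

Lemma norm1N u : norm1 (- u) = norm1 u.
Proof. by apply: eq_bigr => i _; rewrite mxE normrN. Qed.

Lemma norm1Z a u : norm1 (a *: u) = `|a| * norm1 u.
Proof. by rewrite mulr_sumr; apply: eq_bigr => i _; rewrite mxE normrM. Qed.

Lemma norm1_le_norm z : norm1 z <= N%:R * `|z|.
Proof.
by apply: sum_ord_le => i; exact: entry_le_norm.
Qed.

Lemma dot_le_norm1 u v (c : R) : (forall i, `|v ord0 i| <= c) ->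
  `|dot u v| <= c * norm1 u.
Proof.
move=> vc; apply: (le_trans (ler_norm_sum _ _ _)).
by rewrite mulr_sumr; apply: ler_sum => i _; rewrite normrM mulrC ler_wpM2r.
Qed.

End RowVectors.

Section StateSimplex.
Context {R : realType} {N : nat}.
Implicit Types (p q : 'rV[R]_N).
Local Notation D := (state_simplex (R := R) N).

Lemma state_simplex_entry_le1 p i : D p -> p ord0 i <= 1.
Proof.
move=> [p0 <-]; rewrite (bigD1 i)//= lerDl; exact: sumr_ge0.
Qed.

Lemma state_simplex_norm p : D p -> `|p| <= 1.
Proof.
move=> pD; apply: norm_le_entries => // i; rewrite ger0_norm.
  exact: state_simplex_entry_le1.
by case: pD.
Qed.

Lemma state_simplex_norm1 p : D p -> norm1 p = 1.
Proof. by move=> [p0 <-]; apply: eq_bigr => i _; rewrite ger0_norm. Qed.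

Lemma state_simplex_normB p q : D p -> D q -> `|p - q| <= 1.
Proof.
move=> pD qD; apply: norm_le_entries => // i; rewrite !mxE.
have := state_simplex_entry_le1 i pD; have := state_simplex_entry_le1 i qD.
case: pD qD => p0 _ [q0 _]; move: (p0 i) (q0 i).
by rewrite ler_norml; lra.
Qed.

Lemma state_simplex_convex p q (t : R) : D p -> D q -> 0 <= t <= 1 ->
  D ((1 - t) *: p + t *: q).
Proof.
move=> [p0 p1] [q0 q1] /andP[t0 t1]; split=> [i|].
  by rewrite !mxE addr_ge0 ?mulr_ge0// subr_ge0.
under eq_bigr do rewrite !mxE; rewrite big_split/= -!mulr_sumr p1 q1; lra.
Qed.

Lemma state_simplex_segment p q (t : R) : D p -> D q -> 0 <= t <= 1 ->
  D (p + t *: (q - p)).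
Proof.
move=> pD qD t01; have := state_simplex_convex pD qD t01.
suff -> : p + t *: (q - p) = (1 - t) *: p + t *: q by [].
by apply/rowP => i; rewrite !mxE; ring.
Qed.

Lemma state_simplex_N_gt0 p : D p -> (0 < N)%N.
Proof.
move=> [_]; case: N p => [|//] p; rewrite big_ord0 => /eqP.
by rewrite eq_sym oner_eq0.
Qed.

Lemma state_simplex_delta i : D (delta_mx ord0 i).
Proof.
split=> [j|]; first by rewrite mxE; case: eqP.
rewrite (bigD1 i)//= mxE !eqxx big1 ?addr0// => j ji.
by rewrite mxE (negPf ji).
Qed.

Lemma compact_state_simplex : compact D.
Proof.
apply: bounded_closed_compact.
  exists 1; split=> // M M1 p /= /state_simplex_norm p1.
  exact: (le_trans p1 (ltW M1)).
have -> : D = (\bigcap_i (fun p => p ord0 i) @^-1` [set x | 0 <= x]) `&`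
    (fun p => \sum_i p ord0 i) @^-1` [set 1].
  apply/seteqP; split=> p.
    by move=> [p0 p1]; split=> //= i _; exact: p0.
  by move=> [p0 p1]; split=> // i; exact: p0.
apply: closedI.
  apply: closed_bigI => i _; apply: closed_comp; last exact: closed_ge.
  by move=> p _; exact: coord_continuous.
apply: closed_comp; last exact: closed_eq.
move=> p _; move: p; apply: (@continuous_big _ _ _ _ (fun=> true)
  add_continuous _ _ (fun i p => p ord0 i)) => i _.
exact: coord_continuous.
Qed.

End StateSimplex.

Section Compactness.
Context {R : realType}.

Lemma compact_subsequence (V : normedModType R) (K : set V)
    (x : nat -> V) : compact K -> (forall j, K (x j)) ->
  exists2 y, K y & forall e : R, 0 < e -> forall j0,
    exists2 j, (j0 <= j)%N & `|x j - y| < e.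
Proof.
move=> cK xK.
have [|y [yK cly]] := cK (x @ \oo) _.
  by exists 0 => // j _; exact: xK.
exists y => // e e0 j0.
have [|z [[j /= j0j <-] ye]] := cly (x @` [set j | (j0 <= j)%N]) (ball y e) _
  (nbhsx_ballx y e e0).
  by exists j0 => // j j0j; exists j.
by exists j => //; rewrite -ball_normE/= distrC in ye *.
Unshelve. all: by end_near. Qed.

Lemma within_continuousP (V : normedModType R) (K : set V) (f : V -> R) :
  {within K, continuous f} <->
  (forall x, K x -> forall e : R, 0 < e -> exists2 d : R, 0 < d &
     forall y, K y -> `|y - x| < d -> `|f y - f x| < e).
Proof.
rewrite subspace_continuousP; split=> [cf x Kx e e0|cf x Kx].
  have /cvgrPdist_lt/(_ _ e0) := cf x Kx.
  rewrite near_withinE => /nbhs_ballP[d /= d0 xd]; exists d => // y Ky yx.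
  by rewrite distrC; apply: xd => //; rewrite -ball_normE/= distrC.
apply/cvgrPdist_lt => e e0; have [d d0 xd] := cf x Kx e e0.
rewrite near_withinE; apply/nbhs_ballP; exists d => //= y.
by rewrite -ball_normE/= => yx Ky; rewrite distrC; apply: xd => //; rewrite distrC.
Qed.

Lemma compact_uniform_modulus (V : normedModType R) (K : set V) (f : V -> R) :
  compact K -> {within K, continuous f} -> forall e : R, 0 < e ->
  exists2 d : R, 0 < d &
    forall x y, K x -> K y -> `|y - x| < d -> `|f y - f x| < e.
Proof.
move=> cK /within_continuousP cf e e0; apply: contrapT => nd.
have H (j : nat) : exists xy : V * V, [/\ K xy.1, K xy.2,
    `|xy.2 - xy.1| < j.+1%:R^-1 & e <= `|f xy.2 - f xy.1|].
  apply: contrapT => nj; apply: nd; exists j.+1%:R^-1; first by rewrite invr_gt0.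
  move=> x y Kx Ky xy; rewrite ltNge; apply/negP => exy.
  by apply: nj; exists (x, y).
have [xy xyP] := choice H.
have [j|z Kz zP] := compact_subsequence (x := fun j => (xy j).1) cK.
  by case: (xyP j).
have e20 : 0 < e / 2 by rewrite divr_gt0.
have [d d0 dP] := cf z Kz _ e20.
have d20 : 0 < d / 2 by rewrite divr_gt0.
have [j jl jz] := zP _ d20 (Num.truncn (d / 2)^-1).
have [K1 K2 j12 ej] := xyP j.
have jd : j.+1%:R^-1 < d / 2.
  rewrite invf_plt ?posrE//; apply: (lt_le_trans (truncnS_gt _)).
  by rewrite ler_nat ltnS.
have A := dP _ K1 (lt_trans jz _).
have B1 : `|f (xy j).1 - f z| < e / 2 by apply: A; lra.
have B2 : `|f (xy j).2 - f z| < e / 2.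
  apply: dP => //; rewrite -(subrKA (xy j).1); apply: (le_lt_trans (ler_normD _ _)).
  by have := lt_trans j12 jd; lra.
move: ej; rewrite leNgt => /negP; apply; rewrite -(subrKA (f z)).
by apply: (le_lt_trans (ler_normD _ _)); rewrite (distrC (f z)); lra.
Qed.

End Compactness.

(** * A convex alternative on the simplex *)

Section Alternative.
Context {R : realType} {I : finType}.

Lemma simplex_point (i : I) : simplex I (fun j => (j == i)%:R : R).
Proof.
split=> [j|]; first by case: eqP.
by rewrite (bigD1 i)//= eqxx big1 ?addr0// => j /negPf ->.
Qed.

Lemma sum_simplex_point (i : I) (F : I -> R) : \sum_j (j == i)%:R * F j = F i.
Proof.
rewrite (bigD1 i)//= eqxx mul1r big1 ?addr0// => j /negPf ->.
by rewrite mul0r.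
Qed.

Lemma simplex_sum_le (x F : I -> R) c :
  simplex I x -> (forall i, F i <= c) -> \sum_i x i * F i <= c.
Proof.
move=> [x0 x1] Fc; rewrite -[leRHS]mul1r -x1 mulr_suml.
by apply: ler_sum => i _; exact: ler_wpM2l.
Qed.

Lemma simplex_sum_ge (x F : I -> R) c :
  simplex I x -> (forall i, c <= F i) -> c <= \sum_i x i * F i.
Proof.
move=> [x0 x1] Fc; rewrite -[leLHS]mul1r -x1 mulr_suml.
by apply: ler_sum => i _; exact: ler_wpM2l.
Qed.

Lemma simplex_convex (x y : I -> R) t : simplex I x -> simplex I y ->
  0 <= t <= 1 -> simplex I (fun i => (1 - t) * x i + t * y i).
Proof.
move=> [x0 x1] [y0 y1] /andP[t0 t1]; split=> [i|].
  by rewrite addr_ge0 ?mulr_ge0// subr_ge0.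
by rewrite big_split/= -!mulr_sumr x1 y1; lra.
Qed.

Lemma simplex_subsequence (x : nat -> I -> R) : (forall j, simplex I (x j)) ->
  exists2 y, simplex I y & forall e : R, 0 < e -> forall j0,
    exists2 j, (j0 <= j)%N & forall i, `|x j i - y i| < e.
Proof.
move=> xS; pose r j : 'rV[R]_#|I| := \row_k x j (@enum_val I I k).
have sumE (F : I -> R) : \sum_k F (@enum_val I I k) = \sum_i F i.
  by rewrite -(@big_enum_val _ _ _ _ I F); apply: eq_bigl => i.
have rD j : state_simplex #|I| (r j).
  have [x0 x1] := xS j; split=> [k|]; first by rewrite mxE.
  by under eq_bigr do rewrite mxE; rewrite sumE.
have [y [y0 y1] yP] := compact_subsequence (@compact_state_simplex R _) rD.
exists (fun i => y ord0 (enum_rank i)).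
  split=> [i|]; first exact: y0.
  by rewrite -sumE -[RHS]y1; apply: eq_bigr => k _; rewrite enum_valK.
move=> e e0 j0; have [j jj0 jy] := yP e e0 j0; exists j => // i.
apply: le_lt_trans jy.
by have := entry_le_norm (r j - y) ord0 (enum_rank i); rewrite !mxE enum_rankK.
Qed.

(* A near-minimiser k of the squared distance \sum_i (max (k i + e) 0)^2 to the
   shifted negative orthant gives, after normalisation of the excess
   max (k + e) 0, a distribution which is almost nonnegative on K. *)
Lemma convex_alternative_approx (K : set (I -> R)) (k0 : I -> R) (e : R) :
  K k0 ->
  (forall k k' (t : R), K k -> K k' -> 0 <= t <= 1 ->
     exists2 k'', K k'' & forall i, k'' i <= (1 - t) * k i + t * k' i) ->
  (forall k, K k -> exists i, 0 <= k i) ->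
  0 < e <= 1 ->
  exists2 x, simplex I x & forall k, K k ->
    - (e * (4 + \sum_i (`|k0 i| + 1) ^+ 2 + \sum_i (`|k i| + 1) ^+ 2))
      <= \sum_i x i * k i.
Proof.
move=> Kk0 Kconv Kpos /andP[e0 e1].
pose m (k : I -> R) i := Num.max (k i + e) 0.
pose phi (k : I -> R) := \sum_i m k i ^+ 2.
have m0 k i : 0 <= m k i by rewrite le_max lexx orbT.
have phi_ge0 k : 0 <= phi k by apply: sumr_ge0 => i _; exact: sqr_ge0.
have infphi : has_inf (phi @` K).
  by split; [exists (phi k0), k0|exists 0 => _ [k _ <-]].
have dlt k : K k -> inf (phi @` K) <= phi k.
  by move=> Kk; apply: ge_inf; [case: infphi|exists k].
have [_ [k Kk <-] kd] := inf_adherent (exprn_gt0 4 e0) infphi.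
pose M := \sum_i m k i.
have eM : e <= M.
  have [i ki] := Kpos _ Kk; rewrite /M (bigD1 i)//=.
  have : e <= m k i by rewrite le_max lerDr ki.
  have : 0 <= \sum_(j | j != i) m k j by exact: sumr_ge0.
  by lra.
have M0 : 0 < M by exact: lt_le_trans eM.
exists (fun i => m k i / M).
  split=> [i|]; first by rewrite divr_ge0// ltW.
  by rewrite -mulr_suml divff// gt_eqF.
move=> k' Kk'; pose u i := k' i + e.
have e2 : 0 <= e ^+ 2 <= 1 by rewrite sqr_ge0/= expr_le1// ltW.
have [k'' Kk'' k''le] := Kconv _ _ _ Kk Kk' e2.
have A : phi k'' <= \sum_i (m k i + e ^+ 2 * (u i - m k i)) ^+ 2.
  apply: ler_sum => i _; rewrite -[leRHS]real_normK ?num_real//.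
  rewrite ler_pXn2r ?nnegrE ?m0// ge_max normr_ge0 andbT.
  apply: le_trans (ler_norm _).
  have : k i + e <= m k i by rewrite le_max lexx.
  move: (k''le i) e2; rewrite /u; set s := e ^+ 2; move=> k2 /andP[s0 s1] kim.
  have : (1 - s) * (k i + e) <= (1 - s) * m k i by rewrite ler_wpM2l// subr_ge0.
  by move: k2; nra.
pose S := \sum_i (u i - m k i) ^+ 2.
pose L := \sum_i m k i * u i.
have B : \sum_i (m k i + e ^+ 2 * (u i - m k i)) ^+ 2 =
    phi k + 2 * e ^+ 2 * (L - phi k) + e ^+ 4 * S.
  rewrite /phi /L /S -sumrB !mulr_sumr -!big_split/=.
  by apply: eq_bigr => i _; ring.
have phik : phi k <= \sum_i (`|k0 i| + 1) ^+ 2 + 1.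
  have : inf (phi @` K) <= \sum_i (`|k0 i| + 1) ^+ 2.
    apply: (le_trans (dlt _ Kk0)); apply: ler_sum => i _.
    rewrite ler_pXn2r ?nnegrE ?m0//.
    by rewrite ge_max addr_ge0// andbT lerD// ler_norm.
  have : e ^+ 4 <= 1 by rewrite expr_le1// ltW.
  by lra.
have Sle : S <= 2 * \sum_i (`|k' i| + 1) ^+ 2 + 2 * phi k.
  rewrite /S /phi !mulr_sumr -big_split/=; apply: ler_sum => i _.
  have : u i ^+ 2 <= (`|k' i| + 1) ^+ 2.
    rewrite -[leLHS]real_normK ?num_real// ler_pXn2r ?nnegrE//.
    by rewrite (le_trans (ler_normD _ _))// lerD// ger0_norm// ltW.
  by have := sqr_ge0 (u i + m k i); nra.
have Lge : - (e ^+ 2 * (1 + S) / 2) <= L.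
  have := le_trans (dlt _ Kk'') A; rewrite B.
  have E4 : e ^+ 4 = e ^+ 2 * e ^+ 2 by rewrite -exprD.
  have e20 : 0 < e ^+ 2 by exact: exprn_gt0.
  move: kd (phi_ge0 k); rewrite E4; set s := e ^+ 2 in e20 *.
  move=> H1 H2 H3; have : 0 <= s * (s + 2 * (L - phi k) + s * S) by nra.
  by rewrite pmulr_rge0//; nra.
have -> : \sum_i m k i / M * k' i = (L - e * M) / M.
  rewrite /L /M mulr_sumr -sumrB mulr_suml; apply: eq_bigr => i _.
  by rewrite /u; ring.
rewrite mulrDl mulNr mulfK ?gt_eqF//.
have LM : - (e * (1 + S) / 2) <= L / M.
  rewrite ler_pdivlMr//.
  have S0 : 0 <= S by apply: sumr_ge0 => i _; exact: sqr_ge0.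
  have : e * (e * (1 + S)) <= M * (e * (1 + S)).
    by rewrite ler_wpM2r// mulr_ge0 ?addr_ge0// ltW.
  by move: Lge; rewrite expr2; nra.
move: LM phik Sle (phi_ge0 k).
set a := \sum_i _; set b := \sum_i (`|k' i| + 1) ^+ 2.
by move=> LM phik Sle ph0; nra.
Qed.

Lemma convex_alternative (K : set (I -> R)) : (0 < #|I|)%N ->
  (forall k k' (t : R), K k -> K k' -> 0 <= t <= 1 ->
     exists2 k'', K k'' & forall i, k'' i <= (1 - t) * k i + t * k' i) ->
  (forall k, K k -> exists i, 0 <= k i) ->
  exists2 x, simplex I x & forall k, K k -> 0 <= \sum_i x i * k i.
Proof.
move=> /card_gt0P[i0 _] Kconv Kpos.
have [[k0 Kk0]|K0] := pselect (exists k, K k); last first.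
  exists (fun j => (j == i0)%:R); first exact: simplex_point.
  by move=> k Kk; exfalso; apply: K0; exists k.
have e01 (j : nat) : 0 < (j.+1%:R^-1 : R) <= 1.
  by rewrite invr_gt0 ltr0n/= invf_le1 ?ltr0n// ler1n.
have /choice[x xP] (j : nat) : exists x, simplex I x /\ forall k, K k ->
    - (j.+1%:R^-1 * (4 + \sum_i (`|k0 i| + 1) ^+ 2 + \sum_i (`|k i| + 1) ^+ 2))
      <= \sum_i x i * k i.
  have [x xS xK] := convex_alternative_approx Kk0 Kconv Kpos (e01 j).
  by exists x.
have [y yS yP] := simplex_subsequence (fun j => (xP j).1).
exists y => // k Kk.
pose C := 4 + \sum_i (`|k0 i| + 1) ^+ 2 + \sum_i (`|k i| + 1) ^+ 2.
have C0 : 0 < C.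
  by rewrite /C !ltr_pwDl// sumr_ge0// => i _; exact: sqr_ge0.
rewrite leNgt; apply/negP; set e := \sum_i _; rewrite -oppr_gt0 => e0.
pose d := - e / 2 / (1 + \sum_i `|k i|).
have s0 : 0 < 1 + \sum_i `|k i| by rewrite ltr_pwDl// sumr_ge0.
have d0 : 0 < d by rewrite /d !divr_gt0.
have [j jl jy] := yP d d0 (Num.truncn (- e / 2 / C)^-1).
have ec0 : 0 < - e / 2 / C by rewrite !divr_gt0.
have jC : j.+1%:R^-1 * C < - e / 2.
  rewrite -ltr_pdivlMr// invf_plt ?posrE//; apply: (lt_le_trans (truncnS_gt _)).
  by rewrite ler_nat ltnS.
have xjk := (xP j).2 k Kk; rewrite -/C in xjk.
have : \sum_i y i * k i - \sum_i x j i * k i >= e / 2.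
  rewrite -lerN2 -mulNr.
  have -> : - e / 2 = d * (1 + \sum_i `|k i|) by rewrite /d divfK// gt_eqF.
  rewrite opprB -sumrB; apply: (@le_trans _ _ (d * \sum_i `|k i|)); last first.
    by rewrite ler_pM2l// lerDr.
  rewrite mulr_sumr; apply: ler_sum => i _; rewrite -mulrBl.
  by apply: (le_trans (ler_norm _)); rewrite normrM ler_wpM2r// ltW.
move: jC xjk; rewrite -/e; set X := \sum_i x j i * k i; set Y := _ * C.
by lra.
Qed.

End Alternative.

(** * Value of the discretized game *)

Section TupleSum.
Context {R : realType}.

Lemma sum_tuple_cons (T : finType) K (F : K.+1.-tuple T -> R) :
  \sum_h F h = \sum_z \sum_(h : K.-tuple T) F [tuple of z :: h].
Proof.
rewrite pair_big/= (reindex (fun zh : T * K.-tuple T => [tuple of zh.1 :: zh.2]))//.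
exists (fun h : K.+1.-tuple T => (thead h, [tuple of behead h])).
  by case=> z h _; congr pair; apply: val_inj.
by move=> h _; rewrite /= [in RHS](tuple_eta h).
Qed.

Lemma sum_triple (S A B : finType) (F : S * A * B -> R) :
  \sum_z F z = \sum_s \sum_a \sum_b F (s, a, b).
Proof.
rewrite pair_big/= pair_big/=; apply: eq_bigr => -[[s a] b] _.
by [].
Qed.

End TupleSum.

Section TruncatedPayoff.
Context {R : realType} {N : nat} {A B : finType}.
Variables (g : 'I_N -> A -> B -> R) (P : A -> B -> 'M[R]_N) (l M : R).
Hypothesis P_ge0 : forall a b s s', 0 <= P a b s s'.
Hypothesis P_sum1 : forall a b s, \sum_s' P a b s s' = 1.
Hypothesis l01 : 0 < l < 1.
Hypothesis gM : forall s a b, `|g s a b| <= M.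
Local Notation stage := (@stage N A B).
Local Notation strategy1 := (@strategy1 R N A B).
Local Notation strategy2 := (@strategy2 R A B).
Implicit Types (sigma : strategy1) (tau : strategy2) (q : 'I_N -> R).

Definition shift1 sigma (z : stage) : strategy1 := fun past => sigma (z :: past).
Definition shift2 tau (c : A * B) : strategy2 := fun past => tau (c :: past).

Lemma behavior1_shift (sigma : strategy1) z : behavior1 sigma -> behavior1 (shift1 sigma z).
Proof. by move=> sS past s; exact: sS. Qed.

Lemma behavior2_shift tau c : behavior2 tau -> behavior2 (shift2 tau c).
Proof. by move=> tS past; exact: tS. Qed.

Lemma play_prob_shift sigma tau z past q h :
  play_prob P sigma tau (z :: past) q h =
  play_prob P (shift1 sigma z) (shift2 tau (actions z)) past q h.
Proof.
by elim: h past q => [//|[[s a] b] h IH] past q /=; rewrite -rcons_cons IH.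
Qed.

Lemma play_prob_mass sigma tau q K : behavior1 sigma -> behavior2 tau ->
  \sum_(h : K.-tuple stage) play_prob P sigma tau [::] q h =
  if K is 0%N then 1 else \sum_s q s.
Proof.
elim: K sigma tau q => [|K IH] sigma tau q sS tS.
  rewrite (bigD1 [tuple])//= big1 ?addr0// => h /eqP.
  by rewrite (tuple0 h) => /(_ erefl).
rewrite sum_tuple_cons sum_triple.
apply: eq_bigr => s _; rewrite -[RHS]mulr1 -(sS [::] s).2 mulr_sumr.
apply: eq_bigr => a _; rewrite -[RHS]mulr1 -(tS [::]).2 mulr_sumr.
apply: eq_bigr => b _ /=; rewrite -mulr_sumr -[RHS]mulr1; congr (_ * _).
under eq_bigr do rewrite play_prob_shift.
rewrite IH; [|exact: behavior1_shift|exact: behavior2_shift].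
by case: (K).
Qed.

Definition trunc_payoff K q sigma tau : R :=
  \sum_(h : K.-tuple stage)
    play_prob P sigma tau [::] q h * discounted_sum g l h.

Lemma discounted_sum_cons K z (h : K.-tuple stage) :
  discounted_sum g l [tuple of z :: h] =
  l * g z.1.1 z.1.2 z.2 + (1 - l) * discounted_sum g l h.
Proof.
rewrite /discounted_sum big_ord_recl expr0 mulr1 !tnth0; congr (_ + _).
rewrite mulr_sumr; apply: eq_bigr => k _; rewrite tnthS lift0 exprS.
by rewrite -!mulrA [l * _]mulrCA.
Qed.

Lemma trunc_payoff0 q sigma tau : trunc_payoff 0 q sigma tau = 0.
Proof.
rewrite /trunc_payoff big1// => h _.
by rewrite /discounted_sum big_ord0 mulr0.
Qed.

Lemma trunc_payoffS K q sigma tau : behavior1 sigma -> behavior2 tau ->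
  trunc_payoff K.+1 q sigma tau =
  \sum_s \sum_a \sum_b q s * sigma [::] s a * tau [::] b *
    (l * g s a b + (1 - l) * trunc_payoff K (P a b s)
       (shift1 sigma (s, a, b)) (shift2 tau (a, b))).
Proof.
move=> sS tS; rewrite /trunc_payoff.
rewrite sum_tuple_cons sum_triple.
apply: eq_bigr => s _; apply: eq_bigr => a _; apply: eq_bigr => b _.
transitivity (\sum_(h : K.-tuple stage) q s * sigma [::] s a * tau [::] b *
  (play_prob P (shift1 sigma (s, a, b)) (shift2 tau (a, b)) [::] (P a b s) h *
   (l * g s a b + (1 - l) * discounted_sum g l h))).
  apply: eq_bigr => h _; rewrite discounted_sum_cons /= play_prob_shift.
  by rewrite !mulrA.
rewrite -mulr_sumr; congr (_ * _).
under eq_bigr do rewrite mulrDr; rewrite big_split/= -mulr_suml.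
rewrite play_prob_mass; [|exact: behavior1_shift|exact: behavior2_shift].
congr (_ + _); last by rewrite mulr_sumr; apply: eq_bigr => h _; rewrite mulrCA.
by case: (K) => [|k]; rewrite ?P_sum1 mul1r.
Qed.

Lemma trunc_payoff_lincomb K (I : finType) (w : I -> R) (q : I -> 'I_N -> R)
    sigma tau : behavior1 sigma -> behavior2 tau ->
  trunc_payoff K (fun s => \sum_i w i * q i s) sigma tau =
  \sum_i w i * trunc_payoff K (q i) sigma tau.
Proof.
case: K => [|K] sS tS.
  by rewrite trunc_payoff0 big1// => i _; rewrite trunc_payoff0 mulr0.
rewrite trunc_payoffS//; under [RHS]eq_bigr do rewrite trunc_payoffS//.
under [RHS]eq_bigr do rewrite mulr_sumr.
rewrite [RHS]exchange_big/=; apply: eq_bigr => s _.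
under [RHS]eq_bigr do rewrite mulr_sumr.
rewrite [RHS]exchange_big/=; apply: eq_bigr => a _.
under [RHS]eq_bigr do rewrite mulr_sumr.
rewrite [RHS]exchange_big/=; apply: eq_bigr => b _.
by rewrite !mulr_suml; apply: eq_bigr => i _; rewrite !mulrA.
Qed.

Lemma first_stage_le (q : 'I_N -> R) sigma tau (F : 'I_N -> A -> B -> R) (c : R) :
  behavior1 sigma -> behavior2 tau -> (forall s, 0 <= q s) ->
  (forall s a b, `|F s a b| <= c) ->
  `|\sum_s \sum_a \sum_b q s * sigma [::] s a * tau [::] b * F s a b| <=
  c * \sum_s q s.
Proof.
move=> sS tS q0 Fc; apply: (le_trans (ler_norm_sum _ _ _)).
rewrite mulr_sumr; apply: ler_sum => s _.
have [s0 s1] := sS [::] s; have [t0 t1] := tS [::].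
have -> : c * q s = \sum_a \sum_b q s * sigma [::] s a * tau [::] b * c.
  under eq_bigr do rewrite -mulr_suml -mulr_sumr t1 mulr1.
  by rewrite -mulr_suml -mulr_sumr s1 mulr1 mulrC.
apply: (le_trans (ler_norm_sum _ _ _)); apply: ler_sum => a _.
apply: (le_trans (ler_norm_sum _ _ _)); apply: ler_sum => b _.
have w0 : 0 <= q s * sigma [::] s a * tau [::] b by rewrite !mulr_ge0.
by rewrite normrM ger0_norm// ler_wpM2l.
Qed.

Lemma trunc_payoff_increment K q sigma tau : behavior1 sigma -> behavior2 tau ->
  (forall s, 0 <= q s) ->
  `|trunc_payoff K.+1 q sigma tau - trunc_payoff K q sigma tau| <=
  l * M * (1 - l) ^+ K * \sum_s q s.
Proof.
have /andP[l0 l1] := l01.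
elim: K q sigma tau => [|K IH] q sigma tau sS tS q0.
  rewrite trunc_payoff0 subr0 expr0 mulr1 trunc_payoffS//.
  apply: first_stage_le => // s a b; rewrite trunc_payoff0 mulr0 addr0.
  by rewrite normrM gtr0_norm// ler_pM2l.
rewrite trunc_payoffS// [trunc_payoff K.+1 _ _ _]trunc_payoffS// -sumrB.
under eq_bigr do rewrite -sumrB.
under eq_bigr => s _ do under eq_bigr do rewrite -sumrB.
under eq_bigr => s _ do under eq_bigr => a _ do
  under eq_bigr => b _ do rewrite -mulrBr opprD addrACA subrr add0r -mulrBr.
apply: first_stage_le => // s a b.
rewrite normrM gtr0_norm ?subr_gt0// exprS mulrCA ler_pM2l ?subr_gt0//.
have := IH (P a b s) _ _ (behavior1_shift (s, a, b) sS)
  (behavior2_shift (a, b) tS) (P_ge0 a b s).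
by rewrite P_sum1 mulr1.
Qed.

Lemma payoff_trunc K (p : 'rV[R]_N) sigma tau : state_simplex N p ->
  behavior1 sigma -> behavior2 tau ->
  `|payoff g P l p sigma tau - trunc_payoff K (p ord0) sigma tau| <=
  M * (1 - l) ^+ K.
Proof.
move=> [p0 p1] sS tS; have /andP[l0 l1] := l01.
pose J K := trunc_payoff K (p ord0) sigma tau.
have incr k : `|J k.+1 - J k| <= M * (1 - l) ^+ k - M * (1 - l) ^+ k.+1.
  have := trunc_payoff_increment k sS tS p0.
  rewrite -/(J k) -/(J k.+1) p1 mulr1; move/le_trans; apply.
  by rewrite exprS le_eqVlt; apply/orP; left; apply/eqP; ring.
have pc : (fun k => M * (1 - l) ^+ k) @ \oo --> (0 : R).
  rewrite -[X in _ --> X](mulr0 M); apply: cvgMr.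
  by apply: cvg_expr; rewrite ger0_norm ?subr_ge0 ?(ltW l1)// ltrBlDr ltrDl.
pose lo k := J k - M * (1 - l) ^+ k.
pose hi k := J k + M * (1 - l) ^+ k.
have loS : nondecreasing_seq lo.
  apply/nondecreasing_seqP => k; rewrite /lo.
  by have := incr k; rewrite ler_norml => /andP[]; lra.
have hiS : nonincreasing_seq hi.
  apply/nonincreasing_seqP => k; rewrite /hi.
  by have := incr k; rewrite ler_norml => /andP[]; lra.
have M0 k : 0 <= M * (1 - l) ^+ k.
  have [m|m] := leP 0 M; first by rewrite mulr_ge0// exprn_ge0// subr_ge0 ltW.
  have := incr 0%N; rewrite expr0 expr1 => H.
  have := le_trans (normr_ge0 _) H; nra.
have lohi k : lo k <= hi 0%N.
  apply: (@le_trans _ _ (hi k)); last exact: hiS.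
  by rewrite /lo /hi; have := M0 k; lra.
have clo : cvgn lo.
  apply: nondecreasing_is_cvgn => //.
  by exists (hi 0%N) => _ [k _ <-].
have cJ : J @ \oo --> limn lo.
  have -> : J = (fun k => lo k + M * (1 - l) ^+ k).
    by apply/funext => k; rewrite /lo subrK.
  by rewrite -[X in _ --> X]addr0; apply: cvgD.
have chi : hi @ \oo --> limn lo.
  by rewrite -[X in _ --> X]addr0; apply: cvgD.
have -> : payoff g P l p sigma tau = limn lo by exact: cvg_lim.
rewrite -/(J K) ler_norml.
have : lo K <= limn lo by exact: nondecreasing_cvgn_le.
have : limn lo <= hi K.
  have := nonincreasing_cvgn_ge hiS (cvgP _ chi) K.
  by rewrite (cvg_lim _ chi).
by rewrite /lo /hi; lra.
Qed.

End TruncatedPayoff.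

Section GameValue.
Context {R : realType} {N : nat} {A B : finType}.
Variables (g : 'I_N -> A -> B -> R) (P : A -> B -> 'M[R]_N) (l M : R).
Hypothesis P_ge0 : forall a b s s', 0 <= P a b s s'.
Hypothesis P_sum1 : forall a b s, \sum_s' P a b s s' = 1.
Hypothesis l01 : 0 < l < 1.
Hypothesis gM : forall s a b, `|g s a b| <= M.
Hypothesis M_ge0 : 0 <= M.
Variables (a0 : A) (b0 : B).
Local Notation stage := (@stage N A B).
Local Notation strategy1 := (@strategy1 R N A B).
Local Notation strategy2 := (@strategy2 R A B).
Implicit Types (sigma : strategy1) (tau : strategy2) (q xi p : 'rV[R]_N).

Let l0 : 0 < l. Proof. by case/andP: l01. Qed.
Let l1 : 0 < 1 - l. Proof. by case/andP: l01; rewrite subr_gt0. Qed.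

(* [xi] bounds a vector of payoffs, indexed by the initial state, that
   player 2 can secure with an explicit plan for K stages. *)
Fixpoint guaranteed (K : nat) xi : Prop :=
  if K is K'.+1 then
    exists (y : B -> R) (eta : A -> B -> 'rV[R]_N),
      [/\ simplex B y, forall a b, guaranteed K' (eta a b) &
        forall s a, \sum_b y b * (l * g s a b +
          (1 - l) * \sum_s' P a b s s' * eta a b ord0 s') <= xi ord0 s]
  else forall s, M <= xi ord0 s.

Lemma guaranteed_ge K xi s : guaranteed K xi -> - M <= xi ord0 s.
Proof.
elim: K xi s => [|K IH] xi s /=; first by move=> /(_ s); move: M_ge0; lra.
move=> [y [eta [yS etaG xige]]]; apply: le_trans (xige s a0).
apply: simplex_sum_ge => // b.
have : - M <= \sum_s' P a0 b s s' * eta a0 b ord0 s'.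
  apply: simplex_sum_ge => [|s']; first by split.
  exact: IH (etaG a0 b).
have := gM s a0 b; rewrite ler_norml => /andP[g1 _].
by move: l0 l1; nra.
Qed.

Lemma guaranteedS K xi : guaranteed K xi -> guaranteed K.+1 xi.
Proof.
elim: K xi => [|K IH] xi.
  move=> xiM; exists (fun b => (b == b0)%:R), (fun _ _ => const_mx M); split.
  - exact: simplex_point.
  - by move=> a b s; rewrite mxE.
  - move=> s a; apply: le_trans (xiM s).
    apply: simplex_sum_le => [|b]; first exact: simplex_point.
    have -> : \sum_s' P a b s s' * (const_mx M : 'rV[R]_N) ord0 s' = M.
      under eq_bigr do rewrite mxE.
      by rewrite -mulr_suml P_sum1 mul1r.
    have := gM s a b; rewrite ler_norml => /andP[_ g1].
    by move: l0; nra.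
move=> [y [eta [yS etaG xige]]]; exists y, eta; split=> // a b.
exact: (IH _ (etaG a b)).
Qed.

Lemma guaranteed_le K K' xi : (K <= K')%N -> guaranteed K xi -> guaranteed K' xi.
Proof.
move=> /subnK <-; elim: (K' - K)%N => [//|k IH] xiG.
by rewrite addSn; exact: guaranteedS (IH xiG).
Qed.

Lemma weighted_mix (y y' t : R) (u u' : R) : 0 <= y -> 0 <= y' -> 0 <= t <= 1 ->
  let z := (1 - t) * y + t * y' in
  let c := t * y' / z in
  [/\ 0 <= c <= 1 & z * ((1 - c) * u + c * u') = (1 - t) * (y * u) + t * (y' * u')].
Proof.
move=> y0 y'0 /andP[t0 t1] z c.
have a0' : 0 <= (1 - t) * y by rewrite mulr_ge0// subr_ge0.
have b0' : 0 <= t * y' by rewrite mulr_ge0.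
have [z0|z0] := eqVneq z 0.
  have e1 : (1 - t) * y = 0 by apply: le_anti; rewrite a0' andbT -z0 lerDl.
  have e2 : t * y' = 0 by apply: le_anti; rewrite b0' andbT -z0 lerDr.
  split; first by rewrite /c e2 mul0r lexx ler01.
  by rewrite z0 mul0r !mulrA e1 e2 !mul0r addr0.
have zp : 0 < z by rewrite lt_neqAle eq_sym z0 addr_ge0.
split; first by rewrite divr_ge0 ?(ltW zp)//= ler_pdivrMr// mul1r lerDr.
have zc : z * c = t * y' by rewrite /c mulrC divfK.
have -> : z * ((1 - c) * u + c * u') = (z - z * c) * u + z * c * u' by ring.
by rewrite zc /z; ring.
Qed.

Lemma guaranteed_convex K xi xi' (t : R) : guaranteed K xi -> guaranteed K xi' ->
  0 <= t <= 1 -> guaranteed K ((1 - t) *: xi + t *: xi').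
Proof.
elim: K xi xi' t => [|K IH] xi xi' t /=.
  move=> xiM xiM' /andP[t0 t1] s; rewrite !mxE.
  by move: (xiM s) (xiM' s); nra.
move=> [y [eta [yS etaG xige]]] [y' [eta' [yS' etaG' xige']]] t01.
pose z b := (1 - t) * y b + t * y' b.
pose c b := t * y' b / z b.
have y0 b : 0 <= y b by case: yS.
have y'0 b : 0 <= y' b by case: yS'.
exists z, (fun a b => (1 - c b) *: eta a b + c b *: eta' a b); split.
- exact: simplex_convex.
- move=> a b; apply: IH => //.
  by have [] := weighted_mix 0 0 (y0 b) (y'0 b) t01.
- move=> s a; rewrite !mxE; have /andP[t0 t1] := t01.
  apply: (@le_trans _ _ ((1 - t) * (\sum_b y b * (l * g s a b +
          (1 - l) * \sum_s' P a b s s' * eta a b ord0 s')) +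
      t * (\sum_b y' b * (l * g s a b +
          (1 - l) * \sum_s' P a b s s' * eta' a b ord0 s')))); last first.
    by apply: lerD; apply: ler_wpM2l => //; rewrite subr_ge0.
  rewrite !mulr_sumr -big_split/= le_eqVlt; apply/orP; left; apply/eqP.
  apply: eq_bigr => b _.
  set u := l * _ + _ * (\sum_s' P a b s s' * eta a b ord0 s').
  set u' := l * _ + _ * (\sum_s' P a b s s' * eta' a b ord0 s').
  have [_ <-] := weighted_mix u u' (y0 b) (y'0 b) t01.
  congr (_ * _); rewrite -/(z b) -/(c b) /u /u'.
  have -> : \sum_s' P a b s s' * ((1 - c b) *: eta a b + c b *: eta' a b) ord0 s' =
     (1 - c b) * (\sum_s' P a b s s' * eta a b ord0 s') +
     c b * (\sum_s' P a b s s' * eta' a b ord0 s').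
    rewrite !mulr_sumr -big_split/=; apply: eq_bigr => s' _.
    by rewrite !mxE; ring.
  by ring.
Qed.

Definition attainable : set 'rV[R]_N := [set xi | exists K, guaranteed K xi].

Lemma attainable_step (y : B -> R) (eta : A -> B -> 'rV[R]_N) xi :
  simplex B y -> (forall a b, attainable (eta a b)) ->
  (forall s a, \sum_b y b * (l * g s a b +
     (1 - l) * \sum_s' P a b s s' * eta a b ord0 s') <= xi ord0 s) ->
  attainable xi.
Proof.
move=> yS etaG xige.
have /choice[K KP] (ab : A * B) : exists K, guaranteed K (eta ab.1 ab.2).
  exact: etaG.
exists (\max_ab K ab).+1; exists y, eta; split=> // a b.
apply: guaranteed_le (KP (a, b)).
exact: (leq_bigmax (a, b)).
Qed.

Lemma attainable_const : attainable (const_mx M).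
Proof. by exists 0%N => s; rewrite mxE. Qed.

Lemma attainable_unstep xi : attainable xi ->
  exists (y : B -> R) (eta : A -> B -> 'rV[R]_N),
    [/\ simplex B y, forall a b, attainable (eta a b) &
      forall s a, \sum_b y b * (l * g s a b +
        (1 - l) * \sum_s' P a b s s' * eta a b ord0 s') <= xi ord0 s].
Proof.
move=> [K /guaranteedS[y [eta [yS etaG xige]]]]; exists y, eta; split=> // a b.
by exists K; exact: etaG.
Qed.

Lemma attainable_convex xi xi' (t : R) : attainable xi -> attainable xi' ->
  0 <= t <= 1 -> attainable ((1 - t) *: xi + t *: xi').
Proof.
move=> [K xiG] [K' xiG'] t01; exists (maxn K K'); apply: guaranteed_convex => //.
  by apply: guaranteed_le xiG; exact: leq_maxl.
by apply: guaranteed_le xiG'; exact: leq_maxr.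
Qed.

Definition nonneg q := forall s, 0 <= q ord0 s.

(* The value of the game, extended to unnormalised beliefs. *)
Definition val_fun q : R := inf [set dot q xi | xi in attainable].

Lemma dot_attainable_ge q xi : nonneg q -> attainable xi ->
  - M * \sum_s q ord0 s <= dot q xi.
Proof.
move=> q0 [K xiG]; rewrite mulr_sumr; apply: ler_sum => s _.
by rewrite mulrC ler_wpM2l//; exact: guaranteed_ge xiG.
Qed.

Lemma has_inf_val q : nonneg q -> has_inf [set dot q xi | xi in attainable].
Proof.
move=> q0; split.
  by exists (dot q (const_mx M)), (const_mx M) => //; exact: attainable_const.
exists (- M * \sum_s q ord0 s) => _ [xi xiA <-]; exact: dot_attainable_ge.
Qed.

Lemma val_le q xi : nonneg q -> attainable xi -> val_fun q <= dot q xi.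
Proof.
move=> q0 xiA; apply: ge_inf; first by case: (has_inf_val q0).
by exists xi.
Qed.

Lemma val_ge q c : (forall xi, attainable xi -> c <= dot q xi) -> c <= val_fun q.
Proof.
move=> qc; apply: lb_le_inf.
  by exists (dot q (const_mx M)), (const_mx M) => //; exact: attainable_const.
by move=> _ [xi xiA <-]; exact: qc.
Qed.

Lemma val_approx q (e : R) : nonneg q -> 0 < e ->
  exists2 xi, attainable xi & dot q xi < val_fun q + e.
Proof.
move=> q0 e0; have [_ [xi xiA <-] H] := inf_adherent e0 (has_inf_val q0).
by exists xi.
Qed.

Lemma val_le_mass q : nonneg q -> val_fun q <= M * \sum_s q ord0 s.
Proof.
move=> q0; apply: (le_trans (val_le q0 attainable_const)).
by rewrite /dot mulr_sumr; apply: ler_sum => s _; rewrite mxE mulrC.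
Qed.

Lemma val_ge_mass q : nonneg q -> - (M * \sum_s q ord0 s) <= val_fun q.
Proof.
move=> q0; apply: val_ge => xi xiA; rewrite -mulNr.
exact: dot_attainable_ge.
Qed.

Lemma val_scale q (t : R) : nonneg q -> 0 <= t -> val_fun (t *: q) = t * val_fun q.
Proof.
move=> q0; rewrite le_eqVlt => /predU1P[<-|t0].
  rewrite scale0r mul0r; apply: le_anti; apply/andP; split.
    rewrite -(dot0l (const_mx M : 'rV[R]_N)).
    by apply: val_le attainable_const => s; rewrite mxE.
  by apply: val_ge => xi _; rewrite dot0l.
have tq0 : nonneg (t *: q) by move=> s; rewrite mxE mulr_ge0// ltW.
apply: le_anti; apply/andP; split.
  rewrite -ler_pdivrMl//; apply: val_ge => xi xiA.
  by rewrite ler_pdivrMl// -dotZl; exact: val_le.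
apply: val_ge => xi xiA; rewrite dotZl ler_pM2l//; exact: val_le.
Qed.

Lemma val_superadd q q' : nonneg q -> nonneg q' ->
  val_fun q + val_fun q' <= val_fun (q + q').
Proof.
move=> q0 q'0; apply: val_ge => xi xiA; rewrite dotDl.
by apply: lerD; exact: val_le.
Qed.

Lemma guaranteed_min K xi : guaranteed K xi ->
  guaranteed K (\row_s Num.min (xi ord0 s) M).
Proof.
elim: K xi => [|K IH] xi /=; first by move=> xiM s; rewrite mxE le_min xiM lexx.
move=> [y [eta [yS etaG xige]]].
exists y, (fun a b => \row_s Num.min (eta a b ord0 s) M); split=> //.
  by move=> a b; exact: (IH _ (etaG a b)).
move=> s a; rewrite mxE le_min; apply/andP; split.
  apply: le_trans (xige s a); apply: ler_sum => b _.
  rewrite ler_wpM2l//; first by case: yS.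
  rewrite lerD2l ler_pM2l//; apply: ler_sum => s' _.
  by rewrite ler_wpM2l// mxE ge_min lexx.
apply: simplex_sum_le => // b.
have : \sum_s' P a b s s' * (\row_s Num.min (eta a b ord0 s) M) ord0 s' <= M.
  apply: simplex_sum_le => [|s']; first by split.
  by rewrite mxE ge_min lexx orbT.
have := gM s a b; rewrite ler_norml => /andP[_ g1].
by move: l0 l1; nra.
Qed.

Lemma val_lipschitz q q' : nonneg q -> nonneg q' ->
  val_fun q <= val_fun q' + M * norm1 (q - q').
Proof.
move=> q0 q'0; rewrite -lerBlDr; apply: val_ge => xi [K xiG].
pose xi' : 'rV[R]_N := \row_s Num.min (xi ord0 s) M.
have xiG' : guaranteed K xi' by exact: guaranteed_min.
rewrite lerBlDr; apply: (le_trans (val_le q0 (ex_intro _ K xiG'))).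
have -> : dot q xi' = dot q' xi' + dot (q - q') xi' by rewrite dotBl; ring.
apply: lerD.
  by apply: ler_sum => s _; rewrite ler_wpM2l// mxE ge_min lexx.
apply: (le_trans (ler_norm _)); apply: dot_le_norm1 => s.
by rewrite ler_norml (guaranteed_ge s xiG')/= mxE ge_min lexx orbT.
Qed.

Definition update q (x : 'I_N -> A -> R) (a : A) (b : B) : 'rV[R]_N :=
  (\row_s (q ord0 s * x s a)) *m P a b.

Lemma update_nonneg q x a b : nonneg q -> (forall s, simplex A (x s)) ->
  nonneg (update q x a b).
Proof.
move=> q0 xS s'; rewrite mxE; apply: sumr_ge0 => s _; rewrite mxE.
by rewrite !mulr_ge0//; case: (xS s).
Qed.

Lemma update_mass q x a b :
  \sum_s' update q x a b ord0 s' = \sum_s q ord0 s * x s a.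
Proof.
under eq_bigr do rewrite mxE.
rewrite exchange_big/=; apply: eq_bigr => s _.
by rewrite -mulr_sumr P_sum1 mulr1 mxE.
Qed.

Lemma update_mass_sum q x b : (forall s, simplex A (x s)) ->
  \sum_a \sum_s' update q x a b ord0 s' = \sum_s q ord0 s.
Proof.
move=> xS; under eq_bigr do rewrite update_mass.
rewrite exchange_big/=; apply: eq_bigr => s _.
by rewrite -mulr_sumr (xS s).2 mulr1.
Qed.

Lemma dot_update q x a b xi :
  dot (update q x a b) xi =
  \sum_s q ord0 s * x s a * \sum_s' P a b s s' * xi ord0 s'.
Proof.
rewrite /dot; under eq_bigr do rewrite mxE mulr_suml.
rewrite exchange_big/=; apply: eq_bigr => s _.
by rewrite mulr_sumr; apply: eq_bigr => s' _; rewrite mxE -!mulrA.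
Qed.

Definition stage_payoff q (x : 'I_N -> A -> R) (b : B) : R :=
  \sum_a (l * (\sum_s q ord0 s * x s a * g s a b) +
          (1 - l) * val_fun (update q x a b)).

Lemma val_ge_stage q x c : nonneg q -> (forall s, simplex A (x s)) ->
  (forall b, c <= stage_payoff q x b) -> c <= val_fun q.
Proof.
move=> q0 xS cb; apply: val_ge => xi /attainable_unstep[y [eta [yS etaA xige]]].
apply: (@le_trans _ _ (\sum_b y b * stage_payoff q x b)).
  exact: simplex_sum_ge.
apply: (@le_trans _ _ (\sum_s q ord0 s * \sum_a x s a *
    \sum_b y b * (l * g s a b + (1 - l) * \sum_s' P a b s s' * eta a b ord0 s')));
    last first.
  apply: ler_sum => s _; rewrite ler_wpM2l//.
  by apply: simplex_sum_le.
apply: (@le_trans _ _ (\sum_b y b * \sum_a (l * (\sum_s q ord0 s * x s a * g s a b)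
    + (1 - l) * dot (update q x a b) (eta a b)))).
  apply: ler_sum => b _; rewrite ler_wpM2l//; first by case: yS.
  apply: ler_sum => a _; rewrite lerD2l ler_pM2l//.
  by apply: val_le => //; exact: update_nonneg.
rewrite le_eqVlt; apply/orP; left; apply/eqP.
under eq_bigr do rewrite mulr_sumr.
rewrite exchange_big/=.
under [RHS]eq_bigr do rewrite mulr_sumr.
rewrite [RHS]exchange_big/=; apply: eq_bigr => a _.
under [RHS]eq_bigr do rewrite mulrA mulr_sumr.
rewrite [RHS]exchange_big/=; apply: eq_bigr => b _.
rewrite dot_update !mulr_sumr -big_split/= mulr_sumr; apply: eq_bigr => s _.
by ring.
Qed.

Lemma val_le_stage q : nonneg q ->
  exists2 x : 'I_N -> A -> R, (forall s, simplex A (x s)) &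
    forall b, val_fun q <= stage_payoff q x b.
Proof.
move=> q0.
pose c (y : B -> R) (eta : A -> B -> 'rV[R]_N) s a := \sum_b y b *
  (l * g s a b + (1 - l) * \sum_s' P a b s s' * eta a b ord0 s').
pose kf y eta (f : {ffun 'I_N -> A}) := \sum_s q ord0 s * c y eta s (f s) - val_fun q.
pose K : set ({ffun 'I_N -> A} -> R) := [set k | exists (y : B -> R) eta,
  [/\ simplex B y, forall a b, attainable (eta a b) & forall f, k f = kf y eta f]].
have [||k [y [eta [yS etaA kE]]]|X XS XK] := @convex_alternative R _ K.
- by apply/card_gt0P; exists [ffun=> a0].
- move=> k k' t [y [eta [yS etaA kE]]] [y' [eta' [yS' etaA' kE']]] t01.
  pose z b := (1 - t) * y b + t * y' b.
  pose w b := t * y' b / z b.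
  have y0 b : 0 <= y b by case: yS.
  have y'0 b : 0 <= y' b by case: yS'.
  pose eta'' a b := (1 - w b) *: eta a b + w b *: eta' a b.
  exists (kf z eta''); last first.
    move=> f; rewrite kE kE' /kf le_eqVlt; apply/orP; left; apply/eqP.
    have -> : \sum_s q ord0 s * c z eta'' s (f s) =
       (1 - t) * (\sum_s q ord0 s * c y eta s (f s)) +
       t * (\sum_s q ord0 s * c y' eta' s (f s)).
      rewrite !mulr_sumr -big_split/=; apply: eq_bigr => s _.
      rewrite [in RHS]mulrCA [t * _]mulrCA -mulrDr; congr (_ * _).
      rewrite /c !mulr_sumr -big_split/=; apply: eq_bigr => b _.
      have [_ <-] := weighted_mix (l * g s (f s) b + (1 - l) *
          \sum_s' P (f s) b s s' * eta (f s) b ord0 s')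
        (l * g s (f s) b + (1 - l) *
          \sum_s' P (f s) b s s' * eta' (f s) b ord0 s') (y0 b) (y'0 b) t01.
      congr (_ * _); rewrite -/(z b) -/(w b).
      have -> : \sum_s' P (f s) b s s' * eta'' (f s) b ord0 s' =
         (1 - w b) * (\sum_s' P (f s) b s s' * eta (f s) b ord0 s') +
         w b * (\sum_s' P (f s) b s s' * eta' (f s) b ord0 s').
        rewrite !mulr_sumr -big_split/=; apply: eq_bigr => s' _.
        by rewrite !mxE; ring.
      by ring.
    by ring.
  exists z, eta''; split=> //; first exact: simplex_convex.
  move=> a b; apply: attainable_convex => //.
  by have [] := weighted_mix 0 0 (y0 b) (y'0 b) t01.
- pose f : {ffun 'I_N -> A} := [ffun s => [arg max_(a > a0) c y eta s a]%O].
  exists f; rewrite kE /kf subr_ge0.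
  have -> : \sum_s q ord0 s * c y eta s (f s) = dot q (\row_s c y eta s (f s)).
    by apply: eq_bigr => s _; rewrite mxE.
  apply: val_le => //; apply: (attainable_step yS etaA) => s a; rewrite mxE ffunE.
  by case: arg_maxP => // i _; exact.
pose x s a := \sum_(f : {ffun 'I_N -> A} | f s == a) X f.
have X0 f : 0 <= X f by case: XS.
have xsum s (F : A -> R) : \sum_f X f * F (f s) = \sum_a x s a * F a.
  rewrite (partition_big (fun f : {ffun 'I_N -> A} => f s) predT)//=.
  apply: eq_bigr => a _; rewrite mulr_suml.
  by apply: eq_bigr => f /eqP ->.
have xS s : simplex A (x s).
  split=> [a|]; first exact: sumr_ge0.
  have := xsum s (fun=> 1); under eq_bigr do rewrite mulr1.
  by under [X in _ = X -> _]eq_bigr do rewrite mulr1; move=> <-; case: XS.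
exists x => // b; apply/ler_addgt0Pr => e e0.
pose e' := e / #|A|%:R.
have A0 : (0 < #|A|%:R :> R) by rewrite ltr0n; apply/card_gt0P; exists a0.
have e'0 : 0 < e' by rewrite divr_gt0.
have /choice[eta etaP] a : exists xi, attainable xi /\
    dot (update q x a b) xi < val_fun (update q x a b) + e'.
  have [xi xiA xiv] := val_approx (update_nonneg a b q0 xS) e'0.
  by exists xi.
pose y b' : R := (b' == b)%:R.
have /XK H : K (kf y (fun a _ => eta a)).
  exists y, (fun a _ => eta a); split=> //; first exact: simplex_point.
  by move=> a _; case: (etaP a).
have {}H : val_fun q <= \sum_f X f * \sum_s q ord0 s * c y (fun a _ => eta a) s (f s).
  move: H; rewrite /kf; under eq_bigr do rewrite mulrBr.
  by rewrite sumrB -mulr_suml XS.2 mul1r subr_ge0.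
apply: (le_trans H).
have -> : \sum_f X f * (\sum_s q ord0 s * c y (fun a _ => eta a) s (f s)) =
  \sum_a (l * (\sum_s q ord0 s * x s a * g s a b) +
    (1 - l) * dot (update q x a b) (eta a)).
  under eq_bigr do rewrite mulr_sumr.
  rewrite exchange_big/=.
  under eq_bigr => s _ do under eq_bigr do rewrite mulrCA.
  under eq_bigr => s _ do rewrite -mulr_sumr xsum mulr_sumr.
  rewrite exchange_big/=; apply: eq_bigr => a _.
  rewrite dot_update !mulr_sumr -big_split/=; apply: eq_bigr => s _.
  by rewrite /c /y sum_simplex_point; ring.
have -> : e = \sum_(a : A) e' by rewrite sumr_const -mulr_natr divfK// gt_eqF.
rewrite -big_split/=; apply: ler_sum => a _.
rewrite -addrA lerD2l; have := (etaP a).2.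
move: (dot _ _) (val_fun _) => u v uv.
apply: (@le_trans _ _ ((1 - l) * (v + e'))).
  by rewrite ler_pM2l// ltW.
by rewrite mulrDr lerD2l; move: l0 e'0; nra.
Qed.

Section Player1.
Variable x : 'rV[R]_N -> 'I_N -> A -> R.
Hypothesis xS : forall q s, simplex A (x q s).
Hypothesis xP : forall q, nonneg q -> forall b, val_fun q <= stage_payoff q (x q) b.

Fixpoint belief q (past : seq stage) : 'rV[R]_N :=
  if past is z :: past' then belief (update q (x q) z.1.2 z.2) past' else q.

Definition belief_strategy q : strategy1 := fun past s => x (belief q past) s.

Lemma behavior1_belief q : behavior1 (belief_strategy q).
Proof. by move=> past s; exact: xS. Qed.

Lemma belief_strategy_payoff K q tau : nonneg q -> behavior2 tau ->
  val_fun q - M * (1 - l) ^+ K * \sum_s q ord0 s <=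
  trunc_payoff g P l K (q ord0) (belief_strategy q) tau.
Proof.
elim: K q tau => [|K IH] q tau q0 tS.
  by rewrite trunc_payoff0 expr0 mulr1 subr_le0; exact: val_le_mass.
rewrite (trunc_payoffS g l P_sum1)//; last exact: behavior1_belief.
have -> : \sum_s \sum_a \sum_b q ord0 s * belief_strategy q [::] s a * tau [::] b *
     (l * g s a b + (1 - l) * trunc_payoff g P l K (P a b s)
       (shift1 (belief_strategy q) (s, a, b)) (shift2 tau (a, b))) =
   \sum_b tau [::] b * \sum_a (l * (\sum_s q ord0 s * x q s a * g s a b) +
     (1 - l) * trunc_payoff g P l K (update q (x q) a b ord0)
       (belief_strategy (update q (x q) a b)) (shift2 tau (a, b))).
  under [RHS]eq_bigr do rewrite mulr_sumr.
  rewrite [RHS]exchange_big/=.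
  under eq_bigr do rewrite exchange_big/=.
  rewrite exchange_big/=.
  rewrite [RHS]exchange_big/=; apply: eq_bigr => b _.
  rewrite exchange_big/=; apply: eq_bigr => a _.
  have -> : update q (x q) a b ord0 =
      (fun s' => \sum_s (q ord0 s * x q s a) * P a b s s').
    by apply/funext => s'; rewrite mxE; apply: eq_bigr => s _; rewrite mxE.
  rewrite trunc_payoff_lincomb//; [|exact: behavior1_belief|exact: behavior2_shift].
  rewrite !mulr_sumr -big_split/= mulr_sumr; apply: eq_bigr => s _.
  rewrite -[shift1 (belief_strategy q) (s, a, b)]/(belief_strategy (update q (x q) a b)).
  by rewrite /belief_strategy/=; ring.
apply: (@le_trans _ _ (\sum_b tau [::] b * (val_fun q -
    M * (1 - l) ^+ K.+1 * \sum_s q ord0 s))).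
  by apply: simplex_sum_ge => //; exact: tS.
apply: ler_sum => b _; rewrite ler_wpM2l//; first by case: (tS [::]).
apply: (@le_trans _ _ (\sum_a (l * (\sum_s q ord0 s * x q s a * g s a b) +
    (1 - l) * (val_fun (update q (x q) a b) -
      M * (1 - l) ^+ K * \sum_s' update q (x q) a b ord0 s')))).
  have -> : \sum_a (l * (\sum_s q ord0 s * x q s a * g s a b) +
      (1 - l) * (val_fun (update q (x q) a b) -
        M * (1 - l) ^+ K * \sum_s' update q (x q) a b ord0 s')) =
      stage_payoff q (x q) b - M * (1 - l) ^+ K.+1 * \sum_s q ord0 s.
    rewrite -(update_mass_sum q b (xS q)) mulr_sumr -sumrB.
    by apply: eq_bigr => a _; rewrite exprS; ring.
  by rewrite lerD2r; exact: xP.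
apply: ler_sum => a _; rewrite lerD2l ler_pM2l//.
by apply: IH; [exact: update_nonneg|exact: behavior2_shift].
Qed.

End Player1.

Lemma player1_guarantee p : state_simplex N p ->
  exists2 sigma, behavior1 sigma & forall tau, behavior2 tau ->
    val_fun p <= payoff g P l p sigma tau.
Proof.
move=> pD; have p0 : nonneg p by case: pD.
have /choice[x xP] q : exists x : 'I_N -> A -> R, (forall s, simplex A (x s)) /\
    (nonneg q -> forall b, val_fun q <= stage_payoff q x b).
  have [q0|q0] := pselect (nonneg q).
    by have [x xS xP] := val_le_stage q0; exists x.
  by exists (fun _ a => (a == a0)%:R); split=> // s; exact: simplex_point.
have xS q : forall s, simplex A (x q s) by case: (xP q).
have xV q : nonneg q -> forall b, val_fun q <= stage_payoff q (x q) b.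
  by case: (xP q).
have sS : behavior1 (belief_strategy x p) by move=> past s; exact: xS.
exists (belief_strategy x p) => // tau tS; apply/ler_addgt0Pr => e e0.
have [K Ke] : exists K, 2 * M * (1 - l) ^+ K < e.
  have : (fun k => 2 * M * (1 - l) ^+ k) @ \oo --> (0 : R).
    rewrite -[X in _ --> X](mulr0 (2 * M)); apply: cvgMr.
    by apply: cvg_expr; rewrite ger0_norm ?(ltW l1)// ltrBlDr ltrDl.
  move=> /cvgrPdist_lt/(_ _ e0)[K _ /(_ K (leqnn K))]/=.
  rewrite sub0r normrN => H; exists K; exact: le_lt_trans (ler_norm _) H.
have := belief_strategy_payoff xS xV K p0 tS; rewrite pD.2 mulr1.
have := payoff_trunc P_ge0 P_sum1 l01 gM K pD sS tS.
by rewrite ler_norml => /andP[]; move: Ke; lra.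
Qed.

Lemma guaranteed_strategy K xi : guaranteed K xi ->
  exists2 tau, behavior2 tau & forall sigma, behavior1 sigma ->
    forall L (q : 'I_N -> R), (forall s, 0 <= q s) ->
    trunc_payoff g P l L q sigma tau <=
      \sum_s q s * xi ord0 s + M * (1 - l) ^+ L * \sum_s q s.
Proof.
elim: K xi => [|K IH] xi.
  move=> xiM; exists (fun _ b => (b == b0)%:R).
    by move=> past; exact: simplex_point.
  move=> sigma sS L q q0.
  set tau := fun _ => _; have tS : behavior2 tau by move=> past; exact: simplex_point.
  have : trunc_payoff g P l L q sigma tau <= M * (1 - (1 - l) ^+ L) * \sum_s q s.
    elim: L => [|L IHL]; first by rewrite trunc_payoff0 expr0 subrr mulr0 mul0r.
    have := trunc_payoff_increment P_ge0 P_sum1 l01 gM L sS tS q0.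
    rewrite ler_norml => /andP[_ H].
    have := lerD H IHL; rewrite subrK => /le_trans; apply.
    by rewrite -mulrDl exprS le_eqVlt; apply/orP; left; apply/eqP; ring.
  have : M * \sum_s q s <= \sum_s q s * xi ord0 s.
    by rewrite mulr_sumr; apply: ler_sum => s _; rewrite mulrC ler_wpM2l.
  have : 0 <= M * (1 - l) ^+ L * \sum_s q s.
    by rewrite !mulr_ge0 ?sumr_ge0// exprn_ge0// ltW.
  rewrite mulrBr mulr1 mulrBl; lra.
move=> [y [eta [yS etaG xige]]].
have /choice[t tP] (c : A * B) : exists tau, behavior2 tau /\
    forall sigma, behavior1 sigma -> forall L (q : 'I_N -> R), (forall s, 0 <= q s) ->
    trunc_payoff g P l L q sigma tau <=
      \sum_s q s * eta c.1 c.2 ord0 s + M * (1 - l) ^+ L * \sum_s q s.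
  by have [tau tS tauP] := IH _ (etaG c.1 c.2); exists tau.
pose tau (past : seq (A * B)) := if past is c :: past' then t c past' else y.
have tS : behavior2 tau.
  by case=> [|c past]; [exact: yS|case: (tP c) => + _; exact].
exists tau => // sigma sS L q q0.
have xiG : guaranteed K.+1 xi by exists y, eta.
case: L => [|L].
  rewrite trunc_payoff0 expr0 mulr1 mulr_sumr -big_split/=; apply: sumr_ge0 => s _.
  by have := guaranteed_ge s xiG; have := q0 s; nra.
rewrite (trunc_payoffS g l P_sum1)//.
have -> : \sum_s q s * xi ord0 s + M * (1 - l) ^+ L.+1 * \sum_s q s =
    \sum_s q s * (xi ord0 s + M * (1 - l) ^+ L.+1).
  rewrite mulr_sumr -big_split/=; apply: eq_bigr => s _.
  by rewrite mulrDr; congr (_ + _); rewrite mulrC.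
apply: ler_sum => s _.
under eq_bigr => a _ do under eq_bigr => b _ do rewrite -mulrA -mulrA.
under eq_bigr do rewrite -!mulr_sumr.
rewrite -mulr_sumr ler_wpM2l//; apply: simplex_sum_le => // a.
apply: (@le_trans _ _ (\sum_b y b * (l * g s a b +
    (1 - l) * ((\sum_s' P a b s s' * eta a b ord0 s') + M * (1 - l) ^+ L)))).
  apply: ler_sum => b _; rewrite ler_wpM2l//=; first by case: yS.
  rewrite lerD2l ler_pM2l//.
  have := (tP (a, b)).2 _ (behavior1_shift (s, a, b) sS) L (P a b s) (P_ge0 a b s).
  by rewrite P_sum1 mulr1.
have -> : \sum_b y b * (l * g s a b +
    (1 - l) * ((\sum_s' P a b s s' * eta a b ord0 s') + M * (1 - l) ^+ L)) =
    \sum_b y b * (l * g s a b + (1 - l) * (\sum_s' P a b s s' * eta a b ord0 s'))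
    + M * (1 - l) ^+ L.+1.
  rewrite -[M * (1 - l) ^+ L.+1]mul1r -yS.2 mulr_suml -big_split/=.
  by apply: eq_bigr => b _; rewrite exprS; ring.
by rewrite lerD2r.
Qed.

Lemma player2_guarantee p xi : state_simplex N p -> attainable xi ->
  exists2 tau, behavior2 tau & forall sigma, behavior1 sigma ->
    payoff g P l p sigma tau <= dot p xi.
Proof.
move=> pD [K /guaranteed_strategy[tau tS tauP]]; exists tau => // sigma sS.
apply/ler_addgt0Pr => e e0.
have [L Le] : exists K, 2 * M * (1 - l) ^+ K < e.
  have : (fun k => 2 * M * (1 - l) ^+ k) @ \oo --> (0 : R).
    rewrite -[X in _ --> X](mulr0 (2 * M)); apply: cvgMr.
    by apply: cvg_expr; rewrite ger0_norm ?(ltW l1)// ltrBlDr ltrDl.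
  move=> /cvgrPdist_lt/(_ _ e0)[L _ /(_ L (leqnn L))]/=.
  rewrite sub0r normrN => H; exists L; exact: le_lt_trans (ler_norm _) H.
have := tauP _ sS L (p ord0) pD.1; rewrite pD.2 mulr1 -/(dot p xi).
have := payoff_trunc P_ge0 P_sum1 l01 gM L pD sS tS.
by rewrite ler_norml => /andP[]; move: Le; lra.
Qed.

Lemma val_fun_is_value p : state_simplex N p -> is_value g P l p (val_fun p).
Proof.
move=> pD; have p0 : nonneg p by case: pD.
have [s1 s1S s1P] := player1_guarantee pD.
have p2 (e : R) : 0 < e -> exists2 tau, behavior2 tau &
    forall sigma, behavior1 sigma -> payoff g P l p sigma tau <= val_fun p + e.
  move=> e0; have [xi xiA xie] := val_approx p0 e0.
  have [tau tS tauP] := player2_guarantee pD xiA; exists tau => // sigma sS.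
  exact: le_trans (tauP _ sS) (ltW xie).
split; apply/eqP; rewrite eq_le; apply/andP; split.
- apply: le_trans (ereal_sup_ubound _); last by exists s1.
  by apply: le_ereal_inf_tmp => _ [tau tS <-]; rewrite lee_fin s1P.
- apply: ge_ereal_sup => _ [sigma sS <-].
  apply/lee_addgt0Pr => e e0; have [tau tS tauP] := p2 e e0.
  apply: (@le_trans _ _ (payoff g P l p sigma tau)%:E).
    by apply: ereal_inf_lbound; exists tau.
  by rewrite -EFinD lee_fin tauP.
- apply: le_ereal_inf_tmp => _ [tau tS <-].
  apply: (@le_trans _ _ (payoff g P l p s1 tau)%:E); first by rewrite lee_fin s1P.
  by apply: ereal_sup_ubound; exists s1.
- apply/lee_addgt0Pr => e e0; have [tau tS tauP] := p2 e e0.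
  apply: (@le_trans _ _ (ereal_sup [set (payoff g P l p sigma tau)%:E
      | sigma in behavior1])).
    by apply: ereal_inf_lbound; exists tau.
  apply: ge_ereal_sup => _ [sigma sS <-].
  by rewrite -EFinD lee_fin tauP.
Qed.

End GameValue.

(** * Hamiltonian *)

Section Hamiltonian.
Context {R : realType} {N : nat} {A B : finType}.
Variables (g : 'I_N -> A -> B -> R) (r : R) (Q : A -> B -> 'M[R]_N).
Variables (a0 : A) (b0 : B).
Implicit Types (p xi : 'rV[R]_N).
Local Notation H := (hamiltonian g r Q).

Definition ham_term p xi a b : R :=
  - dot (p *m Q a b) xi - r * \sum_s p ord0 s * g s a b.

Lemma hamiltonian_integrand p xi (x : A -> R) (y : B -> R) :
  - dot (p *m mean_rate Q x y) xi - r * mean_payoff g p x y =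
  \sum_a x a * \sum_b y b * ham_term p xi a b.
Proof.
have -> : dot (p *m mean_rate Q x y) xi =
    \sum_a x a * \sum_b y b * dot (p *m Q a b) xi.
  rewrite /mean_rate mulmx_sumr dot_suml; apply: eq_bigr => a _.
  rewrite mulmx_sumr dot_suml mulr_sumr; apply: eq_bigr => b _.
  by rewrite -scalemxAr dotZl mulrA.
have -> : mean_payoff g p x y =
    \sum_a x a * \sum_b y b * \sum_s p ord0 s * g s a b.
  rewrite /mean_payoff exchange_big/=; apply: eq_bigr => a _.
  rewrite exchange_big/= mulr_sumr; apply: eq_bigr => b _.
  by rewrite !mulr_sumr; apply: eq_bigr => s _; ring.
rewrite mulr_sumr -sumrN -sumrB; apply: eq_bigr => a _.
rewrite mulrCA -mulrN -mulrBr; congr (_ * _).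
rewrite mulr_sumr -sumrN -sumrB; apply: eq_bigr => b _.
by rewrite /ham_term; ring.
Qed.

Let val p xi x y := - dot (p *m mean_rate Q x y) xi - r * mean_payoff g p x y.
Let bnd p xi := \sum_a \sum_b `|ham_term p xi a b|.

Let ham_term_le p xi a b : `|ham_term p xi a b| <= bnd p xi.
Proof.
rewrite /bnd (bigD1 a)//= (bigD1 b)//= -addrA lerDl addr_ge0// ?sumr_ge0//.
by move=> ? _; exact: sumr_ge0.
Qed.

Let val_norm p xi x y : simplex A x -> simplex B y -> `|val p xi x y| <= bnd p xi.
Proof.
move=> xS yS; rewrite /val hamiltonian_integrand ler_norml; apply/andP; split.
  apply: simplex_sum_ge => // a; apply: simplex_sum_ge => // b.
  by have := ham_term_le p xi a b; rewrite ler_norml => /andP[].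
apply: simplex_sum_le => // a; apply: simplex_sum_le => // b.
by have := ham_term_le p xi a b; rewrite ler_norml => /andP[].
Qed.

Let point (T : finType) (t0 t : T) : R := (t == t0)%:R.

Let val_point p xi x b : val p xi x (point b) = \sum_a x a * ham_term p xi a b.
Proof.
by rewrite /val hamiltonian_integrand; apply: eq_bigr => a _; rewrite sum_simplex_point.
Qed.

Let inner p xi x := sup [set val p xi x y | y in simplex B].

Let has_sup_inner p xi x : simplex A x -> has_sup [set val p xi x y | y in simplex B].
Proof.
move=> xS; split; first by exists (val p xi x (point b0)), (point b0) => //; exact: simplex_point.
exists (bnd p xi) => _ [y yS <-].
by have := val_norm p xi xS yS; rewrite ler_norml => /andP[].
Qed.

Let has_inf_outer p xi : has_inf [set inner p xi x | x in simplex A].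
Proof.
split; first by exists (inner p xi (point a0)), (point a0) => //; exact: simplex_point.
exists (- bnd p xi) => _ [x xS <-].
have yS := simplex_point (R := R) b0.
apply: (@le_trans _ _ (val p xi x (point b0))).
  by have := val_norm p xi xS yS; rewrite ler_norml => /andP[].
by apply: sup_upper_bound; [exact: has_sup_inner|exists (point b0)].
Qed.

Lemma hamiltonian_le p xi x c : simplex A x ->
  (forall b, \sum_a x a * ham_term p xi a b <= c) -> H p xi <= c.
Proof.
move=> xS xc; apply: (@le_trans _ _ (inner p xi x)).
  by apply: ge_inf; [case: (has_inf_outer p xi)|exists x].
apply: ge_sup; first by case: (has_sup_inner p xi xS).
move=> _ [y yS <-]; rewrite /val hamiltonian_integrand.
under eq_bigr do rewrite mulr_sumr.
rewrite exchange_big/=.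
under eq_bigr do under eq_bigr do rewrite mulrCA.
under eq_bigr do rewrite -mulr_sumr.
exact: simplex_sum_le.
Qed.

Lemma hamiltonian_lt p xi c : H p xi < c ->
  exists2 x, simplex A x & forall b, \sum_a x a * ham_term p xi a b < c.
Proof.
rewrite -subr_gt0 => e0.
have [_ [x xS <-]] := inf_adherent e0 (has_inf_outer p xi).
rewrite addrC subrK => xc; exists x => // b; apply: le_lt_trans xc.
rewrite -val_point; apply: sup_upper_bound; first exact: has_sup_inner.
by exists (point b) => //; exact: simplex_point.
Qed.

Lemma hamiltonian_le_add p xi p' xi' c :
  (forall a b, ham_term p xi a b <= ham_term p' xi' a b + c) ->
  H p xi <= H p' xi' + c.
Proof.
move=> tc; apply/ler_addgt0Pr => e e0.
have /hamiltonian_lt[x xS xH] : H p' xi' < H p' xi' + e by rewrite ltrDl.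
apply: (hamiltonian_le (x := x)) => // b.
apply: (@le_trans _ _ (\sum_a x a * (ham_term p' xi' a b + c))).
  by apply: ler_sum => a _; rewrite ler_wpM2l//; case: xS.
under eq_bigr do rewrite mulrDr.
by rewrite big_split/= -mulr_suml xS.2 mul1r addrAC lerD2r ltW.
Qed.

End Hamiltonian.

(** * Transition semigroup *)

Section MatrixExponential.
Context {R : realType} {N : nat}.
Implicit Types (X : 'M[R]_N).

Lemma cvg_mx_entries m n (u : nat -> 'M[R]_(m, n)) (M : 'M[R]_(m, n)) :
  (forall i j, (fun k => u k i j) @ \oo --> M i j) -> u @ \oo --> M.
Proof.
move=> uM A [E EM EA].
have : \forall k \near \oo, forall ij : 'I_m * 'I_n, E ij.1 ij.2 (u k ij.1 ij.2).
  by apply: filter_forall => -[i j]; exact: uM.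
by apply: filterS => k H; apply: EA => i j; exact: (H (i, j)).
Qed.

Lemma expr_row_sum X (x : R) k i : 0 <= x -> (forall i, \sum_j `|X i j| <= x) ->
  \sum_j `|(X ^+ k) i j| <= x ^+ k.
Proof.
move=> x0 Xx; elim: k i => [|k IH] i.
  rewrite !expr0 (bigD1 i)//= mxE eqxx normr1 big1 ?addr0// => j ji.
  by rewrite mxE eq_sym (negPf ji) normr0.
apply: (@le_trans _ _ (\sum_j \sum_k' `|X i k'| * `|(X ^+ k) k' j|)).
  apply: ler_sum => j _; rewrite exprS mxE; apply: (le_trans (ler_norm_sum _ _ _)).
  by apply: ler_sum => k' _; rewrite normrM.
rewrite exchange_big/= exprS.
apply: (@le_trans _ _ (\sum_k' `|X i k'| * x ^+ k)).
  by apply: ler_sum => k' _; rewrite -mulr_sumr ler_wpM2l.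
by rewrite -mulr_suml ler_wpM2r// exprn_ge0.
Qed.

Lemma expr_entry_le X (x : R) k i j : 0 <= x -> (forall i, \sum_j `|X i j| <= x) ->
  `|(X ^+ k) i j| <= x ^+ k.
Proof.
move=> x0 Xx; apply: le_trans (expr_row_sum k i x0 Xx).
by rewrite (bigD1 j)//= lerDl sumr_ge0.
Qed.

Lemma series_mxE (u : nat -> 'M[R]_N) n i j :
  series u n i j = series (fun k => u k i j) n.
Proof. by rewrite /series/= summxE. Qed.

Lemma exp_series_entry X (x : R) n i j : 0 <= x ->
  (forall i, \sum_j `|X i j| <= x) ->
  `|(n`!%:R^-1 *: X ^+ n) i j| <= exp_coeff x n.
Proof.
move=> x0 Xx; rewrite mxE normrM ger0_norm ?invr_ge0// /exp_coeff/= mulrC.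
by rewrite ler_wpM2r ?invr_ge0//; exact: expr_entry_le.
Qed.

Lemma expmx_cvg X i j :
  (fun n => series (fun k => k`!%:R^-1 *: X ^+ k) n i j) @ \oo --> expmx X i j.
Proof.
pose x := \sum_i \sum_j `|X i j|.
have x0 : 0 <= x by apply: sumr_ge0 => ? _; exact: sumr_ge0.
have Xx i' : \sum_j `|X i' j| <= x.
  by rewrite /x [leRHS](bigD1 i')//= lerDl; apply: sumr_ge0 => ? _; exact: sumr_ge0.
pose a i j k := (k`!%:R^-1 *: X ^+ k) i j.
have ca i' j' : cvgn (series (a i' j')).
  apply: normed_cvg; apply: (@series_le_cvg _ _ (exp_coeff x)) => [n|n|n|].
  - exact: normr_ge0.
  - exact: exp_coeff_ge0.
  - exact: exp_series_entry.
  - exact: is_cvg_series_exp_coeff.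
pose L : 'M[R]_N := \matrix_(i, j) limn (series (a i j)).
have cL i' j' : (fun n => series (fun k => k`!%:R^-1 *: X ^+ k) n i' j') @ \oo
    --> L i' j'.
  under eq_fun do rewrite series_mxE.
  by rewrite mxE; exact: ca.
have -> : expmx X = L.
  by apply: cvg_lim => //; exact: cvg_mx_entries.
exact: cL.
Qed.

Lemma expmx_row_sum X i : (forall i, \sum_j X i j = 0) -> \sum_j expmx X i j = 1.
Proof.
move=> X0.
have Xk k : \sum_j (X ^+ k.+1) i j = 0.
  elim: k => [|k _]; first by rewrite expr1.
  rewrite exprSr; under eq_bigr do rewrite mxE.
  rewrite exchange_big/= big1// => k' _.
  by rewrite -mulr_sumr X0 mulr0.
have S1 n : \sum_j series (fun k => k`!%:R^-1 *: X ^+ k) n.+1 i j = 1.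
  rewrite /series/=; under eq_bigr do rewrite summxE.
  rewrite exchange_big/= big_nat_recl//= [X in _ + X]big1 ?addr0.
    rewrite fact0 invr1 scale1r expr0 (bigD1 i)//= mxE eqxx big1 ?addr0// => j ji.
    by rewrite mxE eq_sym (negPf ji).
  move=> k _; under eq_bigr do rewrite mxE.
  by rewrite -mulr_sumr Xk mulr0.
have c : (fun n => \sum_j series (fun k => k`!%:R^-1 *: X ^+ k) n i j) @ \oo
    --> \sum_j expmx X i j.
  apply: cvg_big => [|j _]; last exact: expmx_cvg.
  by move=> ?; exact: add_continuous.
apply: (cvg_unique _ c) => //.
apply: cvg_near_cst; exists 1%N => // -[//|n] _ /=.
exact: S1.
Qed.

Lemma expmx_expansion X (x : R) i j : 0 <= x -> (forall i, \sum_j `|X i j| <= x) ->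
  `|expmx X i j - (1%:M + X) i j| <= x ^+ 2 * expR x.
Proof.
move=> x0 Xx.
have c : (fun n => `|series (fun k => k`!%:R^-1 *: X ^+ k) n i j - (1%:M + X) i j|)
    @ \oo --> `|expmx X i j - (1%:M + X) i j|.
  by apply: cvg_norm; apply: cvgB; [exact: expmx_cvg|exact: cvg_cst].
rewrite -(cvg_lim _ c)//; apply: limr_le; first exact: cvgP c.
exists 2%N => // -[|[//|n]] // _ /=.
rewrite /series/= summxE 2?big_nat_recl//= fact0 invr1 scale1r expr0.
rewrite scale1r expr1 addrA [(1%:M + X) i j]mxE.
rewrite [X in `|X|](_ : _ =
   \sum_(0 <= k < n) ((k.+2)`!%:R^-1 *: X ^+ k.+2) i j); last by ring.
apply: (le_trans (ler_norm_sum _ _ _)).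
apply: (@le_trans _ _ (\sum_(0 <= k < n) x ^+ 2 * exp_coeff x k)).
  apply: ler_sum => k _; apply: (le_trans (exp_series_entry _ _ _ x0 Xx)).
  rewrite /exp_coeff/= mulrA -exprD add2n ler_wpM2l ?exprn_ge0//.
  rewrite lef_pV2 ?posrE ?ltr0n ?fact_gt0// ler_nat 2!factS mulnA.
  by rewrite leq_pmull.
rewrite -mulr_sumr ler_wpM2l ?exprn_ge0//.
have := nondecreasing_cvgn_le _ (@is_cvg_series_exp_coeff R x) n; apply.
by apply/nondecreasing_series => k _ _; exact: exp_coeff_ge0.
Qed.

Lemma ffact_le_expn m k : (m ^_ k <= m ^ k)%N.
Proof.
elim: k => [|k IH]; first by rewrite ffactn0.
by rewrite ffactnSr expnSr leq_mul// leq_subr.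
Qed.

Lemma binomial_term_le m k : ('C(m, k)%:R / m%:R ^+ k : R) <= k`!%:R^-1.
Proof.
case: m => [|m].
  case: k => [|k]; first by rewrite bin0 expr0 fact0 invr1 mulr1.
  by rewrite bin0n mul0r invr_ge0.
rewrite ler_pdivrMr ?exprn_gt0// ler_pdivlMl ?ltr0n ?fact_gt0//.
by rewrite -natrX -natrM ler_nat mulnC bin_ffact ffact_le_expn.
Qed.

Lemma mx_exprZ X (a : R) n : (a *: X) ^+ n = a ^+ n *: X ^+ n.
Proof.
elim: n => [|n IH]; first by rewrite !expr0 scale1r.
by rewrite !exprS IH -!mulmxE -scalemxAl -scalemxAr scalerA.
Qed.

Lemma mx_expr_ge0 X n i j : (forall i j, 0 <= X i j) -> 0 <= (X ^+ n) i j.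
Proof.
move=> X0; elim: n i => [|n IH] i; first by rewrite expr0 mxE; case: eqP.
by rewrite exprS mxE sumr_ge0// => k _; rewrite mulr_ge0.
Qed.

Lemma expr1D_binomial X m i j : ((1 + m%:R^-1 *: X) ^+ m) i j =
  \sum_(0 <= k < m.+1) ('C(m, k)%:R / m%:R ^+ k) * (X ^+ k) i j.
Proof.
rewrite exprDn_comm; last exact/commr_sym/commr1.
rewrite summxE big_mkord; apply: eq_bigr => k _.
rewrite expr1n mul1r mx_exprZ -scaler_nat !mxE exprVn.
by rewrite mulrA.
Qed.

Lemma euler_expR_ge (x : R) m : 0 <= x -> (0 < m)%N ->
  expR x - (1 + x / m%:R) ^+ m <= expR x * x ^+ 2 / m%:R.
Proof.
move=> x0 m0; have mR : (0 : R) < m%:R by rewrite ltr0n.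
pose y := x / m%:R.
have y0 : 0 <= y by rewrite divr_ge0// ltW.
have y1 : 0 < 1 + y by rewrite ltr_pwDl.
have step : expR (y / (1 + y)) <= 1 + y.
  rewrite -[leRHS]invrK -[y / _]opprK expRN lef_pV2 ?posrE ?invr_gt0 ?expR_gt0//.
  rewrite [leLHS](_ : _ = 1 + - (y / (1 + y))); last by field; rewrite gt_eqF.
  exact: expR_ge1Dx.
have pow : expR (x - x * y) <= (1 + y) ^+ m.
  apply: (@le_trans _ _ (expR (y / (1 + y)) ^+ m)); last first.
    by rewrite ler_pXn2r ?nnegrE ?expR_ge0// ltW.
  rewrite -expRM_natl ler_expR.
  have -> : x = m%:R * y by rewrite /y mulrC divfK ?gt_eqF.
  rewrite -mulrA -mulrBr ler_pM2l// ler_pdivlMr//.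
  have y3 : 0 <= y ^+ 3 by rewrite exprn_ge0.
  rewrite [leLHS](_ : _ = y - y ^+ 3); last by ring.
  by rewrite lerBlDr lerDl.
apply: (@le_trans _ _ (expR x - expR (x - x * y))); first by rewrite lerD2l lerN2.
rewrite expRD -[X in X - _]mulr1 -mulrBr -[leRHS]mulrA ler_pM2l ?expR_gt0//.
by have := expR_ge1Dx (- (x * y)); rewrite /y; lra.
Qed.

(* The partial sums of the exponential series and the Euler products
   (1 + X/m)^m have coefficients whose differences are nonnegative, hence are entrywise as
   close as for the scalar bound x on X. *)
Lemma euler_mx_close X (x : R) m i j : 0 <= x -> (forall i, \sum_j `|X i j| <= x) ->
  (0 < m)%N ->
  `|series (fun k => k`!%:R^-1 *: X ^+ k) m.+1 i j - ((1 + m%:R^-1 *: X) ^+ m) i j|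
  <= expR x * x ^+ 2 / m%:R.
Proof.
move=> x0 Xx m0; rewrite expr1D_binomial /series/= summxE -sumrB.
apply: (le_trans (ler_norm_sum _ _ _)).
apply: le_trans (euler_expR_ge x0 m0).
have -> : (1 + x / m%:R) ^+ m =
    \sum_(0 <= k < m.+1) ('C(m, k)%:R / m%:R ^+ k) * x ^+ k.
  rewrite exprDn big_mkord; apply: eq_bigr => k _.
  by rewrite expr1n mul1r -mulr_natl expr_div_n; ring.
have : \sum_(0 <= k < m.+1) exp_coeff x k <= expR x.
  have := nondecreasing_cvgn_le _ (@is_cvg_series_exp_coeff R x) m.+1; apply.
  by apply/nondecreasing_series => k _ _; exact: exp_coeff_ge0.
rewrite -(lerD2r (- \sum_(0 <= k < m.+1) ('C(m, k)%:R / m%:R ^+ k) * x ^+ k)).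
apply: le_trans; rewrite -sumrB; apply: ler_sum => k _.
rewrite mxE -mulrBl normrM ger0_norm ?subr_ge0 ?binomial_term_le//.
rewrite /exp_coeff/= [x ^+ k / _]mulrC -mulrBl ler_wpM2l ?subr_ge0 ?binomial_term_le//.
exact: expr_entry_le.
Qed.

Lemma expmx_ge0 X i j : (forall i j, j != i -> 0 <= X i j) -> 0 <= expmx X i j.
Proof.
move=> Xoff.
pose x := \sum_i \sum_j `|X i j|.
have x0 : 0 <= x by apply: sumr_ge0 => ? _; exact: sumr_ge0.
have Xx i' : \sum_j `|X i' j| <= x.
  by rewrite /x [leRHS](bigD1 i')//= lerDl; apply: sumr_ge0 => ? _; exact: sumr_ge0.
have pos m : x < m%:R -> forall i j, 0 <= ((1 + m%:R^-1 *: X) ^+ m) i j.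
  move=> xm; have m0 : (0 : R) < m%:R by exact: le_lt_trans xm.
  have Y0 i' j' : 0 <= (1 + m%:R^-1 *: X) i' j'.
    rewrite !mxE; have [<-|ij] := eqVneq i' j'; last first.
      by rewrite add0r mulr_ge0 ?invr_ge0 ?(ltW m0)// Xoff// eq_sym.
    have : `|X i' i'| <= x.
      by apply: le_trans (Xx i'); rewrite (bigD1 i')//= lerDl sumr_ge0.
    rewrite ler_norml => /andP[+ _] => xX.
    rewrite [leRHS](_ : _ = m%:R^-1 * (m%:R + X i' i')); last first.
      by rewrite mulrDr mulVf ?gt_eqF.
    by rewrite mulr_ge0 ?invr_ge0 ?(ltW m0)//; move: xX xm; lra.
  by move=> i' j'; exact: mx_expr_ge0.
rewrite leNgt; apply/negP => E0.
have e0 : 0 < - expmx X i j / 2 by rewrite divr_gt0// oppr_gt0.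
have /cvgrPdist_lt/(_ _ e0)[n0 _ n0P] := @expmx_cvg X i j.
pose c := expR x * x ^+ 2 / (- expmx X i j / 2).
have c0 : 0 <= c by rewrite divr_ge0 ?(ltW e0)// mulr_ge0 ?expR_ge0// sqr_ge0.
pose m := maxn n0 (maxn (Num.truncn x).+1 (Num.truncn c).+1).
have xm : x < m%:R.
  apply: (lt_le_trans (truncnS_gt _)); rewrite ler_nat /m.
  by rewrite (leq_trans (leq_maxl _ _) (leq_maxr _ _)).
have cm : c < m%:R.
  apply: (lt_le_trans (truncnS_gt _)); rewrite ler_nat /m.
  by rewrite (leq_trans (leq_maxr _ _) (leq_maxr _ _)).
have m0 : (0 : R) < m%:R by exact: le_lt_trans c0 cm.
have m0' : (0 < m)%N by rewrite -(ltr0n R).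
have H1 := n0P m.+1 (leq_trans (leq_maxl _ _) (leqnSn _)).
have H2 := euler_mx_close i j x0 Xx m0'.
have H3 := pos m xm i j.
have H4 : expR x * x ^+ 2 / m%:R < - expmx X i j / 2.
  by rewrite ltr_pdivrMr// [ltRHS]mulrC -ltr_pdivrMr.
move: H1 H2 H3 H4 => /=; rewrite ltr_norml ler_norml => /andP[+ _] /andP[+ _].
by lra.
Qed.

End MatrixExponential.

Section Rates.
Context {R : realType} {N : nat} {A B : finType}.
Variables (r : R) (Q : A -> B -> 'M[R]_N).
Hypothesis r_gt0 : 0 < r.
Hypothesis rateQ : is_rate Q.

Lemma transition_ge0 n a b s s' : 0 <= transition Q n a b s s'.
Proof.
apply: expmx_ge0 => i j ji; rewrite mxE mulr_ge0 ?invr_ge0//.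
by case: rateQ => + _; exact.
Qed.

Lemma transition_sum1 n a b s : \sum_s' transition Q n a b s s' = 1.
Proof.
apply: expmx_row_sum => i; under eq_bigr do rewrite mxE.
by rewrite -mulr_sumr rateQ.2 mulr0.
Qed.

Lemma transition_expansion : exists2 C : R, 0 <= C &
  forall n a b s s', (0 < n)%N ->
  `|transition Q n a b s s' - (1%:M + n%:R^-1 *: Q a b) s s'| <= C * n%:R^-1 ^+ 2.
Proof.
pose k := \sum_a \sum_b \sum_i \sum_j `|Q a b i j|.
have k0 : 0 <= k by do 4 (apply: sumr_ge0 => ? _).
have Qk a b i : \sum_j `|Q a b i j| <= k.
  apply: (@le_trans _ _ (\sum_i \sum_j `|Q a b i j|)).
    rewrite [leRHS](bigD1 i)//= lerDl; by do 2 (apply: sumr_ge0 => ? _).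
  apply: (@le_trans _ _ (\sum_b \sum_i \sum_j `|Q a b i j|)).
    rewrite [leRHS](bigD1 b)//= lerDl; by do 3 (apply: sumr_ge0 => ? _).
  rewrite /k [leRHS](bigD1 a)//= lerDl; by do 4 (apply: sumr_ge0 => ? _).
exists (k ^+ 2 * expR k); first by rewrite mulr_ge0 ?expR_ge0// sqr_ge0.
move=> n a b s s' n0.
have h0 : 0 <= (n%:R^-1 : R) by rewrite invr_ge0.
have h1 : (n%:R^-1 : R) <= 1 by rewrite invf_le1 ?ltr0n// ler1n.
apply: (@le_trans _ _ ((n%:R^-1 * k) ^+ 2 * expR (n%:R^-1 * k))).
  apply: expmx_expansion => [|i]; first exact: mulr_ge0.
  under eq_bigr do rewrite mxE normrM ger0_norm//.
  by rewrite -mulr_sumr ler_wpM2l.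
move: h0 h1; set h := n%:R^-1 => h0 h1.
rewrite [leRHS](_ : _ = (h * k) ^+ 2 * expR k); last by ring.
by rewrite ler_wpM2l ?sqr_ge0// ler_expR -[leRHS]mul1r ler_wpM2r.
Qed.

Lemma discount_bounds n : (0 < n)%N ->
  [/\ 0 < discount r n < 1, discount r n <= r / n%:R &
      r / n%:R - (r / n%:R) ^+ 2 <= discount r n].
Proof.
move=> n0; rewrite /discount; set z := r / n%:R.
have z0 : 0 < z by rewrite divr_gt0// ltr0n.
have e1 := expR_ge1Dx (- z).
have e2 : expR (- z) * (1 + z) <= 1.
  by rewrite expRN -[leRHS](mulVf (lt0r_neq0 (expR_gt0 z))) ler_wpM2l ?invr_ge0 ?expR_ge0// expR_ge1Dx.
have e3 : expR (- z) < 1 by rewrite expR_lt1 oppr_lt0.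
have e4 := expR_gt0 (- z).
split; [by lra|by lra|].
suff : expR (- z) <= 1 - z + z ^+ 2 by lra.
have : expR (- z) * (1 + z) <= (1 - z + z ^+ 2) * (1 + z).
  apply: (le_trans e2); rewrite [leRHS](_ : _ = 1 + z ^+ 3); last by ring.
  by rewrite lerDl exprn_ge0// ltW.
by rewrite ler_pM2r// ltr_pwDl// ltW.
Qed.

End Rates.

(** * Test functions *)

Section QuadraticTests.
Context {R : realType} {N : nat}.
Implicit Types (p q z l v : 'rV[R]_N) (M X : 'M[R]_N).

Definition quad (p0 : 'rV[R]_N) (c : R) l M : 'rV[R]_N -> R :=
  fun q => c + dot (q - p0) l + dot ((q - p0) *m M) (q - p0).

Lemma quad_shift p0 c l M p v :
  quad p0 c l M (p + v) = quad p0 c l M p +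
    dot v (l + (p - p0) *m (M + M^T)) + dot (v *m M) v.
Proof.
rewrite /quad (_ : p + v - p0 = p - p0 + v); last by rewrite addrAC.
move: (p - p0) => z.
rewrite dotDl dotDr mulmxDr !mulmxDl dotDr !dotDl dotDr.
by rewrite (dot_trmx M v z) (dotC _ v) (dotC _ v); ring.
Qed.

Lemma differentiable_quad p0 c l M p : differentiable (quad p0 c l M) p.
Proof.
have dcoord i : differentiable (fun q : 'rV[R]_N => (q - p0) ord0 i) p.
  under eq_fun do rewrite mxE.
  by apply: differentiableD; [exact: differentiable_coord|exact: differentiable_cst].
pose f i : 'rV[R]_N -> R := fun q => (q - p0) ord0 i * l ord0 i +
  (\sum_j (fun q => (q - p0) ord0 j * M j i)) q * (q - p0) ord0 i.
have -> : quad p0 c l M = cst c + \sum_i f i.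
  apply/funext => q; rewrite /quad fctE /f fct_sumE -addrA; congr (_ + _).
  rewrite big_split/=; congr (_ + _); apply: eq_bigr => i _.
  by rewrite mxE fct_sumE.
apply: differentiableD; first exact: differentiable_cst.
apply: differentiable_sum => i.
apply: differentiableD.
  by apply: differentiableM; [exact: dcoord|exact: differentiable_cst].
apply: differentiableM => //; apply: differentiable_sum => j.
by apply: differentiableM; [exact: dcoord|exact: differentiable_cst].
Qed.

Lemma derive_quad p0 c l M p v :
  'D_v (quad p0 c l M) p = dot v (l + (p - p0) *m (M + M^T)).
Proof.
set b := dot v _.
apply: cvg_lim => //.
have : (fun h : R => b + h * dot (v *m M) v) @ 0^' --> b.
  rewrite -[X in _ --> X]addr0; apply: cvgD; first exact: cvg_cst.
  rewrite -[X in _ --> X](mul0r (dot (v *m M) v)); apply: cvgMl.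
  exact: cvg_within.
apply: cvg_trans; apply: near_eq_cvg.
near=> h; have h0 : h != 0 by near: h; exact: nbhs_dnbhs_neq.
rewrite [RHS](_ : _ = h^-1 * (quad p0 c l M (p + h *: v) - quad p0 c l M p)).
  by rewrite quad_shift -scalemxAl !dotZl dotZr -/b; field.
by rewrite /= (addrC _ p).
Unshelve. all: by end_near. Qed.

Lemma partial_quad i p0 c l M : partial i (quad p0 c l M) =
  quad p0 (l ord0 i) (\row_j (M + M^T) j i) 0.
Proof.
apply/funext => p; rewrite /partial derive_quad dotC dot_delta mxE /quad.
rewrite mulmx0 dot0l addr0; congr (_ + _); rewrite mxE; apply: eq_bigr => j _.
by rewrite [(\row__ _) _ _]mxE.
Qed.

Lemma smooth_quad p0 c l M : smooth (quad p0 c l M).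
Proof.
move=> s p; suff [c' [l' [M' ->]]] : exists c' l' M',
    foldr partial (quad p0 c l M) s = quad p0 c' l' M'.
  exact: differentiable_quad.
elim: s => [|i s [c' [l' [M' IH]]]] /=; first by exists c, l, M.
by rewrite IH partial_quad; do 3 eexists.
Qed.

Lemma grad_quad p0 c l M p : grad (quad p0 c l M) p = l + (p - p0) *m (M + M^T).
Proof.
by apply/rowP => i; rewrite mxE /partial derive_quad dotC dot_delta.
Qed.

Lemma hess_quad p0 c l M p : hess (quad p0 c l M) p = M + M^T.
Proof.
apply/matrixP => i j; rewrite mxE partial_quad /partial derive_quad.
by rewrite dotC dot_delta trmx0 addr0 mulmx0 addr0 mxE.
Qed.

Lemma quad_hess_form M z : dot (z *m (M + M^T)) z = 2 * dot (z *m M) z.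
Proof. by rewrite mulmxDr dotDl -dot_trmx; ring. Qed.

End QuadraticTests.

Section Taylor.
Context {R : realType} {N : nat}.
Implicit Types (p q z : 'rV[R]_N) (phi f : 'rV[R]_N -> R).

Lemma derive_grad f p z : differentiable f p -> 'D_z f p = dot z (grad f p).
Proof.
move=> df; rewrite deriveE// {1}(row_sum_delta z) linear_sum.
by apply: eq_bigr => i _; rewrite linearZ mxE /partial deriveE.
Qed.

Lemma differentiable_near f p : differentiable f p -> forall k : R, 0 < k ->
  \forall z \near (0 : 'rV[R]_N),
    `|f (p + z) - f p - dot z (grad f p)| <= k * `|z|.
Proof.
move=> df k k0; have /diff_locallyP[_ /eqaddoP/(_ _ k0)] := df.
apply: filterS => z; rewrite !fctE /= (addrC z) -derive_grad// deriveE//.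
by rewrite opprD addrA.
Qed.

Lemma is_derive_line phi p z (t : R) : differentiable phi (p + t *: z) ->
  is_derive t 1 (fun t => phi (p + t *: z)) ('D_z phi (p + t *: z)).
Proof.
move=> df; have dz : derivable phi (p + t *: z) z by exact: diff_derivable.
have E : (fun h : R => h^-1 *: (((fun t => phi (p + t *: z)) \o shift t) (h *: 1)
      - phi (p + t *: z))) =
    (fun h : R => h^-1 *: ((phi \o shift (p + t *: z)) (h *: z) - phi (p + t *: z))).
  apply/funext => h /=; congr (_ *: (phi _ - _)).
  by rewrite -[h *: 1]/(h * 1) mulr1 scalerDl addrCA.
by split; rewrite /derivable /derive E.
Qed.

Lemma smooth_taylor2 phi p : smooth phi -> forall k : R, 0 < k ->
  exists2 d : R, 0 < d & forall z, `|z| < d ->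
  `|phi (p + z) - phi p - dot z (grad phi p) - 2^-1 * dot (z *m hess phi p) z|
    <= k * dot z z.
Proof.
move=> sphi k k0.
pose k' := k / (N%:R + 1).
have N0 : (0 : R) < N%:R + 1 by rewrite ltr_wpDl.
have k'0 : 0 < k' by rewrite divr_gt0.
have : \forall z \near (0 : 'rV[R]_N), forall j,
    `|partial j phi (p + z) - partial j phi p - dot z (grad (partial j phi) p)|
      <= k' * `|z|.
  apply: (@filter_forall _ _ _ (nbhs (0 : 'rV[R]_N))) => j.
  by apply: differentiable_near => //; exact: (sphi [:: j]).
move=> /nbhs_ballP[d /= d0 dP]; exists d => // z zd.
have dphi q : differentiable phi q by exact: (sphi [::]).
pose G t := phi (p + t *: z) - t * dot z (grad phi p) -
  t ^+ 2 * (2^-1 * dot (z *m hess phi p) z).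
pose G' t := 'D_z phi (p + t *: z) - dot z (grad phi p) -
  2 * t * (2^-1 * dot (z *m hess phi p) z).
have dG (t : R) : is_derive t 1 G (G' t).
  have d1 := is_derive_line (dphi (p + t *: z)).
  apply: is_deriveB; last first.
    by apply: is_derive_eq; rewrite -![_ *: _]/(_ * _); ring.
  apply: is_deriveB; last by apply: is_derive_eq; rewrite -![_ *: _]/(_ * _); ring.
have cG : {within `[0, 1], continuous G}.
  by apply: derivable_within_continuous => t _; case: (dG t).
have [c c01 Gc] := MVT ltr01 (fun t _ => dG t) cG.
move: c01; rewrite in_itv/= => /andP[c0 c1].
have -> : phi (p + z) - phi p - dot z (grad phi p) -
    2^-1 * dot (z *m hess phi p) z = G' c.
  move: Gc; rewrite subr0 mulr1 => <-; rewrite /G scale1r scale0r addr0.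
  by ring.
rewrite /G' derive_grad// -dotBr.
have -> : 2 * c * (2^-1 * dot (z *m hess phi p) z) = dot z ((c *: z) *m hess phi p).
  by rewrite -scalemxAl dotZr (dotC z); field.
rewrite -dotBr.
apply: (@le_trans _ _ (\sum_j `|z| * (k' * `|z|))).
  apply: (le_trans (ler_norm_sum _ _ _)); apply: ler_sum => j _.
  rewrite normrM ler_pM//; first exact: entry_le_norm.
  have cz : `|c *: z| <= `|z|.
    by rewrite normrZ gtr0_norm// -[leRHS]mul1r ler_wpM2r// ltW.
  apply: (@le_trans _ _ (k' * `|c *: z|)); last by rewrite ler_pM2l.
  have := dP (c *: z) _ j; rewrite -ball_normE/= sub0r normrN.
  move=> /(_ (le_lt_trans cz zd)); congr (`| _ | <= _).
  rewrite !mxE; congr (_ - _); rewrite dotC /dot; apply: eq_bigr => i _.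
  by rewrite !mxE mulrC.
rewrite sumr_const card_ord -mulr_natl.
apply: (@le_trans _ _ (k * `|z| ^+ 2)); last first.
  by rewrite ler_pM2l// norm_sqr_le_dot.
have -> : k = k' * (N%:R + 1) by rewrite divfK// gt_eqF.
have : 0 <= k' * `|z| ^+ 2 by rewrite mulr_ge0 ?sqr_ge0// ltW.
by rewrite expr2; lra.
Qed.

End Taylor.

Section ViscosityTests.
Context {R : realType} {N : nat}.
Variables (r : R) (H : 'rV[R]_N -> 'rV[R]_N -> R).
Implicit Types (p q z l : 'rV[R]_N) (M : 'M[R]_N) (w : 'rV[R]_N -> R).
Local Notation D := (state_simplex (R := R) N).

Lemma local_max_onP (f : 'rV[R]_N -> R) p : local_max_on D f p <->
  D p /\ exists2 d : R, 0 < d & forall q, D q -> `|q - p| < d -> f q <= f p.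
Proof.
split=> [[Dp]|[Dp [d d0 fd]]].
  rewrite near_withinE => /nbhs_ballP[d /= d0 fd]; split=> //; exists d => // q Dq qp.
  by apply: fd => //; rewrite -ball_normE/= distrC.
split=> //; rewrite near_withinE; apply/nbhs_ballP; exists d => //= q.
by rewrite -ball_normE/= distrC => qp Dq; exact: fd.
Qed.

Lemma local_min_onP (f : 'rV[R]_N -> R) p : local_min_on D f p <->
  D p /\ exists2 d : R, 0 < d & forall q, D q -> `|q - p| < d -> f p <= f q.
Proof.
split=> [[Dp]|[Dp [d d0 fd]]].
  rewrite near_withinE => /nbhs_ballP[d /= d0 fd]; split=> //; exists d => // q Dq qp.
  by apply: fd => //; rewrite -ball_normE/= distrC.
split=> //; rewrite near_withinE; apply/nbhs_ballP; exists d => //= q.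
by rewrite -ball_normE/= distrC => qp Dq; exact: fd.
Qed.

Lemma lambda_max_le p X (k : R) :
  (forall z, tangent p z -> z != 0 -> dot (z *m X) z <= k * dot z z) ->
  (lambda_max p X <= k%:E)%E.
Proof.
move=> Xk; apply: ge_ereal_sup => _ [z [zT /eqP z0] <-].
by rewrite lee_fin ler_pdivrMr ?dot_gt0//; exact: Xk.
Qed.

Lemma lambda_max_ge p X z : tangent p z -> z != 0 ->
  ((dot (z *m X) z / dot z z)%:E <= lambda_max p X)%E.
Proof.
by move=> zT z0; apply: ereal_sup_ubound; exists z => //; split=> //; exact/eqP.
Qed.

Lemma subsolution_quad w p p0 c l M (k : R) : viscosity_subsolution r H w ->
  0 < k -> (forall z, dot (z *m M) z <= - k * dot z z) ->
  local_max_on D (fun q => w q - quad p0 c l M q) p ->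
  r * w p + H p (l + (p - p0) *m (M + M^T)) <= 0.
Proof.
move=> [_ wsub] k0 Mk wmax.
have := wsub _ _ (smooth_quad p0 c l M) wmax.
rewrite /hj_operator grad_quad hess_quad ge_min lee_fin => /orP[//|].
rewrite leNgt => /negP[].
apply: (@lt_le_trans _ _ (2 * k)%:E); first by rewrite lte_fin mulr_gt0.
rewrite leeNr -EFinN; apply: lambda_max_le => z _ _.
by rewrite quad_hess_form; have := Mk z; lra.
Qed.

Lemma supersolution_quad w p p0 c l M : viscosity_supersolution r H w ->
  local_min_on D (fun q => w q - quad p0 c l M q) p ->
  0 <= r * w p + H p (l + (p - p0) *m (M + M^T)) /\
  forall z, tangent p z -> z != 0 -> dot (z *m M) z <= 0.
Proof.
move=> [_ wsup] wmin.
have := wsup _ _ (smooth_quad p0 c l M) wmin.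
rewrite /hj_operator grad_quad hess_quad le_min lee_fin => /andP[-> H2].
split=> // z zT z0; have := lambda_max_ge (M + M^T) zT z0.
move=> /le_trans/(_ _); rewrite oppe_ge0 in H2 => /(_ _ H2).
by rewrite lee_fin quad_hess_form pmulr_lle0 ?invr_gt0 ?dot_gt0// pmulr_rle0.
Qed.

End ViscosityTests.

Section SimplexGeometry.
Context {R : realType} {N : nat}.
Implicit Types (p q z a b : 'rV[R]_N).
Local Notation D := (state_simplex (R := R) N).

Definition concave_on_simplex (v : 'rV[R]_N -> R) :=
  forall a b (t : R), D a -> D b -> 0 <= t <= 1 ->
    (1 - t) * v a + t * v b <= v ((1 - t) *: a + t *: b).

Lemma sum_entryB p q : D p -> D q -> \sum_i (p - q) ord0 i = 0.
Proof.
move=> [_ p1] [_ q1]; under eq_bigr do rewrite !mxE.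
by rewrite sumrB p1 q1 subrr.
Qed.

Lemma state_simplex_add p z (m : R) : D p -> (forall i, m <= p ord0 i) ->
  (forall i, `|z ord0 i| <= m) -> \sum_i z ord0 i = 0 -> D (p + z).
Proof.
move=> [p0 p1] pm zm z0; split=> [i|].
  rewrite mxE; have := zm i; rewrite ler_norml => /andP[+ _].
  by have := pm i; lra.
by under eq_bigr do rewrite mxE; rewrite big_split/= p1 z0 addr0.
Qed.

Lemma scaled_entry_le (t m : R) z i : `|t| <= m -> `|z ord0 i| <= 1 ->
  `|(t *: z) ord0 i| <= m.
Proof.
by move=> tm z1; rewrite mxE normrM -[m]mulr1 ler_pM.
Qed.

Definition center : 'rV[R]_N := const_mx N%:R^-1.

Lemma state_simplex_center : (0 < N)%N -> D center.
Proof.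
move=> N0; split=> [i|]; first by rewrite mxE invr_ge0.
under eq_bigr do rewrite mxE.
by rewrite sumr_const card_ord -[_ *+ _]mulr_natl divff// pnatr_eq0 -lt0n.
Qed.

Lemma within_bounded (v : 'rV[R]_N -> R) : {within D, continuous v} ->
  exists2 B : R, 0 <= B & forall p, D p -> `|v p| <= B.
Proof.
move=> cv.
have [[p0 Dp0]|D0] := pselect (exists p, D p); last first.
  by exists 0 => // p Dp; exfalso; apply: D0; exists p.
have Dn : D !=set0 by exists p0.
have [m _ mP] := compact_EVT_min Dn (@compact_state_simplex R N) cv.
have [M _ MP] := compact_EVT_max Dn (@compact_state_simplex R N) cv.
exists (`|v m| + `|v M|) => [|p Dp]; first exact: addr_ge0.
have := mP p (mem_set Dp); have := MP p (mem_set Dp).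
have := ler_norm (v M); have := ler_norm (- v m); rewrite normrN.
have := normr_ge0 (v M); have := normr_ge0 (v m).
by rewrite ler_norml; lra.
Qed.

Lemma within_quad p0 c l M (K : set 'rV[R]_N) :
  {within K, continuous (quad p0 c l M)}.
Proof.
apply: continuous_subspaceT => p.
exact/differentiable_continuous/differentiable_quad.
Qed.

Lemma quad_scalar p0 c l (K : R) q :
  quad p0 c l (K%:M) q = c + dot (q - p0) l + K * dot (q - p0) (q - p0).
Proof. by rewrite /quad mul_mx_scalar dotZl. Qed.

(* Moving slightly backwards from an interior point q turns the one-sided
   estimate given by the test function into a global one. *)
Lemma concave_supergradient v q p0 c l M (m : R) : concave_on_simplex v ->
  D q -> 0 < m -> (forall i, m <= q ord0 i) ->
  (forall q', D q' -> v q - quad p0 c l M q <= v q' - quad p0 c l M q') ->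
  forall q', D q' -> v q' <= v q + dot (q' - q) (l + (q - p0) *m (M + M^T)).
Proof.
move=> vconc Dq m0 qm vmin q' Dq'; set xi := l + _; set z := q' - q.
pose k := `|dot (z *m M) z| + 1.
have k0 : 0 < k by rewrite ltr_wpDl.
apply/ler_addgt0Pr => e e0.
pose t := Num.min m (e / k).
have t0 : 0 < t by rewrite lt_min m0 divr_gt0.
have tm : t <= m by rewrite ge_min lexx.
have tk : t * k <= e by rewrite -ler_pdivlMr// ge_min lexx orbT.
have Dt : D (q + (- t) *: z).
  apply: state_simplex_add qm _ _ => // [i|].
    apply: scaled_entry_le; first by rewrite normrN gtr0_norm.
    by apply: le_trans (entry_le_norm _ _ _) (state_simplex_normB Dq' Dq).
  under eq_bigr do rewrite mxE.
  by rewrite -mulr_sumr sum_entryB// mulr0.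
have H1 := vmin _ Dt; rewrite quad_shift dotZl -/xi -scalemxAl dotZl dotZr in H1.
have t10 : 0 < 1 + t by rewrite ltr_pwDl// ltW.
pose th := t / (1 + t).
have th01 : 0 <= th <= 1.
  rewrite /th divr_ge0 ?(ltW t0) ?(ltW t10)//= ler_pdivrMr// mul1r lerDr//.
have H2 := vconc _ _ _ Dt Dq' th01.
have E : (1 - th) *: (q + - t *: z) + th *: q' = q.
  by apply/rowP => i; rewrite /z /th !mxE; field; rewrite gt_eqF.
rewrite E in H2.
have H3 : v (q + - t *: z) + t * v q' <= (1 + t) * v q.
  have -> : v (q + - t *: z) + t * v q' =
      (1 + t) * ((1 - th) * v (q + - t *: z) + th * v q').
    by rewrite /th; field; rewrite gt_eqF.
  by rewrite ler_pM2l.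
have H4 : dot (z *m M) z <= k - 1 by rewrite addrK ler_norm.
have H4' : - dot (z *m M) z <= k - 1 by rewrite addrK -normrN ler_norm.
rewrite -(ler_pM2l t0).
move: H1 H3 H4 H4' tk.
move: (v (q + _)) (v q) (v q') (quad _ _ _ _ _) (dot z xi) (dot _ z) => a1 a2 a3 a4 a5 a6.
clearbody k t; clear -t0 k0 => H1 H3 H4 H4' tk.
have : t * (- (t * a6)) <= t * e.
  by rewrite ler_pM2l//; nra.
by nra.
Qed.

End SimplexGeometry.
Arguments center {R N}.

Section SupersolutionConcave.
Context {R : realType} {N : nat}.
Variables (r : R) (H : 'rV[R]_N -> 'rV[R]_N -> R) (v : 'rV[R]_N -> R).
Local Notation D := (state_simplex (R := R) N).
Hypothesis vsup : viscosity_supersolution r H v.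
Hypothesis vcont : {within D, continuous v}.
Implicit Types (a b q : 'rV[R]_N).

Lemma tensor_form (e z : 'rV[R]_N) (x y : R) :
  dot (z *m (x *: (e^T *m e) - y%:M)) z = x * dot z e ^+ 2 - y * dot z z.
Proof.
rewrite mulmxBr dotBl mul_mx_scalar dotZl -scalemxAr dotZl; congr (_ * _ - _).
rewrite mulmxA [z *m e^T]mx11_scalar mul_scalar_mx dotZl -dotE dotC expr2.
by rewrite (dotC e).
Qed.

Lemma supersolution_concave_interior a b (m t : R) : D a -> D b -> 0 < m ->
  (forall i, m <= a ord0 i) -> (forall i, m <= b ord0 i) -> 0 <= t <= 1 ->
  (1 - t) * v a + t * v b <= v ((1 - t) *: a + t *: b).
Proof.
move=> Da Db m0 am bm t01; rewrite leNgt; apply/negP => vlt.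
pose e := b - a; pose E := dot e e.
have [e0|e0] := eqVneq e 0.
  have ba : b = a by apply/eqP; rewrite -subr_eq0 -/e e0.
  move: vlt; rewrite ba -scalerDl -mulrDl subrK scale1r mul1r ltxx//.
have E0 : 0 < E by exact: dot_gt0.
pose h := (1 - t) * v a + t * v b - v ((1 - t) *: a + t *: b).
have h0 : 0 < h by rewrite subr_gt0.
have [B B0 vB] := within_bounded vcont.
have h2 : 0 < h / 2 by rewrite divr_gt0.
have [d d0 dP] := compact_uniform_modulus (@compact_state_simplex R N) vcont h2.
pose d' := Num.min d (m / 2).
have d'0 : 0 < d' by rewrite lt_min d0 divr_gt0.
pose K := (2 * B + 1) / d' ^+ 2.
have K0 : 0 < K by rewrite divr_gt0 ?exprn_gt0// ltr_wpDl// mulr_ge0.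
pose s q := dot (q - a) e / E.
pose psi := quad a (v a) ((v b - v a - h) / E *: e)
  ((h + K * E) / E ^+ 2 *: (e^T *m e) - K%:M).
have psiE q : psi q = v a + s q * (v b - v a) + h * (s q ^+ 2 - s q) -
    K * dot (q - a - s q *: e) (q - a - s q *: e).
  rewrite /psi /quad /s; move: (q - a) => z0; clearbody e.
  rewrite tensor_form dotZr !dotBl !dotBr !dotZl !dotZr (dotC e) -/E.
  by field; rewrite gt_eqF.
pose S := D `&` s @^-1` `[0, 1].
have cs : continuous s.
  move=> q; have -> : s = quad a 0 (E^-1 *: e) 0.
    by apply/funext => q'; rewrite /quad mulmx0 dot0l addr0 add0r dotZr mulrC.
  exact/differentiable_continuous/differentiable_quad.
have cS : compact S.
  apply: (subclosed_compact _ (@compact_state_simplex R N)) => [|q []//].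
  apply: closedI.
    apply: compact_closed; first exact: norm_hausdorff.
    exact: compact_state_simplex.
  by apply: closed_comp => [q _|]; [exact: cs|exact: interval_closed].
have sc x : s (a + x *: e) = x.
  by rewrite /s addrAC subrr add0r dotZl mulfK// gt_eqF.
have ctE : (1 - t) *: a + t *: b = a + t *: e.
  by apply/rowP => i; rewrite !mxE; ring.
have Sct : S ((1 - t) *: a + t *: b).
  by split; [exact: state_simplex_convex|rewrite ctE /preimage/= sc in_itv].
have [q qS qmin] : exists2 q, q \in S & forall q', q' \in S ->
    v q - psi q <= v q' - psi q'.
  apply: compact_EVT_min => //; first by eexists; exact: Sct.
  move=> q; apply: cvgB; last exact: within_quad.
  by apply: (continuous_subspaceW _ vcont) => ? [].
have {qS}[Dq] := set_mem qS; rewrite /preimage/= in_itv/= => /andP[s0 s1].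
have qlt : v q - psi q <= - (h / 2).
  apply: (le_trans (qmin _ (mem_set Sct))); rewrite psiE ctE sc.
  rewrite (_ : a + t *: e - a - t *: e = 0); last by apply/rowP => i; rewrite !mxE; ring.
  rewrite dot0l mulr0 subr0 -ctE.
  rewrite [leLHS](_ : _ = - h - h * (t ^+ 2 - t)); last by rewrite /h; ring.
  have : 0 <= h * (t - 2^-1) ^+ 2 by rewrite mulr_ge0 ?sqr_ge0// ltW.
  by move: h0; nra.
set z := q - a - s q *: e in psiE.
have zd : `|z| < d'.
  have : K * dot z z < 2 * B + 1.
    have := psiE q; rewrite -/z => pE.
    have h3 : h * (s q ^+ 2 - s q) <= 0.
      by rewrite pmulr_rle0// expr2; move: s0 s1; nra.
    have := vB _ Dq; have := vB _ Da; have := vB _ Db.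
    rewrite !ler_norml => /andP[b1 b2] /andP[a1 a2] /andP[q1 q2].
    have : v a + s q * (v b - v a) <= B by move: s0 s1; nra.
    by move: qlt; rewrite pE; move: h0; lra.
  rewrite mulrC -ltr_pdivlMr// /K invf_div mulrCA divff ?mulr1; last first.
    by rewrite gt_eqF// ltr_wpDl// mulr_ge0.
  move=> zz; rewrite -(ltr_pXn2r (n := 2))// ?nnegrE ?(ltW d'0)//.
  exact: le_lt_trans (norm_sqr_le_dot z) zz.
have zdd : `|z| < d by apply: lt_le_trans zd _; rewrite ge_min lexx.
have zm : `|z| < m / 2 by apply: lt_le_trans zd _; rewrite ge_min lexx orbT.
have K0z : 0 <= K * dot z z by rewrite mulr_ge0 ?dot_ge0// ltW.
have sq0 : 0 < s q.
  rewrite lt_neqAle s0 andbT eq_sym; apply/eqP => sq.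
  have qa : `|q - a| < d by move: zdd; rewrite /z sq scale0r subr0.
  have := dP _ _ Da Dq qa; rewrite ltr_norml => /andP[va _].
  by move: qlt; rewrite psiE -/z sq; move: va K0z; lra.
have sq1 : s q < 1.
  rewrite lt_neqAle s1 andbT; apply/eqP => sq.
  have qb : `|q - b| < d.
    by move: zdd; rewrite /z sq scale1r /e -addrA -opprD addrCA subrr addr0.
  have := dP _ _ Db Dq qb; rewrite ltr_norml => /andP[vb _].
  by move: qlt; rewrite psiE -/z sq; move: vb K0z; lra.
have wmin : local_min_on D (fun q => v q - psi q) q.
  apply/local_min_onP; split=> //.
  have : \forall q' \near q, 0 < s q' < 1.
    apply: filterS2 (cvgr_gt _ (cs q) _ sq0) (cvgr_lt _ (cs q) _ sq1).
    by move=> q' /= -> ->.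
  move=> /nbhs_ballP[d1 /= d10 d1P]; exists d1 => // q' Dq' qq'.
  apply: qmin; apply/mem_set; split=> //.
  have := d1P q'; rewrite -ball_normE/= distrC => /(_ qq') /andP[x1 x2].
  by rewrite /preimage/= in_itv/= !ltW.
have [_ /(_ e)] := supersolution_quad vsup wmin.
have eT : tangent q e.
  have qm i : m / 2 <= q ord0 i.
    have qE : q ord0 i = a ord0 i + s q * (b ord0 i - a ord0 i) + z ord0 i.
      by rewrite !mxE; ring.
    have : `|z ord0 i| <= m / 2 by apply: le_trans (entry_le_norm _ _ _) (ltW zm).
    rewrite ler_norml => /andP[z1 _]; rewrite qE.
    by have := am i; have := bm i; move: s0 s1 z1; nra.
  have em i : `|e ord0 i| <= 1.
    by apply: le_trans (entry_le_norm _ _ _) (state_simplex_normB Db Da).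
  have m2 : 0 < m / 2 by rewrite divr_gt0.
  exists (m / 2); split=> //; [|rewrite -scaleNr];
    apply: (state_simplex_add Dq qm) => [i|].
  - by apply: scaled_entry_le; rewrite // gtr0_norm.
  - by under eq_bigr do rewrite mxE; rewrite -mulr_sumr sum_entryB// mulr0.
  - by apply: scaled_entry_le; rewrite // normrN gtr0_norm.
  - by under eq_bigr do rewrite mxE; rewrite -mulr_sumr sum_entryB// mulr0.
move=> /(_ eT e0); rewrite tensor_form -/E.
rewrite [leLHS](_ : _ = h); last by field; rewrite gt_eqF.
by rewrite leNgt h0.
Qed.

Lemma supersolution_concave : concave_on_simplex v.
Proof.
move=> a b t Da Db t01.
have N0 := state_simplex_N_gt0 Da.
have Dc := @state_simplex_center R N N0.
apply/ler_addgt0Pr => e e0.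
have e2 : 0 < e / 2 by rewrite divr_gt0.
have [d d0 dP] := compact_uniform_modulus (@compact_state_simplex R N) vcont e2.
pose k := Num.min (d / 2) (2^-1).
have k0 : 0 < k by rewrite lt_min divr_gt0//= invr_gt0.
have k01 : 0 <= k <= 1.
  rewrite ltW//= ge_min; apply/orP; right.
  by rewrite invf_le1// ler1n.
have kd : k < d by rewrite gt_min; apply/orP; left; rewrite ltr_pdivrMr// ltr_pMr// ltr1n.
pose sh p : 'rV[R]_N := (1 - k) *: p + k *: center.
have Dsh p : D p -> D (sh p) by move=> Dp; exact: state_simplex_convex.
have shd p : D p -> `|sh p - p| < d.
  move=> Dp; have -> : sh p - p = k *: (center - p).
    by apply/rowP => i; rewrite !mxE; ring.
  rewrite normrZ gtr0_norm//; apply: le_lt_trans kd.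
  by rewrite -[leRHS]mulr1 ler_pM2l// state_simplex_normB.
have shm p i : D p -> k * N%:R^-1 <= sh p ord0 i.
  move=> [p0 _]; rewrite !mxE lerDr mulr_ge0// subr_ge0.
  by case/andP: k01.
have m0 : 0 < k * N%:R^-1 by rewrite mulr_gt0// invr_gt0 ltr0n.
have := supersolution_concave_interior (Dsh _ Da) (Dsh _ Db) m0
  (fun i => shm a i Da) (fun i => shm b i Db) t01.
have -> : (1 - t) *: sh a + t *: sh b = sh ((1 - t) *: a + t *: b).
  by apply/rowP => i; rewrite !mxE; ring.
have Dt := state_simplex_convex Da Db t01.
have := dP _ _ Da (Dsh _ Da) (shd _ Da); have := dP _ _ Db (Dsh _ Db) (shd _ Db).
have := dP _ _ Dt (Dsh _ Dt) (shd _ Dt).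
rewrite !ltr_norml => /andP[_ x1] /andP[x2 _] /andP[x3 _].
by move: t01 => /andP[t0 t1]; nra.
Qed.

End SupersolutionConcave.

(** * Comparison principle *)

Section Comparison.
Context {R : realType} {N : nat} {A B : finType}.
Variables (g : 'I_N -> A -> B -> R) (r : R) (Q : A -> B -> 'M[R]_N).
Variables (a0 : A) (b0 : B).
Hypothesis r_gt0 : 0 < r.
Hypothesis Q_sum0 : forall s a b, \sum_s' Q a b s s' = 0.
Implicit Types (p q xi : 'rV[R]_N).
Local Notation D := (state_simplex (R := R) N).
Local Notation H := (hamiltonian g r Q).
Local Notation ham := (ham_term g r Q).

Definition rate_bound : R := \sum_a \sum_b `|Q a b|.
Definition payoff_bound : R := \sum_s \sum_a \sum_b `|g s a b|.

Lemma rate_le_bound a b : `|Q a b| <= rate_bound.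
Proof.
rewrite /rate_bound (bigD1 a)//= (bigD1 b)//= -addrA lerDl.
by rewrite addr_ge0// sumr_ge0// => ? _; exact: sumr_ge0.
Qed.

Lemma rate_bound_ge0 : 0 <= rate_bound.
Proof. by do 2 (apply: sumr_ge0 => ? _). Qed.

Lemma payoff_le_bound s a b : `|g s a b| <= payoff_bound.
Proof.
rewrite /payoff_bound (bigD1 s)//= (bigD1 a)//= (bigD1 b)//= -!addrA lerDl.
rewrite !addr_ge0// ?sumr_ge0// => ? _; rewrite ?sumr_ge0// => ? _.
exact: sumr_ge0.
Qed.

Lemma payoff_bound_ge0 : 0 <= payoff_bound.
Proof. by do 3 (apply: sumr_ge0 => ? _). Qed.

Lemma dot_mulmx_le p (M : 'M[R]_N) xi : `|M| <= rate_bound ->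
  `|dot (p *m M) xi| <= N%:R ^+ 2 * rate_bound * `|p| * `|xi|.
Proof.
move=> Mb; apply: (le_trans (dot_le_norm _ _)).
rewrite expr2 -!mulrA ler_wpM2l// !mulrA ler_wpM2r//.
apply: (le_trans (mulmx_le_norm _ _)).
by rewrite -mulrA ler_wpM2l// mulrC ler_wpM2r.
Qed.

Lemma payoff_term_le p a b :
  `|\sum_s p ord0 s * g s a b| <= N%:R * (`|p| * payoff_bound).
Proof.
apply: (le_trans (ler_norm_sum _ _ _)); apply: sum_ord_le => s.
by rewrite normrM ler_pM// ?entry_le_norm// payoff_le_bound.
Qed.

Lemma ham_term_close p p' xi xi' a b : `|p'| <= 1 ->
  ham p xi a b <= ham p' xi' a b +
    (N%:R ^+ 2 * rate_bound * (`|p' - p| * `|xi| + `|xi' - xi|) +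
     r * (N%:R * (`|p' - p| * payoff_bound))).
Proof.
move=> p'1; rewrite /ham_term.
have -> : - dot (p *m Q a b) xi = - dot (p' *m Q a b) xi' +
   (dot ((p' - p) *m Q a b) xi + dot (p' *m Q a b) (xi' - xi)).
  by rewrite mulmxBl dotBl dotBr; ring.
have -> : \sum_s p ord0 s * g s a b =
   \sum_s p' ord0 s * g s a b - \sum_s (p' - p) ord0 s * g s a b.
  rewrite -sumrB; apply: eq_bigr => s _; rewrite !mxE; ring.
have := dot_mulmx_le (p' - p) xi (rate_le_bound a b).
have := dot_mulmx_le p' (xi' - xi) (rate_le_bound a b).
have := payoff_term_le (p' - p) a b.
rewrite !ler_norml => /andP[_ h1] /andP[_ h2] /andP[_ h3].
have h4 : N%:R ^+ 2 * rate_bound * `|p'| * `|xi' - xi| <=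
    N%:R ^+ 2 * rate_bound * `|xi' - xi|.
  rewrite ler_wpM2r// -[leRHS]mulr1 ler_wpM2l// mulr_ge0 ?rate_bound_ge0//.
have h5 := ler_wpM2l (ltW r_gt0) h1.
move: h2 h3 h4 h5; rewrite mulrBr mulrDr mulrA.
move: (dot _ _) (dot _ _) (dot _ _) (\sum_s _) (\sum_s _) => x1 x2 x3 x4 x5.
move: (r * _) => y1 h2 h3 h4 h5.
by rewrite !mulrA in h2 h3 h4 h5 *; lra.
Qed.

Lemma hamiltonian_close p p' xi xi' : `|p'| <= 1 ->
  H p xi <= H p' xi' +
    (N%:R ^+ 2 * rate_bound * (`|p' - p| * `|xi| + `|xi' - xi|) +
     r * (N%:R * (`|p' - p| * payoff_bound))).
Proof.
by move=> p'1; apply: hamiltonian_le_add => // a b; exact: ham_term_close.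
Qed.

Lemma compact_box (L : R) : compact [set xi : 'rV[R]_N | forall i, `|xi ord0 i| <= L].
Proof.
have -> : [set xi : 'rV[R]_N | forall i, `|xi ord0 i| <= L] =
    [set xi | forall i, `[- L, L]%classic (xi ord0 i)].
  apply/seteqP; split=> xi xiL i; have := xiL i.
    by rewrite ler_norml /= in_itv.
  by rewrite /= in_itv/= -ler_norml.
by apply: (@rV_compact _ _ (fun=> `[- L, L]%classic)) => _; exact: segment_compact.
Qed.

(* Touch v from below at points q_j near q by the paraboloids of opening j;
   their gradients are supergradients of v, bounded since q is interior, and any
   cluster point is a supergradient at q that inherits the inequality. *)
Lemma supersolution_supergradient v q (m : R) : viscosity_supersolution r H v ->
  {within D, continuous v} -> D q -> 0 < m -> (forall i, m <= q ord0 i) ->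
  exists xi, (forall q', D q' -> v q' <= v q + dot (q' - q) xi) /\
    0 <= r * v q + H q xi.
Proof.
move=> vsup vcont Dq m0 qm.
have vconc := supersolution_concave vsup vcont.
have [Bd B0 vB] := within_bounded vcont.
pose L := 8 * Bd / m + 1.
have L0 : 0 < L by rewrite ltr_wpDl// divr_ge0 ?mulr_ge0// ltW.
have step (e : R) : 0 < e -> exists2 xi : 'rV[R]_N, (forall i, `|xi ord0 i| <= L) &
    exists q1, [/\ D q1, `|q1 - q| < e,
      forall q', D q' -> v q' <= v q1 + dot (q' - q1) xi &
      0 <= r * v q1 + H q1 xi].
  move=> e0.
  pose e' := Num.min e (m / 2).
  have m2 : 0 < m / 2 by rewrite divr_gt0.
  have e'0 : 0 < e' by rewrite lt_min e0 m2.
  pose K := (2 * Bd + 1) / e' ^+ 2.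
  have K0 : 0 < K by rewrite divr_gt0 ?exprn_gt0// ltr_wpDl// mulr_ge0.
  pose psi := quad q 0 0 (- K)%:M.
  have psiE q' : psi q' = - (K * dot (q' - q) (q' - q)).
    by rewrite /psi quad_scalar dot0r !add0r mulNr.
  have [q1 /set_mem Dq1 q1min] : exists2 q1, q1 \in D & forall q', q' \in D ->
      v q1 - psi q1 <= v q' - psi q'.
    apply: compact_EVT_min; [by exists q|exact: compact_state_simplex|].
    by move=> x; apply: cvgB; [exact: vcont|exact: within_quad].
  have {}q1min q' : D q' -> v q1 - psi q1 <= v q' - psi q'.
    by move=> Dq'; apply: q1min; exact: mem_set.
  have q1q : `|q1 - q| < e'.
    have := q1min _ Dq; rewrite !psiE subrr dot0l mulr0 oppr0 subr0 opprK.
    have := vB _ Dq; have := vB _ Dq1; rewrite !ler_norml => /andP[x1 x2] /andP[x3 x4] x5.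
    have : K * dot (q1 - q) (q1 - q) < 2 * Bd + 1 by lra.
    rewrite mulrC -ltr_pdivlMr// /K invf_div mulrCA divff ?mulr1; last first.
      by rewrite gt_eqF// ltr_wpDl// mulr_ge0.
    move=> zz; rewrite -(ltr_pXn2r (n := 2))// ?nnegrE ?(ltW e'0)//.
    exact: le_lt_trans (norm_sqr_le_dot _) zz.
  have q1m i : m / 2 <= q1 ord0 i.
    have : `|(q1 - q) ord0 i| <= m / 2.
      by rewrite (le_trans (entry_le_norm _ _ _))// (le_trans (ltW q1q))// ge_min lexx orbT.
    by rewrite !mxE ler_norml => /andP[x1 _]; have := qm i; lra.
  pose xi : 'rV[R]_N := 0 + (q1 - q) *m ((- K)%:M + (- K)%:M^T).
  have xiP := concave_supergradient vconc Dq1 m2 q1m q1min.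
  have wmin : local_min_on D (fun q' => v q' - psi q') q1.
    by apply/local_min_onP; split=> //; exists 1 => // q' Dq' _; exact: q1min.
  have [xiH _] := supersolution_quad vsup wmin.
  exists xi; last first.
    exists q1; split=> //; apply: lt_le_trans q1q _.
    by rewrite ge_min lexx.
  have xi0 : \sum_i xi ord0 i = 0.
    have -> : xi = (- K *+ 2) *: (q1 - q).
      rewrite /xi add0r tr_scalar_mx -mulr2n -raddfMn/= mul_mx_scalar//.
    under eq_bigr do rewrite mxE.
    by rewrite -mulr_sumr sum_entryB// mulr0.
  have xiB i j : xi ord0 i - xi ord0 j <= 4 * Bd / m.
    pose z : 'rV[R]_N := (m / 2) *: (delta_mx ord0 j - delta_mx ord0 i).
    have Dz : D (q1 + z).
      apply: (state_simplex_add Dq1 q1m) => [k|].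
        apply: scaled_entry_le; first by rewrite gtr0_norm.
        apply: le_trans (entry_le_norm _ _ _) (state_simplex_normB _ _);
        exact: state_simplex_delta.
      under eq_bigr do rewrite mxE.
      by rewrite -mulr_sumr sum_entryB ?mulr0//; exact: state_simplex_delta.
    have := xiP _ Dz; rewrite -/xi [q1 + z]addrC addrK.
    rewrite /z dotZl dotBl !(dotC (delta_mx _ _)) !dot_delta.
    have := vB _ Dz; have := vB _ Dq1; rewrite addrC.
    rewrite !ler_norml => /andP[x1 x2] /andP[x3 x4] x5.
    rewrite ler_pdivlMr//.
    rewrite -/z in x5.
    move: (v (q1 + z)) (v q1) (xi ord0 i) (xi ord0 j) x1 x2 x3 x4 x5 => y1 y2 y3 y4.
    by nra.
  move=> i; rewrite ler_norml.
  have NR : (0 : R) < N%:R by rewrite ltr0n (state_simplex_N_gt0 Dq).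
  have up : N%:R * xi ord0 i <= N%:R * (4 * Bd / m).
    have -> : N%:R * xi ord0 i = \sum_j (xi ord0 i - xi ord0 j).
      by rewrite sumrB xi0 subr0 sumr_const card_ord mulr_natl.
    exact: sum_ord_le.
  have dn : N%:R * - xi ord0 i <= N%:R * (4 * Bd / m).
    have -> : N%:R * - xi ord0 i = \sum_j (xi ord0 j - xi ord0 i).
      by rewrite sumrB xi0 sub0r sumr_const card_ord mulrN mulr_natl.
    exact: sum_ord_le.
  rewrite !ler_pM2l// in up dn.
  have : 0 <= 4 * Bd / m by rewrite divr_ge0 ?mulr_ge0// ltW.
  by rewrite /L -mulrA; move: up dn; rewrite -mulrA; lra.
have step' (j : nat) : exists x : 'rV[R]_N * 'rV[R]_N,
    (forall i, `|x.1 ord0 i| <= L) /\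
    [/\ D x.2, `|x.2 - q| < j.+1%:R^-1,
      forall q', D q' -> v q' <= v x.2 + dot (q' - x.2) x.1 &
      0 <= r * v x.2 + H x.2 x.1].
  have [|xi xiL [q1 q1P]] := step j.+1%:R^-1; first by rewrite invr_gt0.
  by exists (xi, q1).
have [x xP] := choice step'.
have [j|xi xiL xiP] := compact_subsequence (x := fun j => (x j).1) (@compact_box L).
  by case: (xP j).
have xi_norm : `|xi| <= L by apply: norm_le_entries => //; exact: ltW.
have close (e : R) : 0 < e -> exists xi1 q1, [/\ D q1, `|xi1 - xi| < e, `|q1 - q| < e,
    `|v q1 - v q| < e & [/\ forall q', D q' -> v q' <= v q1 + dot (q' - q1) xi1,
     `|xi1| <= L & 0 <= r * v q1 + H q1 xi1]].
  move=> e0; have /within_continuousP cv := vcont.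
  have [d d0 dP] := cv q Dq e e0.
  pose d' := Num.min d e.
  have d'0 : 0 < d' by rewrite lt_min d0 e0.
  have [j jl jx] := xiP e e0 (Num.truncn d'^-1).
  have [x1L [Dx2 x2q x2P x2H]] := xP j.
  have jd : (j.+1%:R^-1 : R) < d'.
    rewrite invf_plt ?posrE//; apply: (lt_le_trans (truncnS_gt _)).
    by rewrite ler_nat ltnS.
  have x2d := lt_trans x2q jd.
  exists (x j).1, (x j).2; split=> //.
  - by apply: lt_le_trans x2d _; rewrite ge_min lexx orbT.
  - by apply: dP => //; apply: lt_le_trans x2d _; rewrite ge_min lexx.
  - by split=> //; apply: norm_le_entries => //; exact: ltW.
exists xi; split=> [q' Dq'|].
  apply/ler_addgt0Pr => e e0.
  pose c := 1 + N%:R + N%:R * L.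
  have c0 : 0 < c by rewrite /c -addrA ltr_pwDl// addr_ge0// mulr_ge0// ltW.
  have [xi1 [q1 [Dq1 h1 h2 h3 [h4 h5 h6]]]] := close (e / c) (divr_gt0 e0 c0).
  apply: (le_trans (h4 _ Dq')).
  have -> : dot (q' - q1) xi1 = dot (q' - q) xi + dot (q' - q1) (xi1 - xi)
     - dot (q1 - q) xi by rewrite !dotBr !dotBl; ring.
  have k1 : `|dot (q' - q1) (xi1 - xi)| <= N%:R * (e / c).
    apply: (le_trans (dot_le_norm _ _)); rewrite ler_wpM2l// -[leRHS]mul1r.
    by rewrite ler_pM// ?state_simplex_normB// ltW.
  have k2 : `|dot (q1 - q) xi| <= N%:R * L * (e / c).
    apply: (le_trans (dot_le_norm _ _)); rewrite -mulrA ler_wpM2l// mulrC.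
    by rewrite ler_pM// ltW.

  move: h3 k1 k2; rewrite ltr_norml !ler_norml => /andP[_ h3] /andP[_ k1] /andP[k2 _].
  have ce : e = e / c * c by rewrite divfK// gt_eqF.
  move: ce h3 k1 k2; set t := e / c => ce h3 k1 k2; rewrite [e]ce /c.
  by move: h3 k1 k2; rewrite !mulrDr mulr1 ![t * _]mulrC; lra.
apply/ler_addgt0Pr => e e0.
pose c := r + (N%:R ^+ 2 * rate_bound * (L + 1) + r * (N%:R * payoff_bound)).
have c0 : 0 < c.
  rewrite ltr_wpDr// addr_ge0// !mulr_ge0 ?rate_bound_ge0 ?payoff_bound_ge0//.
  - by rewrite addr_ge0// ltW.
  - exact: ltW.
have [xi1 [q1 [Dq1 h1 h2 h3 [h4 h5 h6]]]] := close (e / c) (divr_gt0 e0 c0).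
apply: (le_trans h6).
have := hamiltonian_close q1 xi1 xi (state_simplex_norm Dq).
rewrite (distrC q) (distrC xi).
set t := e / c in h1 h2 h3 *.
have t0 : 0 <= t by rewrite divr_ge0// ltW.
have ce : e = t * c by rewrite divfK// gt_eqF.
have k1 : `|q1 - q| * `|xi1| <= t * L by rewrite ler_pM// ltW.
have k2 : N%:R ^+ 2 * rate_bound * (`|q1 - q| * `|xi1| + `|xi1 - xi|) <=
    N%:R ^+ 2 * rate_bound * (t * L + t).
  by rewrite ler_wpM2l ?mulr_ge0 ?rate_bound_ge0// lerD// ltW.
have k3 : r * (N%:R * (`|q1 - q| * payoff_bound)) <= r * (N%:R * (t * payoff_bound)).
  rewrite ler_pM2l// ler_wpM2l// ler_wpM2r ?payoff_bound_ge0// ltW//.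
have k4 : r * v q1 <= r * v q + r * t.
  rewrite -mulrDr ler_pM2l//; move: h3; rewrite ltr_norml => /andP[_]; lra.
move=> k5; rewrite ce /c.
rewrite (_ : t * _ = r * t + (N%:R ^+ 2 * rate_bound * (t * L + t) +
  r * (N%:R * (t * payoff_bound)))); last by ring.
by lra.
Qed.

Theorem comparison u v : viscosity_subsolution r H u -> viscosity_supersolution r H v ->
  {within D, continuous u} -> {within D, continuous v} ->
  forall p, D p -> u p <= v p.
Proof.
move=> usub vsup ucont vcont p Dp.
have N0 := state_simplex_N_gt0 Dp.
have NR : (0 : R) < N%:R by rewrite ltr0n.
have Dc := @state_simplex_center R N N0.
pose tau := N%:R^-1 / (N%:R * rate_bound + 1).
have den0 : 0 < N%:R * rate_bound + 1.
  by rewrite ltr_wpDl// mulr_ge0 ?rate_bound_ge0.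
have tau0 : 0 < tau by rewrite divr_gt0 ?invr_gt0.
pose k1 := N%:R ^+ 2 * rate_bound.
pose k2 := r * (N%:R * payoff_bound).
have k10 : 0 <= k1 by rewrite mulr_ge0 ?rate_bound_ge0// exprn_ge0.
have k20 : 0 <= k2 by rewrite !mulr_ge0 ?payoff_bound_ge0// ltW.
pose C := 1 + (tau^-1 + 2 * k1 + k2) / r + N%:R.
have C0 : 0 < C.
  have : 0 <= (tau^-1 + 2 * k1 + k2) / r.
    rewrite divr_ge0 ?(ltW r_gt0)// addr_ge0// addr_ge0 ?invr_ge0 ?(ltW tau0)//.
    exact: mulr_ge0.
  by move: NR; rewrite /C; lra.
apply/ler_addgt0Pr => eta eta0.
pose s := eta / C.
have s0 : 0 < s by rewrite divr_gt0.
have [d d0 dP] := compact_uniform_modulus (@compact_state_simplex R N) vcont s0.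
pose e := Num.min (Num.min s (d / 2)) 2^-1.
have e0 : 0 < e by rewrite !lt_min s0 divr_gt0//= invr_gt0.
have es : e <= s by rewrite !ge_min lexx.
have ed : e < d.
  by rewrite !gt_min [_ / 2 < _]ltr_pdivrMr// ltr_pMr// ltr1n orbT.
have e01 : 0 <= e <= 1.
  by rewrite ltW//= !ge_min invf_le1// ler1n orbT.
have e1 : 0 < 1 - e.
  rewrite subr_gt0 !gt_min [2^-1 < _]invf_lt1// ltr1n orbT//.
pose sh q : 'rV[R]_N := (1 - e) *: q + e *: center.
have Dsh q : D q -> D (sh q) by move=> Dq; exact: state_simplex_convex.
have shB q q' : sh q - sh q' = (1 - e) *: (q - q').
  by apply/rowP => i; rewrite !mxE; ring.
have csh : {within D, continuous (v \o sh)}.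
  apply/within_continuousP => x Dx t t0; move/within_continuousP: vcont => vc.
  have [d1 d10 d1P] := vc _ (Dsh _ Dx) t t0; exists d1 => // y Dy yx.
  apply: d1P; first exact: Dsh.
  rewrite shB normrZ gtr0_norm//; apply: le_lt_trans yx.
  by rewrite -[leRHS]mul1r ler_wpM2r// lerBlDr lerDl ltW.
have [pm /set_mem Dpm pmax] : exists2 pm, pm \in D & forall q, q \in D ->
    u q - (v \o sh) q - quad 0 0 0 (- s)%:M q <=
    u pm - (v \o sh) pm - quad 0 0 0 (- s)%:M pm.
  apply: compact_EVT_max; [by exists p|exact: compact_state_simplex|].
  move=> x; apply: cvgB; last exact: within_quad.
  by apply: cvgB; [exact: ucont|exact: csh].
have {}pmax q : D q -> u q - v (sh q) + s * dot q q <=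
    u pm - v (sh pm) + s * dot pm pm.
  move=> Dq; have := pmax q (mem_set Dq).
  by rewrite !quad_scalar !dot0r !subr0 !add0r !mulNr !opprK.
set qm := sh pm in pmax.
have Dqm : D qm by exact: Dsh.
have m0 : 0 < e / N%:R by rewrite divr_gt0.
have qmm i : e / N%:R <= qm ord0 i.
  rewrite !mxE lerDr mulr_ge0 ?(ltW e1)//; exact: Dpm.1.
have [xi [xiP xiH]] := supersolution_supergradient vsup vcont Dqm m0 qmm.
have Hu : r * u pm + H pm ((1 - e) *: xi + (pm - 0) *m ((- s)%:M + (- s)%:M^T)) <= 0.
  apply: (subsolution_quad usub (c := 0) s0) => [z|].
    by rewrite mul_mx_scalar dotZl.
  apply/local_max_onP; split=> //; exists 1 => // q Dq _.
  have h1 := pmax _ Dq; have h2 := xiP _ (Dsh _ Dq).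
  rewrite /qm shB dotZl -/qm dotBl in h2.
  rewrite !quad_scalar !subr0 !dotZr.
  by move: h1 h2; rewrite !mulrBr; lra.
have flow a b : - (e * dot (center *m Q a b) xi) <= s * tau^-1.
  pose z : 'rV[R]_N := (e * tau) *: (center *m Q a b).
  have zc i : `|(center *m Q a b) ord0 i| <= N%:R * rate_bound + 1.
    apply: (le_trans (entry_le_norm _ _ _)); apply: (le_trans (mulmx_le_norm _ _)).
    rewrite ler_wpDr// ler_wpM2l// -[leRHS]mul1r.
    by rewrite ler_pM// ?state_simplex_norm// rate_le_bound.
  have zE i : `|z ord0 i| <= e / N%:R.
    have -> : z ord0 i = e * tau * (center *m Q a b) ord0 i by rewrite mxE.
    rewrite normrM (gtr0_norm (mulr_gt0 e0 tau0)) -mulrA ler_pM2l// /tau.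
    by rewrite mulrAC -mulrA -[leRHS]mulr1 ler_pM2l ?invr_gt0// ler_pdivrMr// mul1r.
  have Dz : D (qm + z).
    apply: (state_simplex_add Dqm qmm) => //.
    under eq_bigr do rewrite mxE.
    rewrite -mulr_sumr; under eq_bigr do rewrite mxE.
    rewrite exchange_big/= big1 ?mulr0// => k _.
    by rewrite -mulr_sumr Q_sum0 mulr0.
  have zd : `|qm + z - qm| < d.
    rewrite addrAC subrr add0r; apply: le_lt_trans ed.
    apply: norm_le_entries => [|i]; first exact: ltW.
    by apply: (le_trans (zE i)); rewrite ler_pdivrMr// ler_peMr ?(ltW e0)// ler1n.
  have zz : qm + z - qm = z by rewrite addrAC subrr add0r.
  have := xiP _ Dz; rewrite zz dotZl.
  have := dP _ _ Dqm Dz zd; rewrite ltr_norml => /andP[h1 _] h2.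
  rewrite ler_pdivlMr// mulNr mulrAC.
  by move: h1 h2; lra.
have HH : H qm xi <= H pm ((1 - e) *: xi + (pm - 0) *m ((- s)%:M + (- s)%:M^T)) +
    (s * tau^-1 + 2 * s * k1 + e * k2).
  apply: hamiltonian_le_add => // a b.
  rewrite /ham_term subr0 tr_scalar_mx mulmxDr mul_mx_scalar.
  have -> : \sum_s0 qm ord0 s0 * g s0 a b = \sum_s0 pm ord0 s0 * g s0 a b +
      e * \sum_s0 (center - pm) ord0 s0 * g s0 a b.
    rewrite mulr_sumr -big_split/=; apply: eq_bigr => i _.
    by rewrite !mxE; ring.
  rewrite /qm /sh mulmxDl -!scalemxAl dotDl !dotZl !dotDr !dotZr.
  have h1 := flow a b.
  have h2 : `|dot (pm *m Q a b) pm| <= k1.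
    apply: (le_trans (dot_mulmx_le _ _ (rate_le_bound a b))).
    rewrite -mulrA -[leRHS]mulr1 ler_wpM2l// -[leRHS]mulr1.
    by rewrite ler_pM// state_simplex_norm.
  have h3 : r * `|\sum_s0 (center - pm) ord0 s0 * g s0 a b| <= k2.
    rewrite /k2 ler_pM2l//; apply: (le_trans (payoff_term_le _ _ _)).
    by rewrite ler_wpM2l// -[leRHS]mul1r ler_wpM2r ?payoff_bound_ge0// state_simplex_normB.
  have h4 : s * - dot (pm *m Q a b) pm <= s * k1.
    by rewrite ler_pM2l//; apply: le_trans h2; rewrite -normrN ler_norm.
  have h5 : e * (r * - (\sum_s0 (center - pm) ord0 s0 * g s0 a b)) <= e * k2.
    rewrite ler_pM2l//; apply: le_trans h3; rewrite ler_pM2l// -normrN.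
    exact: ler_norm.
  move: h1 h4 h5; rewrite mulrDr.
  move: (dot _ _) (dot _ _) (dot _ _) (\sum_s0 _) (\sum_s0 _) => x1 x2 x3 x4 x5.
  by move=> h1 h4 h5; nra.
have ruv : u pm - v qm <= s * ((tau^-1 + 2 * k1 + k2) / r).
  rewrite mulrA ler_pdivlMr// mulrC mulrBr.
  have : e * k2 <= s * k2 by rewrite ler_wpM2r.
  by move: Hu HH xiH; lra.
have up := pmax _ Dp.
have vp : v (sh p) <= v p + s.
  have : `|sh p - p| < d.
    have -> : sh p - p = e *: (center - p).
      by apply/rowP => i; rewrite !mxE; ring.
    rewrite normrZ gtr0_norm//; apply: le_lt_trans ed.
    by rewrite -[leRHS]mulr1 ler_pM2l// state_simplex_normB.
  move=> /(dP _ _ Dp (Dsh _ Dp)); rewrite ltr_norml => /andP[_].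
  by lra.
have pp : s * dot pm pm <= s * N%:R.
  rewrite ler_pM2l//; apply: (le_trans (ler_norm _)).
  apply: (le_trans (dot_le_norm _ _)); rewrite -[leRHS]mulr1 ler_wpM2l//.
  by rewrite -[leRHS]mulr1 ler_pM// state_simplex_norm.
have p0 : 0 <= s * dot p p by rewrite mulr_ge0 ?dot_ge0// ltW.
have -> : eta = s * C by rewrite divfK// gt_eqF.
by rewrite /C; move: ruv; rewrite !mulrDr mulr1; lra.
Qed.

End Comparison.

(** * One-stage expansion of the values *)

Section DiscreteValues.
Context {R : realType} {N : nat} {A B : finType}.
Variables (g : 'I_N -> A -> B -> R) (r : R) (Q : A -> B -> 'M[R]_N).
Variables (a0 : A) (b0 : B).
Hypothesis r_gt0 : 0 < r.
Hypothesis rateQ : is_rate Q.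
Implicit Types (p q xi : 'rV[R]_N).
Local Notation D := (state_simplex (R := R) N).
Local Notation H := (hamiltonian g r Q).
Local Notation ham := (ham_term g r Q).
Local Notation kQ := (rate_bound Q).
Local Notation Mg := (payoff_bound g).

Definition game_value (n : nat) : 'rV[R]_N -> R :=
  val_fun g (transition Q n) (discount r n) Mg.

Let P_ge0 n := transition_ge0 rateQ n.
Let P_sum1 n := transition_sum1 rateQ n.
Let gM := payoff_le_bound g.
Let M0 : 0 <= Mg := payoff_bound_ge0 g.
Let l01 n (n0 : (0 < n)%N) : 0 < discount r n < 1.
Proof. by case: (discount_bounds r_gt0 n0). Qed.

Lemma game_valueP n p : (0 < n)%N -> D p ->
  is_game_value g r Q n p (game_value n p).
Proof.
move=> n0 Dp.
exact: (val_fun_is_value (P_ge0 n) (P_sum1 n) (l01 n0) gM M0 a0 b0).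
Qed.

Let D_nonneg p : D p -> nonneg p. Proof. by case. Qed.

Lemma game_value_concave n : (0 < n)%N -> concave_on_simplex (game_value n).
Proof.
move=> n0 a b t Da Db /andP[t0 t1].
have sc q s : nonneg q -> 0 <= s -> game_value n (s *: q) = s * game_value n q.
  exact: (val_scale (P_ge0 n) (P_sum1 n) (l01 n0) gM M0 a0).
have t1' : 0 <= 1 - t by rewrite subr_ge0.
rewrite -!sc//; try exact: D_nonneg.
apply: (val_superadd (P_ge0 n) (P_sum1 n) (l01 n0) gM M0 a0) => s;
  by rewrite mxE mulr_ge0//; apply: D_nonneg.
Qed.

Lemma game_value_lipschitz n p q : (0 < n)%N -> D p -> D q ->
  `|game_value n p - game_value n q| <= Mg * N%:R * `|p - q|.
Proof.
move=> n0 Dp Dq.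
have lip x y := val_lipschitz (P_ge0 n) (P_sum1 n) (l01 n0) gM M0 a0
  (q := x) (q' := y).
have := lip _ _ (D_nonneg Dp) (D_nonneg Dq).
have := lip _ _ (D_nonneg Dq) (D_nonneg Dp).
rewrite -/(game_value n p) -/(game_value n q) -(norm1N (q - p)) opprB.
have : Mg * norm1 (p - q) <= Mg * N%:R * `|p - q|.
  by rewrite -mulrA ler_wpM2l// norm1_le_norm.
by rewrite ler_norml; lra.
Qed.

Lemma game_value_bound n p : (0 < n)%N -> D p -> `|game_value n p| <= Mg.
Proof.
move=> n0 Dp.
have := val_le_mass (P_ge0 n) (P_sum1 n) (l01 n0) gM M0 a0 (D_nonneg Dp).
have := val_ge_mass (P_ge0 n) (P_sum1 n) (l01 n0) gM M0 a0 (D_nonneg Dp).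
by rewrite Dp.2 mulr1 ler_norml /game_value => -> ->.
Qed.

Lemma game_value_within n : (0 < n)%N -> {within D, continuous (game_value n)}.
Proof.
move=> n0; apply/within_continuousP => x Dx e e0.
pose c := Mg * N%:R + 1.
have c0 : 0 < c by rewrite ltr_wpDl// mulr_ge0.
exists (e / c); first by rewrite divr_gt0.
move=> y Dy yx; apply: (le_lt_trans (game_value_lipschitz n0 Dy Dx)).
apply: (@le_lt_trans _ _ (c * `|y - x|)); last by rewrite mulrC -ltr_pdivlMr.
by rewrite ler_wpM2r// lerDl.
Qed.

Definition mass q : R := \sum_s q ord0 s.

Lemma nonneg_norm1 q : nonneg q -> norm1 q = mass q.
Proof. by move=> q0; apply: eq_bigr => s _; rewrite ger0_norm. Qed.

Lemma mass_ge0 q : nonneg q -> 0 <= mass q.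
Proof. by move=> q0; exact: sumr_ge0. Qed.

Lemma norm_mulmx_norm1 q (M : 'M[R]_N) (c : R) : (forall i j, `|M i j| <= c) ->
  `|q *m M| <= c * norm1 q.
Proof.
move=> Mc; have c0 (i : 'I_N) : 0 <= c by exact: le_trans (Mc i i).
apply: norm_le_entries => [|j].
  case: (pickP 'I_N) => [i _|e]; first by rewrite mulr_ge0 ?norm1_ge0// (c0 i).
  by rewrite /norm1 big_pred0// mulr0.
rewrite mxE mulr_sumr; apply: (le_trans (ler_norm_sum _ _ _)).
by apply: ler_sum => i _; rewrite normrM mulrC ler_wpM2r.
Qed.

Lemma norm_mulmx_rate q a b : `|q *m Q a b| <= kQ * norm1 q.
Proof.
apply: norm_mulmx_norm1 => i j.
by apply: le_trans (rate_le_bound Q a b); exact: entry_le_norm.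
Qed.

Lemma transition_step (C : R) n q a b : 0 <= C -> (0 < n)%N -> nonneg q ->
  (forall a b s s', `|transition Q n a b s s' - (1%:M + n%:R^-1 *: Q a b) s s'| <=
     C * n%:R^-1 ^+ 2) ->
  `|q *m transition Q n a b - (q + n%:R^-1 *: (q *m Q a b))| <=
    C * n%:R^-1 ^+ 2 * mass q.
Proof.
move=> C0 n0 q0 H; rewrite -nonneg_norm1//.
have -> : q *m transition Q n a b - (q + n%:R^-1 *: (q *m Q a b)) =
    q *m (transition Q n a b - (1%:M + n%:R^-1 *: Q a b)).
  by rewrite mulmxBr mulmxDr mulmx1 scalemxAr.
by apply: norm_mulmx_norm1 => i j; have := H a b i j; rewrite !mxE.
Qed.

Lemma state_simplex_transition n p a b : D p -> D (p *m transition Q n a b).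
Proof.
move=> [p0 p1]; split=> [j|].
  by rewrite mxE sumr_ge0// => i _; rewrite mulr_ge0.
under eq_bigr do rewrite mxE.
rewrite exchange_big/= -p1; apply: eq_bigr => i _.
by rewrite -mulr_sumr P_sum1 mulr1.
Qed.

Definition stage_mean p a b : R := \sum_s p ord0 s * g s a b.

Lemma stage_mean_bound p a b : D p -> `|stage_mean p a b| <= Mg.
Proof.
move=> Dp; apply: (le_trans (ler_norm_sum _ _ _)).
rewrite -[leRHS]mulr1 -(state_simplex_norm1 Dp) /norm1 mulr_sumr.
by apply: ler_sum => s _; rewrite normrM mulrC ler_wpM2r.
Qed.

Lemma one_step_arith_low (V G X l h C2 M B0 W : R) : 0 <= h -> 0 <= l <= 1 ->
  l <= r * h -> r * h - (r * h) ^+ 2 <= l -> `|G - V| <= 2 * M -> `|X| <= B0 ->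
  0 <= C2 -> V + h * X - C2 * h ^+ 2 <= W ->
  V + h * (X + r * (G - V)) - (C2 + 2 * r ^+ 2 * M + r * B0) * h ^+ 2 <=
    l * G + (1 - l) * W.
Proof.
move=> h0 /andP[l0 l1] lrh llow GV XB C20 HW.
have h1 : (1 - l) * (V + h * X - C2 * h ^+ 2) <= (1 - l) * W.
  by rewrite ler_wpM2l// subr_ge0.
have h2 : - ((r * h) ^+ 2 * (2 * M)) <= (l - r * h) * (G - V).
  have : `|(l - r * h) * (G - V)| <= (r * h) ^+ 2 * (2 * M).
    rewrite normrM ler_pM// ler_norml; have := sqr_ge0 (r * h).
    by move: lrh llow; lra.
  by rewrite ler_norml => /andP[].
have h3 : - (r * h * (h * B0)) <= - (l * (h * X)).
  have : `|l * (h * X)| <= r * h * (h * B0).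
    rewrite normrM ger0_norm// ler_pM// normrM ger0_norm// ler_wpM2l//.
  by rewrite ler_norml lerN2 => /andP[].
have h4 : 0 <= l * (C2 * h ^+ 2) by rewrite !mulr_ge0// sqr_ge0.
rewrite [leLHS](_ : _ = V + h * X + r * h * (G - V) - C2 * h ^+ 2
  - (r * h) ^+ 2 * (2 * M) - r * h * (h * B0)); last by ring.
move: h1; rewrite [X in X <= _](_ : _ = V + h * X - C2 * h ^+ 2 - l * V - l * (h * X)
  + l * (C2 * h ^+ 2)); last by ring.
move: h2; rewrite mulrBl (mulrBr l); lra.
Qed.

Lemma one_step_arith_up (V G X l h c1 c2 M B0 W S T u m Y : R) :
  0 <= h -> 0 <= l -> r * h <= 2^-1 -> 0 <= u -> 0 <= m -> 0 <= c1 -> 0 <= M ->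
  0 <= c2 -> c1 + r * M <= T ->
  l <= r * h -> r * h - (r * h) ^+ 2 <= l -> `|G - V| <= 2 * M -> `|X| <= B0 ->
  Y <= m * G + M * u ->
  W <= m * V + S + h * m * X + h * c1 * u - 2 * T * h * u + c2 * h ^+ 2 * m ->
  l * Y + (1 - l) * W <= m * V + h * m * (X + r * (G - V)) + (1 - l) * S +
    (c2 + 2 * r ^+ 2 * M + r * B0) * h ^+ 2 * m.
Proof.
move=> h0 l0 rh u0 m0 c10 M0' c20 cT lrh llow GV XB HY HW.
have l1 : 2^-1 <= 1 - l by lra.
have l1' : 0 <= 1 - l by lra.
have h1 := ler_wpM2l l0 HY; have h2 := ler_wpM2l l1' HW.
have h3 : (l - r * h) * (G - V) <= (r * h) ^+ 2 * (2 * M).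
  apply: (le_trans (ler_norm _)).
  rewrite normrM ler_pM// ler_norml; have := sqr_ge0 (r * h).
  by move: lrh llow; lra.
have h4 : - (l * (h * X)) <= r * h * (h * B0).
  apply: (le_trans (ler_norm _)); rewrite normrN.
  by rewrite normrM ger0_norm// ler_pM// normrM ger0_norm// ler_wpM2l.
have h5 : 0 <= l * (c2 * h ^+ 2 * m) by rewrite !mulr_ge0// sqr_ge0.
have h6 : l * (M * u) + (1 - l) * (h * c1 * u - 2 * T * h * u) <= 0.
  have k1 : l * (M * u) <= r * h * (M * u) by rewrite ler_wpM2r// mulr_ge0.
  have k2 : (1 - l) * (h * u * (2 * T - c1)) >= 2^-1 * (h * u * (2 * T - c1)).
    rewrite ler_wpM2r// !mulr_ge0//.
    have : 0 <= r * M by rewrite mulr_ge0// ltW.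
    by move: cT c10; lra.
  have k3 : 0 <= h * u * (T - c1 - r * M) by rewrite !mulr_ge0//; move: cT; lra.
  have k4 : 0 <= h * u * c1 by rewrite !mulr_ge0.
  rewrite [X in _ + X](_ : _ = - ((1 - l) * (h * u * (2 * T - c1)))); last by ring.
  move: k1 k2 k3 k4.
  rewrite [X in X <= (1 - l) * _](_ : _ = h * u * T - 2^-1 * (h * u * c1)); last by field.
  by lra.
have h3m := ler_wpM2l m0 h3; have h4m := ler_wpM2l m0 h4.
apply: (le_trans (lerD h1 h2)); rewrite -subr_ge0.
rewrite [leRHS](_ : _ =
  - (l * (M * u) + (1 - l) * (h * c1 * u - 2 * T * h * u)) +
  (m * ((r * h) ^+ 2 * (2 * M)) - m * ((l - r * h) * (G - V))) +
  (m * (r * h * (h * B0)) - m * (- (l * (h * X)))) + l * (c2 * h ^+ 2 * m)); last by ring.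
by lra.
Qed.

Lemma ham_termE p xi a b :
  ham p xi a b = - (dot (p *m Q a b) xi + r * stage_mean p a b).
Proof. by rewrite /ham_term opprD. Qed.

Lemma dot_rate_bound p xi a b : D p -> `|dot (p *m Q a b) xi| <= N%:R * kQ * `|xi|.
Proof.
move=> Dp; apply: (le_trans (dot_le_norm _ _)).
rewrite -mulrA ler_wpM2l// ler_wpM2r//.
apply: (le_trans (norm_mulmx_rate _ _ _)).
by rewrite state_simplex_norm1// mulr1.
Qed.

Lemma one_step_low : exists2 E : R -> R -> R,
  (forall Xi K, 0 <= E Xi K) &
  forall (n : nat) p xi (Xi K rho : R), (0 < n)%N -> r * n%:R^-1 <= 1 ->
  D p -> `|xi| <= Xi -> 0 <= K -> E 0 0 * n%:R^-1 <= rho ->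
  (forall q, D q -> `|q - p| <= rho ->
     game_value n p + dot (q - p) xi - K * dot (q - p) (q - p) <= game_value n q) ->
  forall a b, game_value n p - n%:R^-1 * (ham p xi a b + r * game_value n p) -
      E Xi K * n%:R^-1 ^+ 2 <=
    discount r n * stage_mean p a b +
    (1 - discount r n) * game_value n (p *m transition Q n a b).
Proof.
have [C C0 CP] := transition_expansion Q.
have k0 : 0 <= kQ by exact: rate_bound_ge0.
pose kC := kQ + C.
have kC0 : 0 <= kC by exact: addr_ge0.
pose C2 (Xi K : R) := N%:R * C * `|Xi| + `|K| * (N%:R * kC ^+ 2).
have C20 (Xi K : R) : 0 <= C2 Xi K.
  by rewrite addr_ge0 ?mulr_ge0 ?exprn_ge0.
pose E (Xi K : R) := C2 Xi K + 2 * r ^+ 2 * Mg + r * (N%:R * kQ * `|Xi|) + kC.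
have r0 := ltW r_gt0.
have E0 (Xi K : R) : 0 <= E Xi K.
  by rewrite /E !addr_ge0 ?mulr_ge0 ?exprn_ge0.
exists E => // n p xi Xi K rho n0 rh Dp xiX K0 Erho vlow a b.
set h := n%:R^-1 in rh Erho *.
have h0 : 0 <= h by rewrite invr_ge0.
have h1 : h <= 1 by rewrite invf_le1 ?ltr0n// ler1n.
have Xi0 : 0 <= Xi by exact: le_trans xiX.
have [/andP[l0 l1] lrh llow] := discount_bounds r_gt0 n0.
have Dz := state_simplex_transition n a b Dp.
have zP := transition_step a b C0 n0 (D_nonneg Dp) (fun a b s s' => CP n a b s s' n0).
rewrite -/h in zP.
set z := p *m transition Q n a b - p.
have mp : mass p = 1 by exact: Dp.2.
have {}zP : `|z - h *: (p *m Q a b)| <= C * h ^+ 2.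
  by move: zP; rewrite mp mulr1 opprD addrA.
have hh : h ^+ 2 <= h by rewrite expr2 -[leRHS]mulr1 ler_wpM2l.
have zh : `|z| <= kC * h.
  rewrite -[z](subrK (h *: (p *m Q a b))); apply: (le_trans (ler_normD _ _)).
  rewrite /kC mulrDl addrC lerD//.
    rewrite normrZ ger0_norm// mulrC ler_wpM2r//.
    by apply: (le_trans (norm_mulmx_rate _ _ _)); rewrite state_simplex_norm1// mulr1.
  by apply: (le_trans zP); rewrite ler_wpM2l.
have Vz := vlow _ Dz.
have {}Vz := Vz (le_trans zh (le_trans (ler_wpM2r h0 _) Erho)).
have {}Vz : game_value n p + dot z xi - K * dot z z <=
    game_value n (p *m transition Q n a b).
  by apply: Vz; rewrite /E lerDr !addr_ge0 ?mulr_ge0 ?exprn_ge0.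
set V := game_value n p in Vz *; set W := game_value n _ in Vz *.
set X := dot (p *m Q a b) xi.
have dz : h * X - N%:R * (C * h ^+ 2 * Xi) <= dot z xi.
  rewrite -[z](subrK (h *: (p *m Q a b))) dotDl dotZl -/X addrC lerD2r.
  have : `|dot (z - h *: (p *m Q a b)) xi| <= N%:R * (C * h ^+ 2 * Xi).
    by apply: (le_trans (dot_le_norm _ _)); rewrite ler_wpM2l// ler_pM.
  by rewrite ler_norml => /andP[].
have zz : K * dot z z <= K * (N%:R * (kC * h) ^+ 2).
  rewrite ler_wpM2l//; apply: (le_trans (ler_norm _)).
  by apply: (le_trans (dot_le_norm _ _)); rewrite ler_wpM2l// expr2 ler_pM.
have WL : V + h * X - C2 Xi K * h ^+ 2 <= W.
  apply: le_trans Vz; rewrite /C2 !ger0_norm//.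
  move: dz zz; rewrite exprMn.
  rewrite (_ : N%:R * (C * h ^+ 2 * Xi) = N%:R * C * Xi * h ^+ 2); last by ring.
  rewrite (_ : K * (N%:R * (kC ^+ 2 * h ^+ 2)) = K * (N%:R * kC ^+ 2) * h ^+ 2); last by ring.
  by rewrite (mulrDl _ _ (h ^+ 2)); lra.
have GV : `|stage_mean p a b - V| <= 2 * Mg.
  apply: (le_trans (ler_normB _ _)); rewrite mulrDl mul1r lerD//.
    exact: stage_mean_bound.
  exact: game_value_bound.
have XB : `|X| <= N%:R * kQ * Xi.
  apply: (le_trans (dot_rate_bound xi a b Dp)).
  by rewrite ler_wpM2l// mulr_ge0.
have l01' : 0 <= discount r n <= 1 by rewrite !ltW.
have := one_step_arith_low h0 l01' lrh llow GV XB (C20 Xi K) WL.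
apply: le_trans; rewrite ham_termE -/X.
have -> : C2 Xi K + 2 * r ^+ 2 * Mg + r * (N%:R * kQ * Xi) = E Xi K - kC.
  by rewrite /E (ger0_norm Xi0) addrK.
have k2 : 0 <= kC * h ^+ 2 by rewrite mulr_ge0// exprn_ge0.
rewrite [leRHS](_ : _ = V - h * (- (X + r * stage_mean p a b) + r * V)
  - E Xi K * h ^+ 2 + kC * h ^+ 2); last by ring.
by rewrite lerDl.
Qed.

(* Homogeneous form of a strictly concave upper bound; the square is traded for
   a multiple of the l1 norm, so that it survives the normalisation of beliefs. *)
Lemma game_value_cone_le n p xi (d th : R) q : (0 < n)%N -> D p -> 0 < d -> 0 <= th ->
  (forall q, D q -> game_value n q <=
     game_value n p + dot (q - p) xi - d * dot (q - p) (q - p)) ->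
  nonneg q ->
  game_value n q <= mass q * game_value n p + dot (q - mass q *: p) xi -
    2 * th * norm1 (q - mass q *: p) + th ^+ 2 * (N%:R ^+ 2 / d) * mass q.
Proof.
move=> n0 Dp d0 th0 vup q0.
have sc x s : nonneg x -> 0 <= s -> game_value n (s *: x) = s * game_value n x.
  exact: (val_scale (P_ge0 n) (P_sum1 n) (l01 n0) gM M0 a0).
have [m0|m0] := eqVneq (mass q) 0.
  have qE : q = 0 *: p.
    rewrite scale0r; apply/rowP => i; rewrite mxE.
    by have := psumr_eq0P (fun s _ => q0 s) m0; exact.
  rewrite m0 mul0r mulr0 addr0 scale0r subr0 add0r {1}qE sc//; last exact: D_nonneg.
  by rewrite mul0r qE scale0r dot0l /norm1 big1 ?mulr0 ?subrr// => i _; rewrite mxE normr0.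
have mp : 0 < mass q by rewrite lt_neqAle eq_sym m0 mass_ge0.
pose q' := (mass q)^-1 *: q.
have qE : q = mass q *: q' by rewrite scalerA divff// scale1r.
have Dq' : D q'.
  split=> [s|]; first by rewrite mxE mulr_ge0// invr_ge0 ltW.
  by under eq_bigr do rewrite mxE; rewrite -mulr_sumr mulVf.
have -> : q - mass q *: p = mass q *: (q' - p) by rewrite scalerBr -qE.
rewrite {1}qE sc ?(ltW mp)//; last exact: D_nonneg.
rewrite dotZl norm1Z gtr0_norm//.
rewrite [leRHS](_ : _ = mass q * (game_value n p + dot (q' - p) xi -
  2 * th * norm1 (q' - p) + th ^+ 2 * (N%:R ^+ 2 / d))); last by ring.
rewrite ler_pM2l//; apply: (le_trans (vup _ Dq')).
have h1 : 2 * th * norm1 (q' - p) <= 2 * th * (N%:R * `|q' - p|).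
  by rewrite ler_wpM2l ?mulr_ge0// norm1_le_norm.
have h2 : d * `|q' - p| ^+ 2 <= d * dot (q' - p) (q' - p).
  by rewrite ler_pM2l// norm_sqr_le_dot.
have h3 : 0 <= (d * `|q' - p| - th * N%:R) ^+ 2 / d by rewrite divr_ge0 ?sqr_ge0// ltW.
have h4 : (d * `|q' - p| - th * N%:R) ^+ 2 / d = d * `|q' - p| ^+ 2 -
  2 * th * (N%:R * `|q' - p|) + th ^+ 2 * (N%:R ^+ 2 / d).
  by field; rewrite gt_eqF.
by move: h1 h2 h3; rewrite h4; lra.
Qed.

Lemma one_step_up : exists2 E : R -> R -> R,
  (forall Xi d, 0 <= E Xi d) &
  forall (n : nat) p xi (Xi d : R), (0 < n)%N -> r * n%:R^-1 <= 2^-1 ->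
  D p -> `|xi| <= Xi -> 0 < d ->
  (forall q, D q -> game_value n q <=
     game_value n p + dot (q - p) xi - d * dot (q - p) (q - p)) ->
  forall q a b, nonneg q ->
    discount r n * (\sum_s q ord0 s * g s a b) +
    (1 - discount r n) * game_value n (q *m transition Q n a b) <=
    mass q * (game_value n p - n%:R^-1 * (ham p xi a b + r * game_value n p)) +
    (1 - discount r n) * dot (q - mass q *: p) xi +
    E Xi d * n%:R^-1 ^+ 2 * mass q.
Proof.
have [C C0 CP] := transition_expansion Q.
have k0 : 0 <= kQ by exact: rate_bound_ge0.
have r0 := ltW r_gt0.
pose kC := kQ + C.
have kC0 : 0 <= kC by exact: addr_ge0.
pose c1 (Xi : R) := N%:R * kQ * `|Xi|.
have c10 (Xi : R) : 0 <= c1 Xi by rewrite !mulr_ge0.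
pose T (Xi : R) := c1 Xi + r * Mg.
have T0 (Xi : R) : 0 <= T Xi by rewrite addr_ge0// mulr_ge0.
pose c2 (Xi d : R) := N%:R * C * `|Xi| + 2 * T Xi * (N%:R * kC) +
   T Xi ^+ 2 * (N%:R ^+ 2 / `|d|).
have c20 (Xi d : R) : 0 <= c2 Xi d.
  by rewrite !addr_ge0 ?mulr_ge0 ?exprn_ge0 ?invr_ge0.
pose E (Xi d : R) := c2 Xi d + 2 * r ^+ 2 * Mg + r * (N%:R * kQ * `|Xi|).
exists E => [Xi d|n p xi Xi d n0 rh Dp xiX d0 vup q a b q0].
  by rewrite !addr_ge0 ?mulr_ge0 ?exprn_ge0.
set h := n%:R^-1 in rh *.
have h0 : 0 <= h by rewrite invr_ge0.
have h1 : h <= 1 by rewrite invf_le1 ?ltr0n// ler1n.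
have Xi0 : 0 <= Xi by exact: le_trans xiX.
have [/andP[l0 l1] lrh llow] := discount_bounds r_gt0 n0.
pose m := mass q.
have m0 : 0 <= m by exact: mass_ge0.
pose dd := q - m *: p; pose u := norm1 dd.
have u0 : 0 <= u by exact: norm1_ge0.
pose q1 := q *m transition Q n a b.
have q10 : nonneg q1.
  by move=> j; rewrite mxE sumr_ge0// => i _; rewrite mulr_ge0.
have mq1 : mass q1 = m.
  rewrite /mass; under eq_bigr do rewrite mxE.
  rewrite exchange_big/=; apply: eq_bigr => i _.
  by rewrite -mulr_sumr P_sum1 mulr1.
pose err := q1 - (q + h *: (q *m Q a b)).
have errP : `|err| <= C * h ^+ 2 * m.
  exact: transition_step a b C0 n0 q0 (fun a b s s' => CP n a b s s' n0).
have q1E : q1 - m *: p = dd + h *: (q *m Q a b) + err.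
  rewrite /err /dd /q1; move: (q *m transition _ _ _ _) (q *m Q a b) (m *: p) => x y z.
  by apply/rowP => i; rewrite !mxE; ring.
have := game_value_cone_le n0 Dp d0 (mulr_ge0 (T0 Xi) h0) vup q10.
rewrite mq1 q1E => HW.
have Y : \sum_s q ord0 s * g s a b <= m * stage_mean p a b + Mg * u.
  have -> : \sum_s q ord0 s * g s a b = m * stage_mean p a b +
      \sum_s dd ord0 s * g s a b.
    rewrite /stage_mean mulr_sumr -big_split/=; apply: eq_bigr => s _.
    by rewrite !mxE; ring.
  rewrite lerD2l; apply: (le_trans (ler_norm _)).
  apply: (le_trans (ler_norm_sum _ _ _)); rewrite mulr_sumr.
  by apply: ler_sum => s _; rewrite normrM mulrC ler_wpM2r.
pose X := dot (p *m Q a b) xi.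
have hh : h ^+ 2 <= h by rewrite expr2 -[leRHS]mulr1 ler_wpM2l.
have W1 : dot (dd + h *: (q *m Q a b) + err) xi <=
    dot dd xi + h * m * X + h * c1 Xi * u + N%:R * C * Xi * h ^+ 2 * m.
  rewrite [dot (dd + _ + err) _]dotDl [dot (dd + _) _]dotDl dotZl.
  have e1 : dot err xi <= N%:R * (C * h ^+ 2 * m * Xi).
    apply: (le_trans (ler_norm _)).
    by apply: (le_trans (dot_le_norm _ _)); rewrite ler_wpM2l// ler_pM.
  have e2 : dot (dd *m Q a b) xi <= c1 Xi * u.
    apply: (le_trans (ler_norm _)); apply: (le_trans (dot_le_norm _ _)).
    rewrite /c1 ger0_norm// -!mulrA ler_wpM2l// [leRHS](_ : _ = kQ * u * Xi); last by ring.
    by rewrite ler_pM// norm_mulmx_rate.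
  have -> : dot (q *m Q a b) xi = m * X + dot (dd *m Q a b) xi.
    by rewrite /dd mulmxBl -scalemxAl dotBl dotZl -/X; ring.
  have e3 := ler_wpM2l h0 e2.
  move: e1; rewrite (_ : N%:R * (C * h ^+ 2 * m * Xi) = N%:R * C * Xi * h ^+ 2 * m); last by ring.
  by move: e3; rewrite mulrDr !mulrA; lra.
have W2 : u - N%:R * kC * h * m <= norm1 (dd + h *: (q *m Q a b) + err).
  have e1 : u <= norm1 (dd + h *: (q *m Q a b) + err) + norm1 (- (h *: (q *m Q a b) + err)).
    rewrite /u -{1}[dd](addrK (h *: (q *m Q a b) + err)) addrA.
    exact: norm1D.
  have e2 : norm1 (- (h *: (q *m Q a b) + err)) <= N%:R * kC * h * m.
    rewrite norm1N; apply: (le_trans (norm1_le_norm _)).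
    rewrite -!mulrA ler_wpM2l//; apply: (le_trans (ler_normD _ _)).
    rewrite /kC mulrDl lerD//.
      rewrite normrZ ger0_norm// mulrCA ler_wpM2l//.
      apply: (le_trans (norm_mulmx_rate _ _ _)).
      by rewrite nonneg_norm1.
    by apply: (le_trans errP); rewrite -mulrA ler_wpM2l// ler_wpM2r.
  by lra.
have {}HW : game_value n q1 <= m * game_value n p + dot dd xi + h * m * X +
    h * c1 Xi * u - 2 * T Xi * h * u + c2 Xi d * h ^+ 2 * m.
  apply: (le_trans HW).
  have e1 : 2 * (T Xi * h) * (u - N%:R * kC * h * m) <=
      2 * (T Xi * h) * norm1 (dd + h *: (q *m Q a b) + err).
    by rewrite ler_wpM2l// !mulr_ge0.
  have -> : c2 Xi d * h ^+ 2 * m = N%:R * C * Xi * h ^+ 2 * m +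
     2 * (T Xi * h) * (N%:R * kC * h * m) + (T Xi * h) ^+ 2 * (N%:R ^+ 2 / d) * m.
    by rewrite /c2 (ger0_norm Xi0) (gtr0_norm d0); ring.
  move: e1; rewrite [leLHS](_ : _ = 2 * T Xi * h * u -
    2 * (T Xi * h) * (N%:R * kC * h * m)); last by ring.
  by move: W1; lra.
have GV : `|stage_mean p a b - game_value n p| <= 2 * Mg.
  apply: (le_trans (ler_normB _ _)); rewrite mulrDl mul1r lerD//.
    exact: stage_mean_bound.
  exact: game_value_bound.
have XB : `|X| <= N%:R * kQ * Xi.
  apply: (le_trans (dot_rate_bound xi a b Dp)).
  by rewrite ler_wpM2l// mulr_ge0.
have := one_step_arith_up h0 (ltW l0) rh u0 m0 (c10 Xi) M0 (c20 Xi d)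
  (lexx (T Xi)) lrh llow GV XB Y HW.
move/le_trans; apply; rewrite ham_termE -/X /E (ger0_norm Xi0) -/m -/dd.
by rewrite le_eqVlt; apply/orP; left; apply/eqP; ring.
Qed.

End DiscreteValues.

(** * Cluster points of the values *)

Section Semicontinuity.
Context {R : realType} {N : nat}.
Implicit Types (f : 'rV[R]_N -> R) (K : set 'rV[R]_N).

Lemma within_lsc_on K f : {within K, continuous f} -> lsc_on K f.
Proof.
move=> cf x a; rewrite lte_fin => ax.
exists [set y : subspace K | a < f y] => //.
exact: (cvgr_gt _ (cf x) _ ax).
Qed.

Lemma within_usc_on K f : {within K, continuous f} -> usc_on K f.
Proof.
move=> cf; apply: within_lsc_on => x.
by apply: continuousN; exact: cf.
Qed.

Lemma lsc_usc_within K f : lsc_on K f -> usc_on K f -> {within K, continuous f}.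
Proof.
move=> lf uf x; apply/cvgrPdist_lt => e e0.
have [|V1 V1x V1P] := lf x (f x - e); first by rewrite lte_fin ltrBlDr ltrDl.
have [|V2 V2x V2P] := uf x (- f x - e); first by rewrite lte_fin ltrBlDr ltrDl.
apply: filterS2 V1x V2x => y /V1P + /V2P; rewrite !lte_fin => y1 y2.
change (is_true (`|f x - f y| < e)).
by rewrite ltr_norml; move: y1 y2; lra.
Qed.

End Semicontinuity.

Section LocalExtrema.
Context {R : realType} {N : nat}.
Implicit Types (p q : 'rV[R]_N) (f : 'rV[R]_N -> R).
Local Notation D := (state_simplex (R := R) N).

Lemma compact_simplex_ball p (rho : R) :
  compact (D `&` [set q | `|q - p| <= rho]).
Proof.
apply: (subclosed_compact _ (@compact_state_simplex R N)) => [|q []//].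
apply: closedI.
  by apply: compact_closed; [exact: norm_hausdorff|exact: compact_state_simplex].
have cn : continuous (fun q : 'rV[R]_N => `|q - p|).
  move=> q; apply: continuous_comp; last exact: norm_continuous.
  apply: differentiable_continuous.
  by apply: differentiableB; [by []|exact: differentiable_cst].
by apply: (@closed_comp _ _ _ [set x | x <= rho]) => [q _|]; [exact: cn|exact: closed_le].
Qed.

Lemma simplex_ball_min f p (rho : R) : D p -> 0 <= rho -> {within D, continuous f} ->
  exists q, [/\ D q, `|q - p| <= rho & forall q', D q' -> `|q' - p| <= rho -> f q <= f q'].
Proof.
move=> Dp rho0 cf; pose S := D `&` [set q | `|q - p| <= rho].
have [q /set_mem[Dq qp] qmin] : exists2 q, q \in S & forall q', q' \in S -> f q <= f q'.
  apply: compact_EVT_min.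
  - by exists p; split=> //; rewrite /= subrr normr0.
  - exact: compact_simplex_ball.
  - by apply: (continuous_subspaceW _ cf) => ? [].
exists q; split=> // q' Dq' q'p; apply: qmin; exact/mem_set.
Qed.

Definition uniform_cluster (v : nat -> 'rV[R]_N -> R) (w : 'rV[R]_N -> R) :=
  forall e : R, 0 < e -> forall n0, exists2 n, (n0 <= n)%N &
    forall p, D p -> `|v n p - w p| <= e.

Lemma inv_nat_lt (e : R) : 0 < e -> exists2 n0, (0 < n0)%N &
  forall n, (n0 <= n)%N -> n%:R^-1 <= e.
Proof.
move=> e0; exists (Num.truncn e^-1).+1 => // n n0.
have ne : e^-1 <= n%:R.
  by apply: (le_trans (ltW (truncnS_gt _))); rewrite ler_nat.
rewrite -[leRHS]invrK lef_pV2// posrE ?invr_gt0//.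
by rewrite (lt_le_trans _ ne)// invr_gt0.
Qed.

End LocalExtrema.

Section TangentForms.
Context {R : realType} {N : nat}.
Variable p : 'rV[R]_N.
Hypothesis Dp : state_simplex N p.
Implicit Types (z : 'rV[R]_N) (X : 'M[R]_N).

Lemma tangent_support z : \sum_s z ord0 s = 0 ->
  (forall s, p ord0 s = 0 -> z ord0 s = 0) -> tangent p z.
Proof.
move=> z0 zp.
pose m := \big[Num.min/1]_(s | p ord0 s != 0) p ord0 s.
have m0 : 0 < m.
  by apply: lt_bigmin => // s ps; rewrite lt_neqAle eq_sym ps Dp.1.
have mp s : p ord0 s != 0 -> m <= p ord0 s by move=> ps; exact: bigmin_le_cond.
have z1 : 0 < `|z| + 1 by rewrite ltr_wpDl.
have e0 : 0 < m / (`|z| + 1) by rewrite divr_gt0.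
have De z' : `|z'| = `|z| -> \sum_s z' ord0 s = 0 ->
    (forall s, p ord0 s = 0 -> z' ord0 s = 0) ->
    state_simplex N (p + (m / (`|z| + 1)) *: z').
  move=> z'z z'0 z'p; split=> [s|]; last first.
    under eq_bigr do rewrite !mxE.
    by rewrite big_split/= -mulr_sumr z'0 mulr0 addr0 Dp.2.
  rewrite !mxE; have [/z'p ->|ps] := eqVneq (p ord0 s) 0; first by rewrite mulr0 addr0 Dp.1.
  have k : m / (`|z| + 1) * - z' ord0 s <= m.
    rewrite mulrAC ler_pdivrMr// ler_pM2l//.
    apply: (@le_trans _ _ `|z|); last by rewrite lerDl.
    by rewrite -z'z (le_trans _ (entry_le_norm z' ord0 s))// -normrN ler_norm.
  by have := mp _ ps; move: k; rewrite mulrN; lra.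
exists (m / (`|z| + 1)); split=> //; first exact: De.
rewrite -scalerN; apply: De; first by rewrite normrN.
  by under eq_bigr do rewrite mxE; rewrite sumrN z0 oppr0.
by move=> s /zp; rewrite mxE => ->; rewrite oppr0.
Qed.

Lemma lambda_max_lt0 X : (lambda_max p X < 0)%E -> exists2 d : R, 0 < d &
  forall z, tangent p z -> dot (z *m X) z <= - d * dot z z.
Proof.
move=> X0; have [d d0 dX] : exists2 d : R, 0 < d & (lambda_max p X <= (- d)%:E)%E.
  move: X0; case: (lambda_max p X) => [l|//|_].
    by rewrite lte_fin => l0; exists (- l); rewrite ?oppr_gt0// opprK.
  by exists 1; rewrite ?leNye.
exists d => // z zT; have [->|z0] := eqVneq z 0; first by rewrite mul0mx !dot0l mulr0.
have := le_trans (lambda_max_ge X zT z0) dX.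
by rewrite lee_fin ler_pdivrMr// dot_gt0.
Qed.

Definition boundary : 'rV[R]_N := \row_s (p ord0 s == 0)%:R.

Lemma boundary_formE z : dot (z *m diag_mx boundary) z =
  \sum_s (p ord0 s == 0)%:R * z ord0 s ^+ 2.
Proof.
by apply: eq_bigr => s _; rewrite mul_mx_diag !mxE; ring.
Qed.

Lemma form_le_norm X z z' : `|dot (z *m X) z'| <= N%:R ^+ 2 * `|X| * (`|z| * `|z'|).
Proof.
apply: (le_trans (dot_le_norm _ _)).
rewrite [leRHS](_ : _ = N%:R * (N%:R * (`|z| * `|X|) * `|z'|)); last by ring.
by rewrite ler_wpM2l// ler_wpM2r// mulmx_le_norm.
Qed.

(* A zero-sum [z] is a vector supported by the support of [p], on which [X] is
   negative definite, plus a correction of the size of its boundary part. *)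
Lemma boundary_penalty X (d : R) : 0 < d ->
  (forall z, tangent p z -> dot (z *m X) z <= - d * dot z z) ->
  exists2 C : R, 0 <= C & forall z, \sum_s z ord0 s = 0 ->
    dot (z *m X) z <= - (d / 4) * dot z z + C * dot (z *m diag_mx boundary) z.
Proof.
move=> d0 Xd; pose c := N%:R ^+ 2 * `|X|.
have c0 : 0 <= c by rewrite mulr_ge0// exprn_ge0.
pose C1 := 2 * c ^+ 2 / d + c + d / 2 * N%:R.
have C10 : 0 <= C1.
  by rewrite !addr_ge0// ?mulr_ge0 ?exprn_ge0 ?invr_ge0// ltW.
exists (C1 * (N%:R + 1) ^+ 2); first by rewrite mulr_ge0// exprn_ge0// addr_ge0.
move=> z z0.
have [s0 s0P] : exists s0, p ord0 s0 != 0.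
  apply/existsP; apply: contraT => /existsPn p0; have := Dp.2.
  rewrite big1 => [/esym/eqP|s _]; first by rewrite oner_eq0.
  by apply/eqP; have := p0 s; rewrite negbK.
pose zo := z *m diag_mx boundary.
have zoE s : zo ord0 s = z ord0 s * (p ord0 s == 0)%:R by rewrite /zo mul_mx_diag !mxE.
pose e := \sum_s zo ord0 s.
pose z2 := zo - e *: delta_mx ord0 s0.
have subE (u : 'rV[R]_N) k s :
    (u - k *: delta_mx ord0 s0) ord0 s = u ord0 s - k * (s == s0)%:R.
  by rewrite !mxE eqxx.
pose z1 := z - z2.
have zE : z = z1 + z2 by rewrite subrK.
have z1E s : z1 ord0 s = z ord0 s - z2 ord0 s.
  by rewrite [in RHS]zE [in RHS]mxE addrK.
have sz2 : \sum_s z2 ord0 s = 0.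
  under eq_bigr do rewrite subE.
  rewrite sumrB -/e -mulr_sumr (bigD1 s0)//= eqxx big1 => [|i /negPf ->//].
  by rewrite addr0 mulr1 subrr.
have z1T : tangent p z1.
  apply: tangent_support => [|s ps].
    by under eq_bigr do rewrite z1E; rewrite sumrB z0 sz2 subrr.
  rewrite z1E subE zoE ps eqxx mulr1.
  have /negPf -> : s != s0 by apply: contraNneq s0P => <-; apply/eqP.
  by rewrite mulr0 subr0 subrr.
have N1 : (0 : R) <= N%:R + 1 by rewrite addr_ge0.
have z2n : `|z2| ^+ 2 <= (N%:R + 1) ^+ 2 * dot (z *m diag_mx boundary) z.
  have -> : dot (z *m diag_mx boundary) z = dot zo zo.
    rewrite boundary_formE; apply: eq_bigr => s _; rewrite zoE.
    by case: eqP => _; rewrite ?mulr0 ?mul0r ?mulr1 ?mul1r// expr2.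
  apply: (@le_trans _ _ ((N%:R + 1) ^+ 2 * `|zo| ^+ 2)); last first.
    by rewrite ler_wpM2l ?exprn_ge0// norm_sqr_le_dot.
  rewrite -exprMn ler_pXn2r// ?nnegrE ?mulr_ge0//.
  apply: (le_trans (ler_normB _ _)); rewrite mulrDl mul1r addrC lerD2r normrZ.
  apply: (@le_trans _ _ `|e|).
    by rewrite ler_piMr// norm_le_entries// => i; rewrite mxE; case: (_ && _); rewrite ?normr1 ?normr0.
  apply: (le_trans (ler_norm_sum _ _ _)); apply: sum_ord_le => s.
  exact: entry_le_norm.
clearbody z1; clearbody z2.
have dz2 : dot z2 z2 <= N%:R * `|z2| ^+ 2.
  by apply: (le_trans (ler_norm _)); apply: (le_trans (dot_le_norm _ _)); rewrite expr2 mulrA.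
have dz1 := norm_sqr_le_dot z1.
have X1 := Xd _ z1T.
have X12 := form_le_norm X z1 z2; have X21 := form_le_norm X z2 z1.
have X22 := form_le_norm X z2 z2; rewrite -/c in X12 X21 X22.
have young : 2 * c * (`|z1| * `|z2|) <= d / 2 * `|z1| ^+ 2 + 2 * c ^+ 2 / d * `|z2| ^+ 2.
  have : 0 <= (d / 2) * (`|z1| - 2 * c / d * `|z2|) ^+ 2.
    by rewrite mulr_ge0 ?sqr_ge0// divr_ge0// ltW.
  rewrite (_ : _ * _ ^+ 2 = d / 2 * `|z1| ^+ 2 + 2 * c ^+ 2 / d * `|z2| ^+ 2 -
    2 * c * (`|z1| * `|z2|)); last by field; rewrite gt_eqF.
  by rewrite subr_ge0.
have split2 : dot z z <= 2 * dot z1 z1 + 2 * dot z2 z2.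
  have := dot_ge0 (z1 - z2); rewrite zE !(dotDl, dotDr, dotNl, dotNr).
  by rewrite (dotC z2 z1); lra.
have XzE : dot (z *m X) z = dot (z1 *m X) z1 + dot (z1 *m X) z2 +
    dot (z2 *m X) z1 + dot (z2 *m X) z2.
  by rewrite [in LHS]zE mulmxDl !(dotDl, dotDr); ring.
have k1 : dot (z *m X) z <= - (d / 4) * dot z z + C1 * `|z2| ^+ 2.
  have : d / 2 * dot z2 z2 <= d / 2 * (N%:R * `|z2| ^+ 2) by rewrite ler_wpM2l// divr_ge0// ltW.
  have : d / 4 * dot z z <= d / 4 * (2 * dot z1 z1 + 2 * dot z2 z2).
    by rewrite ler_wpM2l// divr_ge0// ltW.
  have : d / 2 * `|z1| ^+ 2 <= d / 2 * dot z1 z1 by rewrite ler_wpM2l// divr_ge0// ltW.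
  move: X12 X21 X22 young X1; rewrite XzE (mulrC `|z2| `|z1|) -expr2 /C1 !mulrDl.
  rewrite !ler_norml => /andP[_ x1] /andP[_ x2] /andP[_ x3].
  by move: x1 x2 x3; lra.
apply: (le_trans k1); rewrite lerD2l -mulrA ler_wpM2l//.
Qed.

End TangentForms.

Section ClusterPoints.
Context {R : realType} {N : nat} {A B : finType}.
Variables (g : 'I_N -> A -> B -> R) (r : R) (Q : A -> B -> 'M[R]_N).
Variables (a0 : A) (b0 : B).
Hypothesis r_gt0 : 0 < r.
Hypothesis rateQ : is_rate Q.
Variable w : 'rV[R]_N -> R.
Local Notation v := (game_value g r Q).
Hypothesis wP : uniform_cluster v w.
Implicit Types (p q xi : 'rV[R]_N).
Local Notation D := (state_simplex (R := R) N).
Local Notation H := (hamiltonian g r Q).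
Local Notation ham := (ham_term g r Q).
Local Notation kQ := (rate_bound Q).
Local Notation Mg := (payoff_bound g).
Local Notation L := (Mg * N%:R).

Let L0 : 0 <= L. Proof. by rewrite mulr_ge0// payoff_bound_ge0. Qed.

Lemma cluster_lipschitz p q : D p -> D q -> `|w p - w q| <= L * `|p - q|.
Proof.
move=> Dp Dq; apply/ler_addgt0Pr => e e0.
have e2 : 0 < e / 2 by rewrite divr_gt0.
have [n n0 nP] := wP e2 1%N.
have h1 := game_value_lipschitz g a0 r_gt0 rateQ n0 Dp Dq.
have := nP _ Dp; have := nP _ Dq; move: h1.
move: (L * _) => x; rewrite !ler_norml => /andP[x1 x2] /andP[y1 y2] /andP[z1 z2].
by apply/andP; split; lra.
Qed.

Lemma cluster_within : {within D, continuous w}.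
Proof.
apply/within_continuousP => x Dx e e0.
have c0 : 0 < L + 1 by rewrite ltr_wpDl.
exists (e / (L + 1)); first by rewrite divr_gt0.
move=> y Dy yx; apply: (le_lt_trans (cluster_lipschitz Dy Dx)).
apply: (@le_lt_trans _ _ ((L + 1) * `|y - x|)); last by rewrite mulrC -ltr_pdivlMr.
by rewrite ler_wpM2r// lerDl.
Qed.

Lemma cluster_concave : concave_on_simplex w.
Proof.
move=> a b t Da Db t01; apply/ler_addgt0Pr => e e0.
have e2 : 0 < e / 2 by rewrite divr_gt0.
have [n n0 nP] := wP e2 1%N.
have Dt := state_simplex_convex Da Db t01.
have := game_value_concave g a0 r_gt0 rateQ n0 Da Db t01.
have := nP _ Da; have := nP _ Db; have := nP _ Dt.
rewrite !ler_norml => /andP[x1 x2] /andP[y1 y2] /andP[z1 z2].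
by case/andP: t01 => t0 t1; nra.
Qed.

Lemma cluster_second_order phi p z : smooth phi ->
  local_min_on D (fun q => w q - phi q) p -> tangent p z ->
  dot (z *m hess phi p) z <= 0.
Proof.
move=> sphi /local_min_onP[Dp [d2 d20 wmin]] [e [e0 De1 De2]].
rewrite leNgt; apply/negP => X0; set X := dot _ z in X0.
pose k := X / (4 * (dot z z + 1)).
have zz0 := dot_ge0 z.
have den0 : 0 < 4 * (dot z z + 1) by rewrite mulr_gt0// ltr_wpDl.
have k0 : 0 < k by rewrite divr_gt0.
have [d1 d10 d1P] := smooth_taylor2 p sphi k0.
pose d := Num.min d1 d2.
have d0 : 0 < d by rewrite lt_min d10.
pose s := Num.min e (d / 2 / (`|z| + 1)).
have z1 : 0 < `|z| + 1 by rewrite ltr_wpDl.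
have s0 : 0 < s by rewrite lt_min e0 !divr_gt0.
have se : s <= e by rewrite ge_min lexx.
have szd : `|s *: z| < d.
  rewrite normrZ gtr0_norm//; apply: (@le_lt_trans _ _ (d / 2)); last first.
    by rewrite ltr_pdivrMr// ltr_pMr// ltr1n.
  apply: (@le_trans _ _ (s * (`|z| + 1))); first by rewrite ler_wpM2l ?(ltW s0)// lerDl.
  by rewrite -ler_pdivlMr// ge_min lexx orbT.
have Ds y : D (p + e *: y) -> D (p + s *: y).
  move=> De; have se01 : 0 <= s / e <= 1.
    by rewrite divr_ge0 ?(ltW s0) ?(ltW e0)//= ler_pdivrMr// mul1r.
  have := state_simplex_segment Dp De se01.
  by rewrite addrAC subrr add0r scalerA divfK// gt_eqF.
have D1 := Ds z De1.
have D2 : D (p + s *: - z) by apply: Ds; rewrite scalerN.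
have sz1 : `|s *: z| < d1 by apply: lt_le_trans szd _; rewrite ge_min lexx.
have sz2 : `|s *: - z| < d1 by rewrite scalerN normrN.
have n1 : `|p + s *: z - p| < d2.
  by rewrite addrAC subrr add0r; apply: lt_le_trans szd _; rewrite ge_min lexx orbT.
have n2 : `|p + s *: - z - p| < d2.
  by rewrite addrAC subrr add0r scalerN normrN; apply: lt_le_trans szd _; rewrite ge_min lexx orbT.
have m1 := wmin _ D1 n1; have m2 := wmin _ D2 n2.
have t1 := d1P _ sz1; have t2 := d1P _ sz2.
move: t1 t2; rewrite -!scalemxAl !mulNmx !dotZl !dotZr !dotNl !dotNr !mulrN !opprK -/X.
rewrite !ler_norml => /andP[t1 _] /andP[t2 _].
have half : 0 <= (2^-1 : R) <= 1 by rewrite invr_ge0 invf_le1// ler1n ler0n.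
have := cluster_concave D1 D2 half.
have -> : (1 - 2^-1) *: (p + s *: z) + 2^-1 *: (p + s *: - z) = p.
  by apply/rowP => i; rewrite !mxE; field.
have kX : k * (dot z z + 1) * 4 = X by rewrite /k; field; rewrite gt_eqF// ltr_wpDl.
have s20 : 0 < s * s by rewrite mulr_gt0.
have : 2 * (s * s * (k * dot z z)) < s * s * X.
  rewrite mulrCA ltr_pM2l// -kX; move: k0; nra.
move: m1 m2 t1 t2; move: (w _) (w _) (w _) (phi _) (phi _) (phi _) (dot z (grad _ _)).
move=> w1 w2 w3 p1 p2 p3 G.
rewrite (_ : k * (s * (s * dot z z)) = s * s * (k * dot z z)); last by ring.
rewrite (_ : 2^-1 * (s * (s * X)) = 2^-1 * (s * s * X)); last by ring.
by move: (s * s * (k * _)) (s * s * X) (s * G) => x y zz; lra.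
Qed.

Lemma hessian_form_bound (X : 'M[R]_N) z :
  `|dot (z *m X) z| <= N%:R ^+ 2 * `|X| * dot z z.
Proof.
apply: (le_trans (form_le_norm _ _ _)).
by rewrite ler_wpM2l ?mulr_ge0 ?exprn_ge0// -expr2 norm_sqr_le_dot.
Qed.

Lemma cluster_first_order_low phi p : smooth phi ->
  local_min_on D (fun q => w q - phi q) p -> 0 <= r * w p + H p (grad phi p).
Proof.
move=> sphi /local_min_onP[Dp [d2 d20 wmin]].
rewrite leNgt; apply/negP; set G := grad phi p => neg.
pose eta := - (r * w p + H p G).
have eta0 : 0 < eta by rewrite oppr_gt0.
have [d1 d10 d1P] := smooth_taylor2 p sphi (ltr01 (R := R)).
pose rho := Num.min d1 d2 / 2.
have rho0 : 0 < rho by rewrite divr_gt0// lt_min d10.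
have rhod : rho < Num.min d1 d2 by rewrite ltr_pdivrMr ?ltr_pMr ?ltr1n// lt_min d10.
have rho1 : rho < d1 by apply: lt_le_trans rhod _; rewrite ge_min lexx.
have rho2 : rho < d2 by apply: lt_le_trans rhod _; rewrite ge_min lexx orbT.
pose K := N%:R ^+ 2 * `|hess phi p| + 2.
have K0 : 0 <= K by rewrite addr_ge0// mulr_ge0 ?exprn_ge0.
pose psi := quad p (phi p) G (- K)%:M.
have psiE q : psi q = phi p + dot (q - p) G - K * dot (q - p) (q - p).
  by rewrite /psi quad_scalar mulNr.
have wpsi q : D q -> `|q - p| <= rho ->
    w p - psi p + dot (q - p) (q - p) <= w q - psi q.
  move=> Dq qp; have := wmin _ Dq (le_lt_trans qp rho2).
  have := d1P (q - p) (le_lt_trans qp rho1).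
  have -> : p + (q - p) = q by rewrite addrCA subrr addr0.
  have := hessian_form_bound (hess phi p) (q - p).
  rewrite !psiE subrr !dot0l -/G /K mul1r.
  rewrite !ler_norml => /andP[x1 x2] /andP[y1 y2].
  have : 0 <= N%:R ^+ 2 * `|hess phi p| * dot (q - p) (q - p).
    by rewrite mulr_ge0 ?dot_ge0// mulr_ge0// exprn_ge0.
  move: x1 x2 y1 y2; rewrite mulr0 subr0 addr0 (mulrDl _ 2).
  by lra.
pose Xi := `|G| + 2 * K.
pose cH := N%:R ^+ 2 * kQ * (Xi + 2 * K) + r * (N%:R * Mg) + r * L + r + 1.
have kQ0 : 0 <= kQ by exact: rate_bound_ge0.
have Mg0 : 0 <= Mg by exact: payoff_bound_ge0.
have r0 := ltW r_gt0.
have Xi0 : 0 <= Xi by rewrite addr_ge0// mulr_ge0.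
have cH0 : 0 < cH.
  by rewrite ltr_wpDl// !addr_ge0 ?mulr_ge0 ?exprn_ge0 ?addr_ge0// mulr_ge0.
(* the error e forces |p_n - p| <= s *)
pose s := Num.min (rho / 2) (eta / 2 / cH).
have s0 : 0 < s.
  rewrite lt_min (divr_gt0 rho0)//=.
  by rewrite (divr_gt0 _ cH0)// (divr_gt0 eta0).
pose e := Num.min (s ^+ 2 / 2) s.
have e0 : 0 < e by rewrite lt_min s0 divr_gt0// exprn_gt0.
have [E E0 EP] := one_step_low g a0 r_gt0 rateQ.
pose E1 := E Xi K + 1.
have E10 : 0 < E1 by rewrite ltr_wpDl.
pose hmax := Num.min (Num.min (r^-1) (rho / 2 / (E 0 0 + 1))) (eta / 4 / E1).
have E00 : 0 < E 0 0 + 1 by rewrite ltr_wpDl.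
have hmax0 : 0 < hmax.
  rewrite !lt_min invr_gt0 r_gt0/= (divr_gt0 (divr_gt0 rho0 (ltr0n _ 2)) E00)/=.
  exact: (divr_gt0 (divr_gt0 eta0 (ltr0n _ 4)) E10).
have [n0 n00 n0P] := inv_nat_lt hmax0.
have [n nn0 nP] := wP e0 n0.
have n_gt0 : (0 < n)%N by exact: leq_trans nn0.
have hn := n0P n nn0; set h := n%:R^-1 in hn.
have h0 : 0 < h by rewrite invr_gt0 ltr0n.
have cv : {within D, continuous (v n)} by exact: game_value_within.
have vcont : {within D, continuous (fun q => v n q - psi q)}.
  by move=> x; apply: cvgB; [exact: cv|exact: within_quad].
have [pn [Dpn pnp pnmin]] := simplex_ball_min Dp (ltW rho0) vcont.
have pns : `|pn - p| <= s.
  have := pnmin _ Dp _; rewrite subrr normr0 => /(_ (ltW rho0)).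
  have := wpsi _ Dpn pnp; have := nP _ Dpn; have := nP _ Dp.
  rewrite !ler_norml => /andP[x1 x2] /andP[y1 y2] z1 z2.
  have zz : dot (pn - p) (pn - p) <= s ^+ 2.
    have : e <= s ^+ 2 / 2 by rewrite ge_min lexx.
    by move: x1 x2 y1 y2 z1 z2; lra.
  rewrite -(ler_pXn2r (n := 2))// ?nnegrE ?(ltW s0)//.
  exact: le_trans (norm_sqr_le_dot _) zz.
pose xin := G + (pn - p) *m ((- K)%:M + (- K)%:M^T).
have xinE : xin = G - (2 * K) *: (pn - p).
  rewrite /xin tr_scalar_mx mulmxDr mul_mx_scalar -scalerDl.
  by rewrite -scaleNr; congr (_ + _ *: _); ring.
have xinX : `|xin| <= Xi.
  rewrite xinE /Xi; apply: (le_trans (ler_normB _ _)); rewrite lerD2l normrZ.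
  rewrite ger0_norm ?mulr_ge0// -[leRHS]mulr1 ler_wpM2l ?mulr_ge0//.
  exact: state_simplex_normB.
have vlow q : D q -> `|q - pn| <= rho / 2 ->
    v n pn + dot (q - pn) xin - K * dot (q - pn) (q - pn) <= v n q.
  move=> Dq qpn; have qp : `|q - p| <= rho.
    rewrite -(subrKA pn); apply: (le_trans (ler_normD _ _)).
    have : s <= rho / 2 by rewrite ge_min lexx.
    by move: qpn pns; lra.
  have := pnmin _ Dq qp.
  have -> : psi q = psi pn + dot (q - pn) xin - K * dot (q - pn) (q - pn).
    have {1}-> : q = pn + (q - pn) by rewrite addrCA subrr addr0.
    by rewrite /psi quad_shift mul_mx_scalar dotZl -/xin mulNr.
  by lra.
have HH : H pn xin <= H p G + (N%:R ^+ 2 * kQ * (`|p - pn| * `|xin| + `|G - xin|) +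
   r * (N%:R * (`|p - pn| * Mg))).
  exact: (hamiltonian_close g Q a0 b0 r_gt0 pn xin G (state_simplex_norm Dp)).
have HS : H pn xin < - (r * v n pn) - eta / 2.
  apply: (le_lt_trans HH).
  have pnp' : `|p - pn| <= s by rewrite distrC.
  have k1 : `|p - pn| * `|xin| + `|G - xin| <= s * (Xi + 2 * K).
    rewrite mulrDr lerD//; first exact: ler_pM.
    rewrite xinE opprB addrCA subrr addr0 normrZ ger0_norm ?mulr_ge0//.
    by rewrite mulrC ler_wpM2r ?mulr_ge0.
  have k2 : N%:R ^+ 2 * kQ * (`|p - pn| * `|xin| + `|G - xin|) <=
      s * (N%:R ^+ 2 * kQ * (Xi + 2 * K)).
    by rewrite [leRHS]mulrCA ler_wpM2l// mulr_ge0// exprn_ge0.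
  have k3 : r * (N%:R * (`|p - pn| * Mg)) <= s * (r * (N%:R * Mg)).
    rewrite [leRHS](_ : _ = r * (N%:R * (s * Mg))); last by ring.
    by rewrite ler_wpM2l// ler_wpM2l// ler_wpM2r.
  have k4 : r * (v n pn - w p) <= s * (r * L + r).
    rewrite [leRHS](_ : _ = r * (s * L + s)); last by ring.
    rewrite ler_wpM2l//; have := nP _ Dpn; have := cluster_lipschitz Dpn Dp.
    have : L * `|pn - p| <= s * L by rewrite mulrC ler_wpM2r.
    have : e <= s by rewrite ge_min lexx orbT.
    by rewrite !ler_norml => y1 y2 /andP[y3 y4] /andP[y5 y6]; lra.
  have k5 : s * (cH - 1) < eta / 2.
    apply: (@lt_le_trans _ _ (s * cH)); first by rewrite ltr_pM2l// ltrBlDr ltrDl.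
    by rewrite -ler_pdivlMr// ge_min lexx orbT.
  move: k5; rewrite /cH addrK !mulrDr => k5.
  have : H p G = - eta - r * w p by rewrite /eta; ring.
  by move: k2 k3 k4; rewrite !mulrDr mulrN; lra.
have [x xS xH] := hamiltonian_lt a0 b0 HS.
have half h' : 0 <= h' -> 0 < E1 -> h' <= eta / 4 / E1 -> h' * E Xi K <= eta / 4.
  move=> h'0 _; rewrite ler_pdivlMr// => hE; apply: le_trans hE.
  by rewrite ler_wpM2l// /E1 lerDl.
have stage b : v n pn + h * (eta / 4) <= stage_payoff g (transition Q n) (discount r n) Mg pn (fun=> x) b.
  have upd a : update (transition Q n) pn (fun=> x) a b = x a *: (pn *m transition Q n a b).
    rewrite /update scalemxAl; congr (_ *m _); apply/rowP => i; rewrite !mxE; ring.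
  have -> : stage_payoff g (transition Q n) (discount r n) Mg pn (fun=> x) b =
     \sum_a x a * (discount r n * stage_mean g pn a b +
       (1 - discount r n) * v n (pn *m transition Q n a b)).
    apply: eq_bigr => a _; rewrite upd.
    have Dt := state_simplex_transition rateQ n a b Dpn.
    have x0 : 0 <= x a by case: xS.
    have [l0 _ _] := discount_bounds r_gt0 n_gt0.
    rewrite (val_scale (transition_ge0 rateQ n) (transition_sum1 rateQ n) l0
      (payoff_le_bound g) (payoff_bound_ge0 g) a0)//; last by case: Dt.
    rewrite -/(v n _) mulrDr [X in _ = X + _]mulrCA [X in _ = _ + X]mulrCA.
    congr (_ * _ + _); rewrite /stage_mean mulr_sumr; apply: eq_bigr => i _; ring.
  have rh1 : r * h <= 1.
    rewrite -ler_pdivlMl// mulr1; apply: (le_trans hn).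
    by rewrite !ge_min lexx.
  have Erho : E 0 0 * h <= rho / 2.
    apply: (@le_trans _ _ ((E 0 0 + 1) * h)); first by rewrite ler_wpM2r ?(ltW h0)// lerDl.
    rewrite mulrC -ler_pdivlMr//; apply: (le_trans hn).
    by rewrite !ge_min lexx orbT.
  have low a := EP n pn xin Xi K (rho / 2) n_gt0 rh1 Dpn xinX K0 Erho vlow a b.
  apply: (@le_trans _ _ (\sum_a x a * (v n pn - h * (ham pn xin a b + r * v n pn)
      - E Xi K * h ^+ 2))); last first.
    by apply: ler_sum => a _; rewrite ler_wpM2l//; case: xS.
  have -> : \sum_a x a * (v n pn - h * (ham pn xin a b + r * v n pn) - E Xi K * h ^+ 2) =
      v n pn - E Xi K * h ^+ 2 - h * (\sum_a x a * ham pn xin a b + r * v n pn).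
    rewrite -[v n pn - E Xi K * h ^+ 2]mul1r -[r * v n pn in RHS]mul1r -xS.2.
    rewrite !mulr_suml -big_split/= mulr_sumr -sumrB.
    by apply: eq_bigr => a _; ring.
  have hE : h * E Xi K <= eta / 4.
    apply: half => //; first exact: ltW.
    by apply: (le_trans hn); rewrite !ge_min lexx !orbT.
  have xb := ltW (xH b).
  have k1 : h * (h * E Xi K) <= h * (eta / 4) by rewrite ler_pM2l.
  have k2 : h * (\sum_a x a * ham pn xin a b + r * v n pn) <= h * (- (eta / 2)).
    by rewrite ler_pM2l//; move: xb; lra.
  move: k1 k2; rewrite (_ : h * (h * E Xi K) = E Xi K * h ^+ 2); last by ring.
  by lra.
have [l0 _ _] := discount_bounds r_gt0 n_gt0.
have := val_ge_stage (transition_ge0 rateQ n) (transition_sum1 rateQ n) l0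
  (payoff_le_bound g) (payoff_bound_ge0 g) a0 b0 (Dpn.1) (fun=> xS) stage.
rewrite -/(v n pn) leNgt ltrDl => /negP[].
by rewrite mulr_gt0// divr_gt0.
Qed.

Lemma cluster_supersolution : viscosity_supersolution r H w.
Proof.
split; first exact/within_lsc_on/cluster_within.
move=> phi p sphi wmin; rewrite /hj_operator le_min lee_fin.
apply/andP; split; first exact: cluster_first_order_low.
rewrite oppe_ge0; apply: lambda_max_le => z zT _.
by rewrite mul0r; exact: (cluster_second_order sphi wmin).
Qed.

End ClusterPoints.

Section ClusterSubsolution.
Context {R : realType} {N : nat} {A B : finType}.
Variables (g : 'I_N -> A -> B -> R) (r : R) (Q : A -> B -> 'M[R]_N).
Variables (a0 : A) (b0 : B).
Hypothesis r_gt0 : 0 < r.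
Hypothesis rateQ : is_rate Q.
Local Notation v := (game_value g r Q).
Implicit Types (p q xi : 'rV[R]_N).
Local Notation D := (state_simplex (R := R) N).
Local Notation H := (hamiltonian g r Q).
Local Notation ham := (ham_term g r Q).
Local Notation kQ := (rate_bound Q).
Local Notation Mg := (payoff_bound g).
Local Notation L := (Mg * N%:R).

Lemma hamiltonian_step_up : exists2 E : R -> R -> R,
  (forall Xi d, 0 <= E Xi d) &
  forall (n : nat) p xi (Xi d : R), (0 < n)%N -> r * n%:R^-1 <= 2^-1 ->
  D p -> `|xi| <= Xi -> 0 < d ->
  (forall q, D q -> v n q <= v n p + dot (q - p) xi - d * dot (q - p) (q - p)) ->
  r * v n p + H p xi <= E Xi d * n%:R^-1.
Proof.
have [E E0 EP] := one_step_up g a0 r_gt0 rateQ.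
exists E => // n p xi Xi d n0 rn Dp xiX d0 vup.
have [l0 _ _] := discount_bounds r_gt0 n0.
have [x xS xP] := val_le_stage (transition_ge0 rateQ n) (transition_sum1 rateQ n) l0
  (payoff_le_bound g) (payoff_bound_ge0 g) a0 b0 Dp.1.
pose q a : 'rV[R]_N := \row_s (p ord0 s * x s a).
have q0 a s : 0 <= q a ord0 s by rewrite mxE mulr_ge0 ?Dp.1//; case: (xS s).
have sq : \sum_a q a = p.
  apply/rowP => s; rewrite summxE; under eq_bigr do rewrite mxE.
  by rewrite -mulr_sumr (xS s).2 mulr1.
have sm : \sum_a mass (q a) = 1.
  by rewrite /mass exchange_big/= -Dp.2 -[in RHS]sq; apply: eq_bigr => s _; rewrite summxE.
have mS : simplex A (fun a => mass (q a)) by split=> // a; exact: mass_ge0.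
set h := n%:R^-1; have h0 : 0 < h by rewrite invr_gt0 ltr0n.
suff Hle : H p xi <= E Xi d * h - r * v n p by move: Hle; lra.
apply: (hamiltonian_le a0 b0 mS) => b.
have stage : v n p <= \sum_a (mass (q a) * (v n p - h * (ham p xi a b + r * v n p)) +
    (1 - discount r n) * dot (q a - mass (q a) *: p) xi + E Xi d * h ^+ 2 * mass (q a)).
  apply: (le_trans (xP b)); apply: ler_sum => a _.
  apply: le_trans (EP n p xi Xi d n0 rn Dp xiX d0 vup (q a) a b (q0 a)).
  rewrite lerD2r ler_wpM2l//; first by case/andP: l0 => /ltW.
  by apply: ler_sum => s _; rewrite mxE.
have dot0 : \sum_a dot (q a - mass (q a) *: p) xi = 0.
  by rewrite -dot_suml sumrB -scaler_suml sq sm scale1r subrr dot0l.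
move: stage; rewrite !big_split/= -mulr_sumr dot0 mulr0 addr0 -mulr_sumr sm mulr1.
have -> : \sum_a mass (q a) * (v n p - h * (ham p xi a b + r * v n p)) =
    v n p - h * (\sum_a mass (q a) * ham p xi a b + r * v n p).
  move: (v n p) => V.
  rewrite -[V in RHS]mul1r [r * (1 * V)]mulrCA -sm.
  rewrite !mulr_suml -big_split/= mulr_sumr -sumrB.
  by apply: eq_bigr => a _; ring.
rewrite expr2 => stage.
have : h * (\sum_a mass (q a) * ham p xi a b + r * v n p) <= h * (E Xi d * h).
  by move: stage; lra.
by rewrite ler_pM2l//; lra.
Qed.

Lemma local_upper_extend n p pn xi (rho k : R) : (0 < n)%N -> 0 < rho <= 1 -> 0 < k ->
  D pn -> `|pn - p| <= rho / 2 ->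
  (forall q, D q -> `|q - p| <= rho ->
     v n q <= v n pn + dot (q - pn) xi - k * dot (q - pn) (q - pn)) ->
  forall q, D q -> v n q <= v n pn + dot (q - pn) xi - k * (rho / 2) * dot (q - pn) (q - pn).
Proof.
move=> n0 /andP[rho0 rho1] k0 Dpn pnp vup q Dq.
have t0 : 0 < rho / 2 by rewrite divr_gt0.
have t01 : 0 <= rho / 2 <= 1 by rewrite ltW//=; move: rho1; lra.
have qtE : (1 - rho / 2) *: pn + (rho / 2) *: q - pn = (rho / 2) *: (q - pn).
  by apply/rowP => i; rewrite !mxE; ring.
have Dt := state_simplex_convex Dpn Dq t01.
have tp : `|(1 - rho / 2) *: pn + (rho / 2) *: q - p| <= rho.
  rewrite -(subrKA pn) qtE; apply: (le_trans (ler_normD _ _)).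
  have : `|(rho / 2) *: (q - pn)| <= rho / 2.
    rewrite normrZ gtr0_norm// -[leRHS]mulr1 ler_wpM2l ?(ltW t0)//.
    exact: state_simplex_normB.
  by move: pnp; lra.
have := vup _ Dt tp; have := game_value_concave g a0 r_gt0 rateQ n0 Dpn Dq t01.
rewrite qtE !dotZl !dotZr => c1 c2.
have : rho / 2 * (v n q) <= rho / 2 *
    (v n pn + dot (q - pn) xi - k * (rho / 2) * dot (q - pn) (q - pn)).
  by move: c1 c2; move: (dot _ _) (dot _ _) (v n _) => y1 y2 y3; lra.
by rewrite ler_pM2l.
Qed.

Variable w : 'rV[R]_N -> R.
Hypothesis wP : uniform_cluster v w.

(* The test function is tightened so that [w - psi] has a strict quadratic
   maximum at [p], and tilted by [c] times the boundary coordinates to absorb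
   the penalty on the directions leaving the face of [p]. *)
Lemma local_max_penalized phi p : smooth phi ->
  local_max_on D (fun q => w q - phi q) p ->
  (lambda_max p (hess phi p) < 0)%E ->
  forall c : R, 0 < c -> exists (M : 'M[R]_N) (k rho : R),
    [/\ 0 < k, 0 < rho <= 1,
      forall z : 'rV[R]_N, \sum_s z ord0 s = 0 -> dot (z *m M) z <= - k * dot z z &
      forall q, D q -> `|q - p| <= rho ->
        w q - quad p (phi p) (grad phi p + c *: boundary p) M q + k * dot (q - p) (q - p) <=
        w p - phi p].
Proof.
move=> sphi /local_max_onP[Dp [d2 d20 wmax]] /lambda_max_lt0[d d0 Xd] c c0.
have [C C0 CP] := boundary_penalty Dp d0 Xd.
pose X := hess phi p; pose G := grad phi p; pose O := diag_mx (boundary p).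
pose M := 2^-1 *: X + (d / 16)%:M - (C / 2) *: O.
have Mz z : dot (z *m M) z =
    2^-1 * dot (z *m X) z + d / 16 * dot z z - C / 2 * dot (z *m O) z.
  rewrite /M mulmxBr mulmxDr mul_mx_scalar -!scalemxAr.
  by rewrite !(dotDl, dotNl, dotZl).
have k0 : 0 < d / 32 by rewrite divr_gt0.
have [d1 d10 d1P] := smooth_taylor2 p sphi k0.
pose rho := Num.min 1 (Num.min (Num.min d1 d2 / 2) (c / (C / 2 + 1))).
have C1 : 0 < C / 2 + 1 by rewrite ltr_wpDl// divr_ge0.
have rho0 : 0 < rho by rewrite !lt_min ltr01 !divr_gt0// lt_min d10.
have rho1 : rho <= 1 by rewrite ge_min lexx.
have rhod : rho < Num.min d1 d2.
  apply: (@le_lt_trans _ _ (Num.min d1 d2 / 2)); first by rewrite !ge_min lexx orbT.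
  by rewrite ltr_pdivrMr ?ltr_pMr ?ltr1n// lt_min d10.
have rhoc : C / 2 * rho <= c.
  apply: (@le_trans _ _ ((C / 2 + 1) * rho)); first by rewrite ler_wpM2r ?(ltW rho0)// lerDl.
  by rewrite mulrC -ler_pdivlMr// !ge_min lexx !orbT.
exists M, (d / 32), rho; split=> //; first by rewrite rho0.
  move=> z z0; rewrite Mz; have := CP z z0; rewrite -/X -/O.
  have : 0 <= d * dot z z by rewrite mulr_ge0 ?dot_ge0// ltW.
  by lra.
move=> q Dq qp; pose z := q - p.
have qd1 : `|z| < d1 by apply: (le_lt_trans qp); apply: lt_le_trans rhod _; rewrite ge_min lexx.
have qd2 : `|z| < d2.
  by apply: (le_lt_trans qp); apply: lt_le_trans rhod _; rewrite ge_min lexx orbT.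
have := wmax _ Dq qd2; have := d1P _ qd1; rewrite ler_norml => /andP[_].
have -> : p + z = q by rewrite addrC subrK.
rewrite /quad -/z -/G -/X Mz dotDr dotZr => t1 t2.
have : C / 2 * dot (z *m O) z <= c * dot z (boundary p).
  rewrite boundary_formE /dot !mulr_sumr; apply: ler_sum => s _.
  rewrite [boundary p _ _]mxE; have [ps|_] := eqVneq (p ord0 s) 0; last by rewrite mul0r !mulr0.
  have zs0 : 0 <= z ord0 s by rewrite !mxE ps subr0 Dq.1.
  rewrite mul1r mulr1 expr2 mulrA ler_wpM2r//.
  apply: le_trans rhoc; rewrite ler_wpM2l ?divr_ge0//.
  by apply: le_trans qp; apply: le_trans (entry_le_norm z ord0 s); exact: ler_norm.
by move: t1 t2; lra.
Qed.

Lemma cluster_subsolution : viscosity_subsolution r H w.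
Proof.
split; first exact/within_usc_on/(cluster_within a0 r_gt0 rateQ wP).
move=> phi p sphi pmax; rewrite /hj_operator ge_min lee_fin.
rewrite -implyNb -ltNge; apply/implyP => eta0'.
rewrite oppe_le0 leNgt; apply/negP => X0.
have [Dp _] := (local_max_onP _ _).1 pmax.
set G := grad phi p in eta0'.
have kQ0 : 0 <= kQ by exact: rate_bound_ge0.
have Mg0 : 0 <= Mg by exact: payoff_bound_ge0.
have r0 := ltW r_gt0.
have L0 : 0 <= L by rewrite mulr_ge0.
have k20 : 0 <= N%:R ^+ 2 * kQ by rewrite mulr_ge0// exprn_ge0.
pose c := (r * w p + H p G) / 2 / (N%:R ^+ 2 * kQ + 1).
have c0 : 0 < c by rewrite !divr_gt0// ltr_wpDl.
have [M [k [rho [k0 rho01 Mk wpsi]]]] := local_max_penalized sphi pmax X0 c0.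
pose G' := G + c *: boundary p; rewrite -/G -/G' in wpsi.
pose eta := r * w p + H p G'.
have eta0 : 0 < eta.
  have := hamiltonian_close g Q a0 b0 r_gt0 p G G' (state_simplex_norm Dp).
  rewrite subrr normr0 !mul0r !mulr0 addr0 add0r /G' [G + _]addrC addrK normrZ (gtr0_norm c0).
  have bd : `|boundary p| <= 1.
    by apply: norm_le_entries => // i; rewrite mxE; case: eqP => _; rewrite ?normr1 ?normr0.
  have : N%:R ^+ 2 * kQ * (c * `|boundary p|) <= (N%:R ^+ 2 * kQ + 1) * c.
    by apply: ler_pM; rewrite ?(mulr_ge0 (ltW c0)) ?lerDl ?ger_pMr.
  rewrite [X in _ <= X](_ : _ = (r * w p + H p G) / 2); last first.
    by rewrite /c; field; rewrite gt_eqF// ltr_wpDl.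
  by rewrite /eta /G' [c *: _ + G]addrC; move: eta0'; lra.
have [rho0 rho1] := andP rho01.
pose MM := M + M^T.
pose Xi := `|G'| + N%:R * `|MM|.
have Xi0 : 0 <= Xi by rewrite addr_ge0// mulr_ge0.
pose cH := N%:R ^+ 2 * kQ * (`|G'| + N%:R * `|MM|) + r * (N%:R * Mg) + r * L + r + 1.
have cH0 : 0 < cH.
  by rewrite ltr_wpDl// !addr_ge0 ?mulr_ge0 ?exprn_ge0 ?addr_ge0// mulr_ge0.
pose s := Num.min (rho / 2) (eta / 2 / cH).
have s0 : 0 < s.
  rewrite lt_min (divr_gt0 rho0)//=.
  by rewrite (divr_gt0 _ cH0)// (divr_gt0 eta0).
pose e := Num.min (k * s ^+ 2 / 2) s.
have e0 : 0 < e by rewrite lt_min s0 divr_gt0// mulr_gt0// exprn_gt0.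
have [E E0 EP] := hamiltonian_step_up.
pose dd := k * (rho / 2).
have dd0 : 0 < dd by rewrite mulr_gt0// divr_gt0.
pose E1 := E Xi dd + 1.
have E10 : 0 < E1 by rewrite ltr_wpDl.
pose hmax := Num.min (r^-1 / 2) (eta / 4 / E1).
have hmax0 : 0 < hmax.
  rewrite lt_min divr_gt0 ?invr_gt0//=.
  exact: (divr_gt0 (divr_gt0 eta0 (ltr0n _ 4)) E10).
have [n0 n00 n0P] := inv_nat_lt hmax0.
have [n nn0 nP] := wP e0 n0.
have n_gt0 : (0 < n)%N by exact: leq_trans nn0.
have hn := n0P n nn0; set h := n%:R^-1 in hn.
have h0 : 0 < h by rewrite invr_gt0 ltr0n.
pose psi := quad p (phi p) G' M.
have cv : {within D, continuous (v n)} by exact: game_value_within.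
have vcont : {within D, continuous (fun q => psi q - v n q)}.
  by move=> x; apply: cvgB; [exact: within_quad|exact: cv].
have [pn [Dpn pnp pnmin]] := simplex_ball_min Dp (ltW rho0) vcont.
have pns : `|pn - p| <= s.
  have := pnmin _ Dp _; rewrite subrr normr0 => /(_ (ltW rho0)).
  rewrite {2}/psi {1}/quad subrr mul0mx !dot0l !addr0.
  have := wpsi _ Dpn pnp; rewrite -/psi; have := nP _ Dpn; have := nP _ Dp.
  rewrite !ler_norml => /andP[x1 x2] /andP[y1 y2] z1 z2.
  have zz : dot (pn - p) (pn - p) <= s ^+ 2.
    rewrite -(ler_pM2l k0).
    have : e <= k * s ^+ 2 / 2 by rewrite ge_min lexx.
    by move: x1 x2 y1 y2 z1 z2; lra.
  rewrite -(ler_pXn2r (n := 2))// ?nnegrE ?(ltW s0)//.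
  exact: le_trans (norm_sqr_le_dot _) zz.
pose xin := G' + (pn - p) *m MM.
have xinG : `|xin - G'| <= `|pn - p| * (N%:R * `|MM|).
  rewrite /xin [G' + _]addrC addrK mulrCA.
  exact: mulmx_le_norm.
have xinX : `|xin| <= Xi.
  rewrite /Xi -[xin](subrK G') addrC; apply: (le_trans (ler_normD _ _)).
  rewrite lerD2l; apply: (le_trans xinG); rewrite ler_piMl ?mulr_ge0//.
  exact: state_simplex_normB.
have vup q : D q -> `|q - p| <= rho ->
    v n q <= v n pn + dot (q - pn) xin - k * dot (q - pn) (q - pn).
  move=> Dq qp; have := pnmin _ Dq qp.
  have -> : psi q = psi pn + dot (q - pn) xin + dot ((q - pn) *m M) (q - pn).
    have {1}-> : q = pn + (q - pn) by rewrite addrCA subrr addr0.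
    by rewrite /psi quad_shift.
  have := Mk _ (sum_entryB Dq Dpn).
  by lra.
have pnr : `|pn - p| <= rho / 2 by apply: le_trans pns _; rewrite ge_min lexx.
have vup' := local_upper_extend n_gt0 rho01 k0 Dpn pnr vup.
have rh2 : r * h <= 2^-1.
  rewrite -ler_pdivlMl//; apply: (le_trans hn).
  by rewrite ge_min lexx.
have HE := EP n pn xin Xi dd n_gt0 rh2 Dpn xinX dd0 vup'; rewrite -/h in HE.
have hE : E Xi dd * h <= eta / 4.
  apply: (@le_trans _ _ (E1 * h)); first by rewrite ler_wpM2r ?(ltW h0)// lerDl.
  by rewrite mulrC -ler_pdivlMr//; apply: (le_trans hn); rewrite ge_min lexx orbT.
have HH := hamiltonian_close g Q a0 b0 r_gt0 p G' xin (state_simplex_norm Dpn).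
have k2 : N%:R ^+ 2 * kQ * (`|pn - p| * `|G'| + `|xin - G'|) <=
    s * (N%:R ^+ 2 * kQ * (`|G'| + N%:R * `|MM|)).
  rewrite [leRHS]mulrCA ler_wpM2l// mulrDr lerD//; first by rewrite ler_wpM2r.
  by apply: (le_trans xinG); rewrite ler_wpM2r// mulr_ge0.
have k3 : r * (N%:R * (`|pn - p| * Mg)) <= s * (r * (N%:R * Mg)).
  rewrite [leRHS](_ : _ = r * (N%:R * (s * Mg))); last by ring.
  by rewrite ler_wpM2l// ler_wpM2l// ler_wpM2r.
have k4 : r * (w p - v n pn) <= s * (r * L + r).
  rewrite [leRHS](_ : _ = r * (s * L + s)); last by ring.
  rewrite ler_wpM2l//; have := nP _ Dpn.
  have := cluster_lipschitz a0 r_gt0 rateQ wP Dpn Dp.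
  have : L * `|pn - p| <= s * L by rewrite mulrC ler_wpM2r.
  have : e <= s by rewrite ge_min lexx orbT.
  by rewrite !ler_norml => y1 y2 /andP[y3 y4] /andP[y5 y6]; lra.
have k5 : s * (cH - 1) < eta / 2.
  apply: (@lt_le_trans _ _ (s * cH)); first by rewrite ltr_pM2l// ltrBlDr ltrDl.
  by rewrite -ler_pdivlMr// ge_min lexx orbT.
move: k5; rewrite /cH addrK => k5.
have : eta = r * w p + H p G' by [].
by move: k5 k2 k3 k4 HH HE hE eta0; lra.
Qed.

End ClusterSubsolution.

Section Compactness.
Context {R : realType}.

Lemma ultrafilter_limit (V : normedModType R) (K : set V) (U : set_system nat)
    (x : nat -> V) : UltraFilter U -> compact K -> U [set n | K (x n)] ->
  exists2 y, K y & forall e : R, 0 < e -> U [set n | `|x n - y| < e].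
Proof.
move=> UU Kc UK; have [y [Ky xy]] := Kc (x @ U) _ UK.
exists y => // e e0; have [//|Un] := in_ultra_setVsetC [set n | `|x n - y| < e] UU.
have [z [/= h1 h2]] := xy (~` [set z | `|z - y| < e]) _ Un (nbhsx_ballx y e e0).
by case: h1; move: h2; rewrite -ball_normE/= distrC.
Qed.

Lemma lipschitz_cluster (N : nat) (K : set 'rV[R]_N) (f : nat -> 'rV[R]_N -> R)
    (I : set nat) (M L : R) : compact K -> 0 <= L ->
  (forall n p, (0 < n)%N -> K p -> `|f n p| <= M) ->
  (forall n p q, (0 < n)%N -> K p -> K q -> `|f n p - f n q| <= L * `|p - q|) ->
  (forall n0, exists2 n, (n0 <= n)%N & I n) ->
  exists w : 'rV[R]_N -> R, forall e : R, 0 < e -> forall n0,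
    exists n, [/\ (n0 <= n)%N, I n & forall p, K p -> `|f n p - w p| <= e].
Proof.
move=> Kc L0 fM fL Iinf.
have FF : ProperFilter (within I \oo).
  split; last exact: within_filter.
  move=> [n0 _ /= h0]; have [n n0n In] := Iinf n0.
  exact: (h0 n n0n In).
have [U [UU FU]] := ultraFilterLemma FF.
have Ubig n0 : U [set n | [/\ (n0 <= n)%N, I n & (0 < n)%N]].
  by apply: FU; exists n0.+1 => // n /= n0n In; split=> //; [exact: ltnW|exact: leq_ltn_trans n0n].
have wex p : exists y : R, K p -> forall e : R, 0 < e -> U [set n | `|f n p - y| < e].
  have [Kp|nKp] := pselect (K p); last by exists 0.
  have [||y _ yP] := @ultrafilter_limit R^o `[- M, M]%classic U (fun n => f n p) UU.
  - exact: segment_compact.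
  - apply: filterS (Ubig 0%N) => n [_ _ n0] /=.
    by rewrite in_itv/= -ler_norml fM.
  - by exists y.
have [w wP] := choice wex; exists w => e e0 n0; apply: contrapT => bad.
pose Bad n p := K p /\ e < `|f n p - w p|.
have badP n : exists p, (n0 <= n)%N -> I n -> Bad n p.
  have [[n0n In]|nI] := pselect ((n0 <= n)%N /\ I n); last first.
    by exists 0 => n0n In; case: nI.
  apply: contrapT => nb; apply: bad; exists n; split=> // p Kp.
  by rewrite leNgt; apply/negP => epn; apply: nb; exists p.
have [x xP] := choice badP.
have Ux : U [set n | K (x n)].
  by apply: filterS (Ubig n0) => n [n0n In _]; case: (xP n n0n In).
have [y Ky yP] := ultrafilter_limit UU Kc Ux.
have L1 : 0 < L + 1 by rewrite ltr_wpDl.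
have wL p q : K p -> K q -> `|w p - w q| <= L * `|p - q|.
  move=> Kp Kq; apply/ler_addgt0Pr => d d0.
  have d2 : 0 < d / 2 by rewrite divr_gt0.
  have [n [[h1 h2] [_ _ n1]]] := filter_ex
    (filterI (filterI (wP p Kp _ d2) (wP q Kq _ d2)) (Ubig 0%N)).
  have := fL n p q n1 Kp Kq; move: h1 h2 => /=; move: (L * _) => c.
  rewrite !ltr_norml !ler_norml => /andP[x1 x2] /andP[y1 y2] /andP[z1 z2].
  by apply/andP; split; lra.
have e4 : 0 < e / 4 by rewrite divr_gt0.
have [n [[h1 h2] [n0n In n1]]] := filter_ex
  (filterI (filterI (yP _ (divr_gt0 e4 L1)) (wP y Ky _ e4)) (Ubig n0)).
have [Kx ex] := xP n n0n In.
have k : L * `|x n - y| <= e / 4.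
  apply: (@le_trans _ _ ((L + 1) * `|x n - y|)); first by rewrite ler_wpM2r// lerDl.
  by rewrite mulrC -ler_pdivlMr// ltW.
move: ex; apply/negP; rewrite -leNgt.
have := fL n _ _ n1 Kx Ky; have := wL _ _ Kx Ky; move: h2 k => /=.
move: (L * _) => c; rewrite ltr_norml !ler_norml.
move=> /andP[x1 x2] c1 /andP[y1 y2] /andP[z1 z2].
by apply/andP; split; lra.
Qed.

End Compactness.

Section Uniqueness.
Context {R : realType} {N : nat} {A B : finType}.
Variables (g : 'I_N -> A -> B -> R) (r : R) (Q : A -> B -> 'M[R]_N).
Variables (a0 : A) (b0 : B).
Hypothesis r_gt0 : 0 < r.
Hypothesis rateQ : is_rate Q.
Local Notation D := (state_simplex (R := R) N).
Local Notation H := (hamiltonian g r Q).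
Local Notation v := (game_value g r Q).

Lemma viscosity_solution_unique (w w' : 'rV[R]_N -> R) :
  viscosity_solution r H w -> viscosity_solution r H w' ->
  forall p, D p -> w' p = w p.
Proof.
move=> [wsub wsup] [wsub' wsup'] p Dp.
have cw := lsc_usc_within wsup.1 wsub.1.
have cw' := lsc_usc_within wsup'.1 wsub'.1.
apply/eqP; rewrite eq_le; apply/andP; split.
  exact: (comparison a0 b0 r_gt0 rateQ.2 wsub' wsup cw' cw Dp).
exact: (comparison a0 b0 r_gt0 rateQ.2 wsub wsup' cw cw' Dp).
Qed.

Lemma cluster_solution w : uniform_cluster v w -> viscosity_solution r H w.
Proof.
by move=> wP; split; [exact: cluster_subsolution|exact: cluster_supersolution].
Qed.

Lemma game_value_cluster (I : set nat) : (forall n0, exists2 n, (n0 <= n)%N & I n) ->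
  exists2 w, viscosity_solution r H w & forall e : R, 0 < e ->
    exists2 n, I n & forall p, D p -> `|v n p - w p| <= e.
Proof.
move=> Iinf.
have [||||w wP] := @lipschitz_cluster R N D v I (payoff_bound g)
  (payoff_bound g * N%:R) (@compact_state_simplex R N).
- by rewrite mulr_ge0// payoff_bound_ge0.
- by move=> n p; exact: game_value_bound.
- by move=> n p q; exact: game_value_lipschitz.
- exact: Iinf.
exists w; last by move=> e /wP/(_ 0%N)[n [_ In h]]; exists n.
by apply: cluster_solution => e /wP h n0; have [n [n0n _ nP]] := h n0; exists n.
Qed.

Lemma game_value_uniform w : viscosity_solution r H w -> {uniform D, v @ \oo --> w}.
Proof.
move=> wsol P /uniform_nbhs[E [[/= e e0 eE] EP]].
suff [n0 n0P] : exists n0, forall n, (n0 <= n)%N -> forall p, D p -> `|v n p - w p| < e.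
  by exists n0 => // n /n0P h; apply: EP => p Dp; apply: eE; rewrite /= distrC; exact: h.
apply: contrapT => bad.
have [|w' w'sol w'P] := @game_value_cluster [set n | ~ forall p, D p -> `|v n p - w p| < e].
  move=> n0; apply: contrapT => h; apply: bad; exists n0 => n n0n p Dp.
  by apply: contrapT => np; apply: h; exists n => // /(_ p Dp).
have [n /= nbad nP] := w'P _ (divr_gt0 e0 (ltr0n _ 2)).
apply: nbad => p Dp; rewrite -(viscosity_solution_unique wsol w'sol Dp).
by apply: (le_lt_trans (nP p Dp)); rewrite ltr_pdivrMr// ltr_pMr// ltr1n.
Qed.

End Uniqueness.

Theorem theorem7 (R : realType) (N : nat) (A B : finType)
    (g : 'I_N -> A -> B -> R) (r : R) (Q : A -> B -> 'M[R]_N)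
    (A_nonempty : (0 < #|A|)%N) (B_nonempty : (0 < #|B|)%N)
    (r_gt0 : 0 < r) (rateQ : is_rate Q) :
  exists v : nat -> 'rV[R]_N -> R,
    (forall (n : nat) (p : 'rV[R]_N), (0 < n)%N -> state_simplex N p ->
      is_game_value g r Q n p (v n p)) /\
    exists w : 'rV[R]_N -> R,
      [/\ {uniform state_simplex N, v @ \oo --> w},
          viscosity_solution r (hamiltonian g r Q) w
        & forall w' : 'rV[R]_N -> R,
            viscosity_solution r (hamiltonian g r Q) w' ->
            forall p, state_simplex N p -> w' p = w p].
Proof.
have /card_gt0P[a0 _] := A_nonempty; have /card_gt0P[b0 _] := B_nonempty.
exists (game_value g r Q); split; first by move=> n p; exact: game_valueP.
have [|w wsol _] := game_value_cluster g a0 b0 r_gt0 rateQ (I := setT).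
  by move=> n0; exists n0.
exists w; split=> //; first exact: game_value_uniform.
by move=> w' w'sol p Dp; exact: (viscosity_solution_unique a0 b0 r_gt0 rateQ wsol w'sol Dp).
Qed.
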